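(* Let $N=(N_1,\dots,N_d)$ be a multivariate Hawkes process with parameters $\mu\in[0,\infty)^d$ and $\boldsymbol{\varphi}=(\varphi_{ij})_{1\le i,j\le d}$, $\varphi_{ij}:[0,\infty)\to[0,\infty)$. Assume that $\int_0^\infty\varphi_{ij}(t)\,dt<\infty$ for all $i,j$ and that the spectral radius of $\mathbf K=\int_0^\infty\boldsymbol{\varphi}(t)\,dt$ satisfies $\rho(\mathbf K)<1$. Let $X_t=N_t-E(N_t)$ for $t\ge0$ and $X_t=0$ for $t\le 0$. Let $(\Delta_T)_{T>0}$ and $(\tau_T)_{T>0}$ be two families of real numbers with $\Delta_T>0$. If $\Delta_T/T\to0$ and $\tau_T/T\to0$ as $T\to\infty$, then $$\mathbf V_{\Delta_T,T}(X,X_{\tau_T+\cdot})-\mathbf v_{\Delta_T,\tau_T}\to0\quad\text{as }T\to\infty\text{ in }L^2(P),$$ where $$\mathbf v_{\Delta,\tau}=\bigl(1-\tfrac{|\tau|}{\Delta}\bigr)^+\mathbf\Sigma+\int_{[0,\infty)^2}ds\,dt\,\bigl(1-\tfrac{|t-s-\tau|}{\Delta}\bigr)^+\boldsymbol\psi(s)\mathbf\Sigma\,\boldsymbol\psi(t)^\top+\int_0^\infty ds\,\bigl(1-\tfrac{|s+\tau|}{\Delta}\bigr)^+\boldsymbol\psi(s)\mathbf\Sigma+\int_0^\infty ds\,\bigl(1-\tfrac{|s-\tau|}{\Delta}\bigr)^+\mathbf\Sigma\,\boldsymbol\psi(s)^\top,$$ or equivalently $$\mathbf v_{\Delta,\tau}=\int_{[0,\infty)^2}\bigl(1-\tfrac{|t-s-\tau|}{\Delta}\bigr)^+\bigl(\mathbf{Id}\,\delta_0(ds)+\boldsymbol\psi(s)ds\bigr)\mathbf\Sigma\bigl(\mathbf{Id}\,\delta_0(dt)+\boldsymbol\psi(t)^\top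 dt\bigr),$$ with $\mathbf\Sigma$ the diagonal matrix such that $\mathbf\Sigma_{ii}=\bigl((\mathbf{Id}-\mathbf K)^{-1}\mu\bigr)_i$ and $\boldsymbol\psi=\sum_{n\ge1}\boldsymbol\varphi_n$.
   Context: A multivariate Hawkes process with parameters $(\mu,\boldsymbol\varphi)$ is defined as follows. Let $(T_n)_{n\ge1}$ be a non-decreasing sequence of random variables with values in $(0,\infty]$ with $T_n<T_{n+1}$ on $\{T_n<\infty\}$, and $(Z_n)_{n\ge1}$ random variables with values in $\{1,\dots,d\}$. Put $N_{i,t}=\sum_{n\ge1}\mathbf 1_{\{T_n\le t\}\cap\{Z_n=i\}}$ for $t\ge0$ (so $N_{i,0}=0$ and no two components jump simultaneously) and let $\mathscr F_t=\sigma(N_{i,s}:s\le t,\,1\le i\le d)$. Let $\mu_i\ge 0$ and let $\varphi_{ij}:[0,\infty)\to[0,\infty)$ be (Borel) functions. $N$ is a Hawkes process under $P$ if for all $n\ge1$ and $i$ the process $N_{i,t\wedge T_n}-\int_0^{t\wedge T_n}\lambda_{i,s}\,ds$ is an $(\mathscr F_t)$-martingale, where $$\lambda_{i,t}=\mu_i+\int_{(0,t)}\sum_{j=1}^d\varphi_{ij}(t-s)\,dN_{j,s}.$$ No stationarity is assumed. $\mu$, $N_t$, $X_t$ are regarded as column vectors, integrals of matrices are componentwise, $\mathbf{Id}$ is the identity matrix, $\delta_0$ is the Dirac mass at $0$, $x^+=\max(x,0)$, $^\top$ is transposition. The matrix-valued functions $\boldsymbol\varphi_n$ on $[0,\infty)$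 are defined by $\boldsymbol\varphi_1=\boldsymbol\varphi$ and $\boldsymbol\varphi_{n+1}(t)=\int_0^t\boldsymbol\varphi(t-s)\boldsymbol\varphi_n(s)\,ds$; since $\int_0^\infty\boldsymbol\varphi_n(t)\,dt=\mathbf K^n$, the series $\sum_{n\ge1}\boldsymbol\varphi_n$ converges in $L^1(dt)$. For $\mathbb R^d$-valued processes $Z,Z'$ indexed by $\mathbb R$, and $\Delta,T>0$, $$\mathbf V_{\Delta,T}(Z,Z')=\frac1T\sum_{i=1}^{\lfloor T/\Delta\rfloor}\bigl(Z_{i\Delta}-Z_{(i-1)\Delta}\bigr)\bigl(Z'_{i\Delta}-Z'_{(i-1)\Delta}\bigr)^\top,$$ and $Z_{\tau+\cdot}$ denotes the process $t\mapsto Z_{\tau+t}$. *)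

(* Defs.v *)
From mathcomp Require Export all_boot all_order all_algebra.
From mathcomp Require Export all_classical all_reals all_analysis measurable_realfun.
From mathcomp Require Export complex.
Export Order.TTheory GRing.Theory Num.Theory.
Export numFieldNormedType.Exports.

Set Implicit Arguments.
Unset Strict Implicit.
Unset Printing Implicit Defensive.

#[export] Set Implicit Arguments.
#[export] Unset Strict Implicit.
#[export] Unset Printing Implicit Defensive.

Local Open Scope classical_set_scope.
Local Open Scope ring_scope.

Definition mxintegral d (S : measurableType d) (R : realType) m n
    (nu : {measure set S -> \bar R}) (D : set S) (F : S -> 'M[R]_(m, n)) : 'M[R]_(m, n) :=
  \matrix_(i, j) \int[nu]_(x in D) F x i j.

Definition spectral_radius (R : realType) d (A : 'M[R]_d) : R :=
  sup [set ComplexField.Normc.normc a |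
    a in [set a : R[i] | eigenvalue (map_mx (real_complex R) A) a]].

Section point_process.
Context {disp : measure_display} {Omega : measurableType disp} {R : realType}.
Context {d : nat}.
(* Jump times and marks are indexed by n >= 1; their values at n = 0 are
   never used. *)
Variables (T : nat -> Omega -> \bar R) (Z : nat -> Omega -> 'I_d).

Definition marked_point_process : Prop :=
  [/\ forall n, (1 <= n)%N -> measurable_fun setT (T n),
      forall n i, (1 <= n)%N -> measurable (Z n @^-1` [set i]),
      forall n w, (1 <= n)%N -> (0 < T n w)%E,
      forall n w, (1 <= n)%N -> (T n w <= T n.+1 w)%E &
      forall n w, (1 <= n)%N -> (T n w < +oo)%E -> (T n w < T n.+1 w)%E].

(* The value +oo is possible only after an accumulation of jump times. *)
Definition counting_process (i : 'I_d) (t : R) (w : Omega) : \bar R :=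
  (\sum_(1 <= n <oo) ((T n w <= t%:E)%E && (Z n w == i))%:R%:E)%E.

(* The random measure dN_i: a unit mass at each finite jump time of mark i. *)
Definition jump_measure (i : 'I_d) (w : Omega) : {measure set R -> \bar R} :=
  mseries (fun n => if (T n w < +oo)%E && (Z n w == i)
                    then (\d_(fine (T n w)) : {measure set R -> \bar R})
                    else mzero) 1.

Definition natural_filtration (t : R) : set (set Omega) :=
  <<s \bigcup_(i in [set: 'I_d]) \bigcup_(s in `[0, t])
        preimage_set_system setT (counting_process i s) measurable >>.

Definition intensity (mu : 'cV[R]_d) (phi : R -> 'M[R]_d)
    (i : 'I_d) (t : R) (w : Omega) : \bar R :=
  ((mu i 0)%:E +
   \sum_(j < d) \int[jump_measure j w]_(s in `]0%R, t[) (phi (t - s) i j)%:E)%E.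

Definition stopped_compensated (mu : 'cV[R]_d) (phi : R -> 'M[R]_d)
    (n : nat) (i : 'I_d) (t : R) (w : Omega) : \bar R :=
  let tn := fine (Order.min t%:E (T n w)) in
  (counting_process i tn w -
   \int[lebesgue_measure]_(s in `[0%R, tn]) intensity mu phi i s w)%E.

End point_process.

(* Time ranges over [0, +oo[; E(M_t | F_s) = M_s is expressed by the defining
   property of conditional expectation. *)
Definition martingale {disp : measure_display} {Omega : measurableType disp}
    {R : realType} (P : probability Omega R)
    (F : R -> set (set Omega)) (M : R -> Omega -> \bar R) : Prop :=
  [/\ forall t, 0 <= t -> preimage_set_system setT (M t) measurable `<=` F t,
      forall t, 0 <= t -> P.-integrable setT (M t) &
      forall s t A, 0 <= s -> s <= t -> F s A ->
        (\int[P]_(w in A) M t w = \int[P]_(w in A) M s w)%E].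

Definition hawkes_process {disp : measure_display}
    {Omega : measurableType disp} {R : realType} {d : nat}
    (P : probability Omega R) (mu : 'cV[R]_d) (phi : R -> 'M[R]_d)
    (T : nat -> Omega -> \bar R) (Z : nat -> Omega -> 'I_d) : Prop :=
  [/\ forall i, 0 <= mu i 0,
      forall i j, measurable_fun `[(0 : R), +oo[ (fun t : R => phi t i j),
      forall i j t, 0 <= t -> 0 <= phi t i j,
      marked_point_process T Z &
      forall n i, (1 <= n)%N ->
        martingale P (natural_filtration T Z)
          (stopped_compensated T Z mu phi n i)].

Section covariation.
Context {disp : measure_display} {Omega : measurableType disp} {R : realType}.
Context {d : nat}.

Definition centered_process (P : probability Omega R)
    (T : nat -> Omega -> \bar R) (Z : nat -> Omega -> 'I_d)
    (t : R) (w : Omega) : 'cV[R]_d :=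
  if t <= 0 then 0 else
  \col_i (fine (counting_process T Z i t w) -
          fine (\int[P]_w' counting_process T Z i t w')%E).

Definition covariation (Delta H : R) (Y Y' : R -> 'cV[R]_d) : 'M[R]_d :=
  H^-1 *: \sum_(1 <= i < (Num.truncn (H / Delta)).+1)
    (Y (i%:R * Delta) - Y ((i%:R - 1) * Delta)) *m
    (Y' (i%:R * Delta) - Y' ((i%:R - 1) * Delta))^T.

(* Convergence in L^2(P) of a random matrix, entry by entry. *)
Definition cvg0_L2 (P : probability Omega R) (Y : R -> Omega -> 'M[R]_d) :=
  forall i j, ('N[P]_2%:E [ (fun w => (Y H w i j)%:E) ])%E @[H --> +oo%R] --> 0%E.

End covariation.

Section limit.
Context {R : realType} {d : nat}.
Variables (mu : 'cV[R]_d) (phi : R -> 'M[R]_d).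

Definition branching_matrix : 'M[R]_d :=
  mxintegral lebesgue_measure `[0, +oo[ phi.

(* The convolution integral may be infinite for t in a Lebesgue-null set, on
   which the real-valued integral takes the junk value 0; this affects none of
   the integrals in which phi_pow and psi occur. *)
Definition convolve (f : R -> 'M[R]_d) (t : R) : 'M[R]_d :=
  mxintegral lebesgue_measure `[0, t] (fun s => phi (t - s) *m f s).

(* phi_n for n >= 1 *)
Definition phi_pow (n : nat) : R -> 'M[R]_d := iter n.-1 convolve phi.

(* The terms are nonnegative, so this pointwise sum represents the sum of the
   series in L^1; it is finite almost everywhere when the latter converges. *)
Definition psi (t : R) : 'M[R]_d :=
  \matrix_(i, j) fine (\sum_(1 <= n <oo) (phi_pow n t i j)%:E)%E.

Definition Sigma : 'M[R]_d :=
  diag_mx (invmx (1%:M - branching_matrix) *m mu)^T.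

Definition tent (Delta x : R) : R := Num.max (1 - `|x| / Delta) 0.

Definition limit_cov (Delta tau : R) : 'M[R]_d :=
  tent Delta tau *: Sigma
  + mxintegral (lebesgue_measure \x lebesgue_measure)%E
      (`[0, +oo[ `*` `[0, +oo[)
      (fun st => tent Delta (st.2 - st.1 - tau) *:
                 (psi st.1 *m Sigma *m (psi st.2)^T))
  + mxintegral lebesgue_measure `[0, +oo[
      (fun s => tent Delta (s + tau) *: (psi s *m Sigma))
  + mxintegral lebesgue_measure `[0, +oo[
      (fun s => tent Delta (s - tau) *: (Sigma *m (psi s)^T)).

(* The (i, j) entry of the matrix-valued measure Id delta_0(ds) + psi(s) ds on
   [0, +oo[, as a bare set function: it is a measure as soon as psi is
   measurable and nonnegative on [0, +oo[. *)
Definition cluster_measure (i j : 'I_d) (A : set R) : \bar R :=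
  ((1%:M i j : R)%:E * \d_(0%R : R) A +
   \int[lebesgue_measure]_(s in A `&` `[0%R, +oo[) (psi s i j)%:E)%E.

Definition limit_cov_measure (Delta tau : R) : 'M[R]_d :=
  \matrix_(i, j) \sum_(k < d) \sum_(l < d)
    fine (\int[cluster_measure i k \x cluster_measure j l]_(st in
            `[0%R, +oo[ `*` `[0%R, +oo[)
          (tent Delta (st.2 - st.1 - tau) * Sigma k l)%:E)%E.

End limit.

(* Main.v *)
(* Write M = N - L for the compensated process, L being the compensator, and
   kappa for the matrix-valued measure Id delta_0 + psi(s) ds. Solving the
   renewal equation of the intensity gives, path by path and almost surely,
       X_t = (kappa * M)_t = int kappa(ds) M_{t - s},
   with E N_t = int kappa(ds) mu (t - s)^+. Hence V(X, X_{tau + .}) - v is the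
   integral against kappa_ik(ds) kappa_jl(dt) of the error terms
       (1/T) sum_p (M^k increment on cell p, shifted by -s)
                   (M^l increment on cell p, shifted by tau - t)
         - 1(k = l) (1 - |t - s - tau| / Delta)^+ Sigma_kk,
   and by Cauchy-Schwarz it suffices to bound the second moments of these.
   Since no two jumps are simultaneous, the product of two increments of M,
   minus the number of common jumps when k = l, is centered given the past; the
   products over distinct cells are orthogonal, and fourth moments of M bound
   each of them. The number of common jumps is in turn close to its mean, which
   differs from its stationary value only by the tails of kappa.
   Moments are first computed for the processes stopped at the n-th jump, whose
   compensators have a deterministic modulus of continuity, so that martingale
   increments can be handled through ever finer subdivisions. *)

From HB Require Import structures.
Require Import Defs.
From mathcomp Require Import ring lra.

Local Open Scope classical_set_scope.
Local Open Scope ring_scope.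

(** * Integrals of bounded functions *)

(** The order of the moment bounds avoids a circle. Fourth moments of M reduce to second moments of
    the compensator. These come from the representation by [kap], which needs only second moments of
    M, that is, first moments of N; it gives second moments of N, then of L = N - M. Stopping only
    shrinks increments, so the bounds are uniform in the stopping index and Fatou's lemma removes
    the stopping. The function phi is merely integrable and the kernel may have heavy tails. Errors
    caused by a delay r are therefore kept in the form min(1, |r| / T), whose integral against a
    finite measure tends to 0 without any rate. The condition on the spectral radius becomes usable
    through Cayley-Hamilton: the characteristic polynomial, removed one root at a time, turns
    summability of the powers of K into scalar recursions with ratios below 1. The inverse of Id - K
    is then a sum of nonnegative matrices, which allows inequalities between mean vectors to be
    inverted; this also excludes explosion. *)

Definition bounded_measurable d (T : measurableType d) (R : realType)
    (f : T -> R) : Prop :=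
  measurable_fun setT f /\ exists c, forall x, `|f x| <= c.

Section bounded_measurable_theory.
Context d (T : measurableType d) (R : realType).
Implicit Types f g : T -> R.

Lemma bounded_measurable_cst (c : R) : bounded_measurable (fun _ : T => c).
Proof. by split; [exact: measurable_cst | exists `|c|]. Qed.

Lemma bounded_measurableD f g : bounded_measurable f -> bounded_measurable g ->
  bounded_measurable (fun x => f x + g x).
Proof.
move=> [mf [a fa]] [mg [b gb]]; split; first exact: measurable_funD.
by exists (a + b) => x; rewrite (le_trans (ler_normD _ _))// lerD.
Qed.

Lemma bounded_measurableM f g : bounded_measurable f -> bounded_measurable g ->
  bounded_measurable (fun x => f x * g x).
Proof.
move=> [mf [a fa]] [mg [b gb]]; split; first exact: measurable_funM.
by exists (a * b) => x; rewrite normrM ler_pM.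
Qed.

Lemma bounded_measurableZ (c : R) f : bounded_measurable f ->
  bounded_measurable (fun x => c * f x).
Proof. by move=> bf; apply: bounded_measurableM bf; exact: bounded_measurable_cst. Qed.

Lemma bounded_measurableN f : bounded_measurable f ->
  bounded_measurable (fun x => - f x).
Proof.
move=> /(bounded_measurableZ (-1)).
by under eq_fun do rewrite mulN1r.
Qed.

Lemma bounded_measurableB f g : bounded_measurable f -> bounded_measurable g ->
  bounded_measurable (fun x => f x - g x).
Proof.
move=> bf bg; apply: (@bounded_measurableD f (fun x => - g x)) => //.
exact: bounded_measurableN.
Qed.

Lemma bounded_measurableX f n : bounded_measurable f ->
  bounded_measurable (fun x => f x ^+ n).
Proof.
move=> bf; elim: n => [|n IH].
  by under eq_fun do rewrite expr0; exact: bounded_measurable_cst.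
by under eq_fun do rewrite exprS; exact: bounded_measurableM.
Qed.

Lemma bounded_measurable_norm f : bounded_measurable f ->
  bounded_measurable (fun x => `|f x|).
Proof.
move=> [mf [a fa]]; split; last by exists a => x; rewrite normr_id.
exact: measurableT_comp.
Qed.

Lemma bounded_measurable_sum (I : Type) (r : seq I) (P : pred I) (f : I -> T -> R) :
  (forall i, P i -> bounded_measurable (f i)) ->
  bounded_measurable (fun x => \sum_(i <- r | P i) f i x).
Proof.
move=> bf; elim: r => [|i r IH].
  by under eq_fun do rewrite big_nil; exact: bounded_measurable_cst.
under eq_fun do rewrite big_cons.
case: (boolP (P i)) => // Pi.
by apply: bounded_measurableD IH; exact: bf.
Qed.

End bounded_measurable_theory.

Section finite_integral.
Context d (T : measurableType d) (R : realType).
Variable mu : {finite_measure set T -> \bar R}.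
Implicit Types f g : T -> R.

Lemma bounded_measurable_integrable f : bounded_measurable f ->
  mu.-integrable setT (EFin \o f).
Proof.
move=> [mf [c fc]]; apply: measurable_bounded_integrable => //.
  exact: fin_num_fun_lty.
exists c; split; first exact: num_real.
by move=> x cx y _ /=; rewrite (le_trans (fc y))// ltW.
Qed.
Let bi := bounded_measurable_integrable.

Lemma Rint_add f g : bounded_measurable f -> bounded_measurable g ->
  \int[mu]_x (f x + g x) = \int[mu]_x f x + \int[mu]_x g x.
Proof. by move=> bf bg; rewrite RintegralD//; exact: bi. Qed.

Lemma Rint_sub f g : bounded_measurable f -> bounded_measurable g ->
  \int[mu]_x (f x - g x) = \int[mu]_x f x - \int[mu]_x g x.
Proof. by move=> bf bg; rewrite RintegralB//; exact: bi. Qed.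

Lemma Rint_scale c f : bounded_measurable f ->
  \int[mu]_x (c * f x) = c * \int[mu]_x f x.
Proof. by move=> bf; rewrite RintegralZl//; exact: bi. Qed.

Lemma Rint_sum (I : Type) (r : seq I) (P : pred I) (f : I -> T -> R) :
  (forall i, P i -> bounded_measurable (f i)) ->
  \int[mu]_x (\sum_(i <- r | P i) f i x) = \sum_(i <- r | P i) \int[mu]_x f i x.
Proof.
move=> bf; elim: r => [|i r IH].
  under eq_Rintegral do rewrite big_nil; rewrite big_nil.
  by rewrite Rintegral_cst// mul0r.
under eq_Rintegral do rewrite big_cons; rewrite big_cons.
case: ifPn => // Pi; rewrite Rint_add ?IH//; first exact: bf.
exact: bounded_measurable_sum.
Qed.

Lemma Rint_le f g : bounded_measurable f -> bounded_measurable g ->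
  (forall x, f x <= g x) -> \int[mu]_x f x <= \int[mu]_x g x.
Proof. by move=> bf bg fg; apply: le_Rintegral => //; exact: bi. Qed.

Lemma Rint_norm f : bounded_measurable f ->
  `|\int[mu]_x f x| <= \int[mu]_x `|f x|.
Proof. by move=> bf; apply: le_normr_Rintegral => //; exact: bi. Qed.

Lemma Rint_EFin f : bounded_measurable f ->
  (\int[mu]_x f x)%:E = (\int[mu]_x (f x)%:E)%E.
Proof. by move=> bf; rewrite /Rintegral fineK//; apply: integrable_fin_num => //; exact: bi. Qed.

(** Dominated convergence. It serves for errors along subdivisions, which vanish exactly once the
    mesh separates the jumps, but from an index depending on the path. *)
Lemma Rint_eventually0 (f : nat -> T -> R) c :
  (forall n, measurable_fun setT (f n)) ->
  (forall n x, `|f n x| <= c) ->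
  (forall x, exists n0, forall n, (n0 <= n)%N -> f n x = 0) ->
  forall e, 0 < e -> exists n0, forall n, (n0 <= n)%N -> \int[mu]_x `|f n x| <= e.
Proof.
move=> mf fc f0 e e0.
have bf n : bounded_measurable (f n) by split => //; exists c.
have cvgf x : (fun n => (`|f n x|)%:E) @ \oo --> 0%:E.
  have [n0 n0P] := f0 x; apply/cvg_EFin; first by apply: nearW => n.
  apply: (cvg_near_cst _); exists n0 => // n /= n0n.
  by rewrite /comp /= n0P// normr0.
have dom : {ae mu, forall x n, setT x -> (`|(`|f n x|)%:E| <= (cst c%:E) x)%E}.
  by apply: aeW => x n _; rewrite /= lee_fin normr_id.
have [_ _] := @dominated_convergence _ T R mu setT measurableT
  (fun n x => (`|f n x|)%:E) (cst 0%:E) (cst c%:E)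
  (fun n => (measurable_EFinP _ _).2 (bounded_measurable_norm (bf n)).1)
  (measurable_cst _) (aeW _ (fun x _ => cvgf x))
  (bi (bounded_measurable_cst T c)) dom.
rewrite integral0 => /fine_cvgP[_ /cvgrPdist_le/(_ _ e0)[n0 _ H]].
exists n0 => n /H /=; rewrite sub0r normrN; apply: le_trans.
by rewrite ler_norm.
Qed.

End finite_integral.

Lemma measurable_g_sigma_sub d (T : measurableType d) (G : set (set T)) d' (U : measurableType d')
    (f : T -> U) :
  G `<=` measurable ->
  measurable_fun setT (f : g_sigma_algebraType G -> U) -> measurable_fun setT f.
Proof.
move=> Gm mf _ B mB; have := mf measurableT B mB.
by apply: smallest_sub => //; exact: sigma_algebra_measurable.
Qed.

Lemma staircase_approx (R : realType) (e x : R) (K : nat) : 0 < e -> 0 <= x ->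
  let s := e * \sum_(j < K) (j.+1%:R * e <= x)%R%:R in
  if (K%:R * e <= x)%R then s = K%:R * e else (s <= x) && (x < s + e).
Proof.
move=> e0 x0 /=; elim: K => [|K IH].
  by rewrite mul0r x0 big_ord0 mulr0.
rewrite big_ord_recr /= mulrDr.
have K1 : K.+1%:R * e = K%:R * e + e by rewrite -natr1; ring.
case: (boolP (_ <= x)%R) IH; rewrite K1 => xK.
  have [Kx|] := boolP (K%:R * e + e <= x); first by move=> ->; rewrite mulr1.
  by rewrite -ltNge => Kx ->; rewrite mulr0 addr0 xK Kx.
have [Kx|_] := boolP (K%:R * e + e <= x); last by rewrite mulr0 addr0.
by move: xK; rewrite -ltNge; lra.
Qed.

(** Rounding [W + c] down to a multiple of [e] gives a combination of indicators of superlevel sets,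
    which lie in the sigma-algebra and annihilate [D]. The rounding error costs at most [e] times
    the integral of [|D|]. *)
Lemma Rint_mul_eq0 d (T : measurableType d) (R : realType)
    (mu : {finite_measure set T -> \bar R}) (G : set (set T)) (W D : T -> R) :
  G `<=` measurable ->
  bounded_measurable (W : g_sigma_algebraType G -> R) ->
  bounded_measurable D ->
  (forall A, <<s G >> A -> \int[mu]_(x in A) D x = 0) ->
  \int[mu]_x (W x * D x) = 0.
Proof.
move=> Gm [mW [c Wc]] bD D0.
have Gs A : <<s G >> A -> measurable A.
  by move=> GA; apply: smallest_sub GA => //; exact: sigma_algebra_measurable.
have bW : bounded_measurable W.
  by split; [exact: measurable_g_sigma_sub Gm mW | exists c].
have c0 : 0 <= c by apply: le_trans (Wc point); exact: normr_ge0.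
have D1 : \int[mu]_x D x = 0.
  by apply: D0; exact: (@measurableT _ (g_sigma_algebraType G)).
have bDn := bounded_measurable_norm bD.
suff H e : 0 < e -> `|\int[mu]_x (W x * D x)| <= e * \int[mu]_x `|D x|.
  apply/eqP; rewrite -normr_le0; apply/ler_addgt0Pr => e e0.
  have I0 : 0 <= \int[mu]_x `|D x| by exact: Rintegral_ge0.
  set I := Rintegral _ _ _ in I0 H.
  have e'0 : 0 < e / (I + 1) by apply: divr_gt0 => //; lra.
  apply: (le_trans (H _ e'0)); rewrite add0r mulrAC ler_pdivrMr; last lra.
  by rewrite ler_pM2l//; lra.
move=> e0.
(* Since [W + c] takes values in [0, 2c], the cap [K * e] is never reached. *)
pose K := (Num.truncn (2 * c / e)).+1.
have Kc : 2 * c < K%:R * e.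
  by rewrite -ltr_pdivrMr// /K; apply: truncnS_gt.
pose A j := [set x | j.+1%:R * e <= W x + c].
have GA j : <<s G >> (A j).
  have := mW measurableT _ (measurable_itv `[(j.+1%:R * e - c), +oo[).
  rewrite setTI; congr (<<s G >> _); apply/seteqP.
  by split => x /=; rewrite in_itv /= andbT /A /= lerBlDr.
have bA j : bounded_measurable (fun x => \1_(A j) x : R).
  split; first by apply: measurable_indic; exact: Gs.
  by exists 1 => x; rewrite indicE normr_nat; case: (_ \in _).
have AD j : \int[mu]_x (\1_(A j) x * D x) = 0.
  rewrite -[RHS](D0 _ (GA j)) [RHS]Rintegral_mkcond.
  by apply: eq_Rintegral => x _; rewrite patchE indicE; case: ifP; rewrite ?mul1r ?mul0r.
pose S x := \sum_(j < K) \1_(A j) x : R.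
have bS : bounded_measurable S by apply: bounded_measurable_sum => j _; exact: bA.
have SD : \int[mu]_x (S x * D x) = 0.
  under eq_Rintegral do rewrite /S mulr_suml.
  rewrite Rint_sum; first by rewrite big1// => j _; exact: AD.
  by move=> j _; exact: bounded_measurableM.
have -> : \int[mu]_x (W x * D x) =
   \int[mu]_x ((W x + c - e * S x) * D x).
  have -> : \int[mu]_x ((W x + c - e * S x) * D x) =
    \int[mu]_x ((W x * D x + c * D x) - e * (S x * D x)).
    by apply: eq_Rintegral => x _; ring.
  have bWD := bounded_measurableM bW bD.
  have bcD := bounded_measurableZ c bD.
  have bSD := bounded_measurableM bS bD.
  rewrite Rint_sub ?Rint_add//; [|exact: bounded_measurableD|exact: bounded_measurableZ].
  by rewrite !Rint_scale// D1 SD; ring.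
have bWS : bounded_measurable (fun x => W x + c - e * S x).
  apply: bounded_measurableB; last exact: bounded_measurableZ.
  by apply: bounded_measurableD => //; exact: bounded_measurable_cst.
have bWSD := bounded_measurableM bWS bD.
apply: (le_trans (Rint_norm mu bWSD)).
rewrite -Rint_scale//; apply: Rint_le; first exact: bounded_measurable_norm.
  exact: bounded_measurableZ.
move=> x; rewrite normrM; apply: ler_wpM2r => //.
have Wx0 : 0 <= W x + c by have := Wc x; rewrite ler_norml; lra.
have Wxc : W x + c <= 2 * c by have := Wc x; rewrite ler_norml; lra.
have := staircase_approx K e0 Wx0; rewrite /= lt_geF; last by lra.
rewrite (_ : \sum_(j < K) _ = S x); last first.
  by apply: eq_bigr => j _; rewrite indicE mem_setE /A.
by move=> /andP[? ?]; rewrite ler_norml; lra.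
Qed.

(** * Martingale calculus for compensated counting processes *)

Definition subdivision (R : realType) (a b : R) (m q : nat) : R :=
  a + q%:R * ((b - a) / m.+1%:R).

Section subdivision_theory.
Context (R : realType).
Implicit Types a b : R.

Lemma subdivision0 a b m : subdivision a b m 0 = a.
Proof. by rewrite /subdivision mul0r addr0. Qed.

Lemma subdivision_last a b m : subdivision a b m m.+1 = b.
Proof. by rewrite /subdivision mulrCA divff ?pnatr_eq0//; ring. Qed.

Lemma subdivision_mono a b m p q : a <= b -> (p <= q)%N ->
  subdivision a b m p <= subdivision a b m q.
Proof.
move=> ab pq; rewrite lerD2l ler_wpM2r ?ler_nat//.
by rewrite divr_ge0 ?ler0n//; lra.
Qed.

Lemma subdivision_ge a b m q : a <= b -> a <= subdivision a b m q.
Proof. by move=> ab; rewrite -[leLHS](subdivision0 a b m) subdivision_mono. Qed.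

Lemma subdivision_le a b m q : a <= b -> (q <= m.+1)%N -> subdivision a b m q <= b.
Proof. by move=> ab qm; rewrite -[leRHS](subdivision_last a b m) subdivision_mono. Qed.

Lemma subdivisionS a b m q :
  subdivision a b m q.+1 - subdivision a b m q = (b - a) / m.+1%:R.
Proof. by rewrite /subdivision -natr1; ring. Qed.

Lemma subdivision_mesh a b h : a <= b -> 0 < h -> exists m0, forall m, (m0 <= m)%N ->
  (b - a) / m.+1%:R <= h.
Proof.
move=> ab h0; exists (Num.truncn ((b - a) / h)) => m m0m.
rewrite ler_pdivrMr ?ltr0n// mulrC -ler_pdivrMr//.
by apply: (le_trans (ltW (truncnS_gt _))); rewrite ler_nat.
Qed.

Lemma sum_subdivision (f : R -> R) a b m :
  \sum_(q < m.+1) (f (subdivision a b m q.+1) - f (subdivision a b m q)) = f b - f a.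
Proof.
rewrite -(big_mkord xpredT (fun q => f (subdivision a b m q.+1) - f (subdivision a b m q))).
by rewrite telescope_sumr// subdivision0 subdivision_last.
Qed.

End subdivision_theory.

(* [N k] counts the jumps of mark [k]; [c_simple] says that fine subdivisions
   separate the jumps. The filtration is given by generators. *)
Record compensated_counting d (Om : measurableType d) (R : realType)
  (P : probability Om R) (n : nat) (F : R -> set (set Om))
  (N L : 'I_n -> R -> Om -> R) : Prop := CompensatedCounting {
  c_sub : forall t, F t `<=` measurable ;
  c_filt : forall s t, s <= t -> <<s F s >> `<=` <<s F t >> ;
  c_meas : forall k t, measurable_fun setT (N k t) ;
  c_adapted : forall k t,
    measurable_fun setT ((fun w => N k t w - L k t w) : g_sigma_algebraType (F t) -> R) ;
  c_N_mono : forall k s t w, s <= t -> N k s w <= N k t w ;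
  c_L_mono : forall k s t w, s <= t -> L k s w <= L k t w ;
  c_N_bnd : exists c, forall k t w, `|N k t w| <= c ;
  c_L_bnd : forall t, exists c, forall k w, `|L k t w| <= c ;
  c_L_cont : forall e, 0 < e -> exists2 h, 0 < h & forall k s t w,
    s <= t -> t - s <= h -> L k t w - L k s w <= e ;
  c_simple : forall w a b, a <= b -> exists m0, forall m, (m0 <= m)%N ->
    forall q, (q <= m)%N -> forall k l,
    let D k := N k (subdivision a b m q.+1) w - N k (subdivision a b m q) w in
    (D k = 0 \/ D k = 1) /\ (k != l -> D k * D l = 0) ;
  c_mart : forall k s t A, s <= t -> <<s F s >> A ->
    \int[P]_(w in A) (N k t w - L k t w) = \int[P]_(w in A) (N k s w - L k s w)
}.

Lemma Rint_cst d (T : measurableType d) (R : realType) (P : probability T R) (c : R) :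
  \int[P]_w c = c.
Proof.
rewrite Rintegral_cst// -[RHS]mulr1; congr (_ * _).
by rewrite (_ : _ setT = 1%E)//; exact: probability_setT.
Qed.

Section compensated_counting_theory.
Context d (Om : measurableType d) (R : realType) (P : probability Om R) (n : nat).
Variables (F : R -> set (set Om)) (N L : 'I_n -> R -> Om -> R).
Hypothesis H : compensated_counting P F N L.

Let dN k s t w := N k t w - N k s w.
Let dL k s t w := L k t w - L k s w.
Let dM k s t w := (N k t w - L k t w) - (N k s w - L k s w).
Let pt := @subdivision R.
Let ad t (f : Om -> R) := bounded_measurable (f : g_sigma_algebraType (F t) -> R).

Lemma ad_bounded_measurable t f : ad t f -> bounded_measurable f.
Proof.
move=> [mf [c fc]]; split; last by exists c.
by apply: measurable_g_sigma_sub mf; exact: c_sub H t.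
Qed.

Lemma ad_mono s t f : s <= t -> ad s f -> ad t f.
Proof.
move=> st [mf [c fc]]; split; last by exists c.
by move=> _ B mB; apply: (c_filt H st); exact: mf.
Qed.

Lemma N_bounded k t : bounded_measurable (N k t).
Proof.
by split; [exact: c_meas H k t | have [c cP] := c_N_bnd H; exists c => w; exact: cP].
Qed.

Lemma M_ad k t : ad t (fun w => N k t w - L k t w).
Proof.
split; first exact: c_adapted H k t.
have [c cP] := c_N_bnd H; have [c' c'P] := c_L_bnd H t; exists (c + c') => w.
by rewrite (le_trans (ler_normB _ _))// lerD.
Qed.

Lemma dM_ad k s t : s <= t -> ad t (dM k s t).
Proof.
move=> st; apply: bounded_measurableB; first exact: M_ad.
by apply: (ad_mono st); exact: M_ad.
Qed.

Lemma dN_bounded k s t : bounded_measurable (dN k s t).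
Proof. by apply: bounded_measurableB; exact: N_bounded. Qed.

Lemma dM_bounded k s t : bounded_measurable (dM k s t).
Proof. by apply: bounded_measurableB; apply: ad_bounded_measurable; exact: M_ad. Qed.

Lemma dL_bounded k s t : bounded_measurable (dL k s t).
Proof.
have -> : dL k s t = (fun w => dN k s t w - dM k s t w).
  by apply/funext => w; rewrite /dL /dN /dM; ring.
by apply: bounded_measurableB; [exact: dN_bounded|exact: dM_bounded].
Qed.

Lemma dN_ge0 k s t w : s <= t -> 0 <= dN k s t w.
Proof. by move=> st; rewrite subr_ge0; exact: c_N_mono H _ _ _ _ st. Qed.

Lemma dL_ge0 k s t w : s <= t -> 0 <= dL k s t w.
Proof. by move=> st; rewrite subr_ge0; exact: c_L_mono H _ _ _ _ st. Qed.

Lemma martingale_orthogonal k s t W : s <= t -> ad s W ->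
  \int[P]_w (W w * dM k s t w) = 0.
Proof.
move=> st adW; apply: (Rint_mul_eq0 (c_sub H (t := s)) adW (dM_bounded k s t)) => A FA.
have mA : measurable A.
  apply: smallest_sub FA; first exact: sigma_algebra_measurable.
  exact: c_sub H s.
have iM t' : P.-integrable A (EFin \o (fun w => N k t' w - L k t' w)).
  apply: (@integrableS _ _ _ P setT) => //.
  by apply: bounded_measurable_integrable; apply: ad_bounded_measurable; exact: M_ad.
by rewrite /dM RintegralB// (c_mart H k st FA) subrr.
Qed.

Lemma total_bound : exists2 C, 0 < C & forall k s t w, s <= t -> dN k s t w <= C.
Proof.
have [c cP] := c_N_bnd H; exists (2 * `|c| + 1).
  by have := normr_ge0 c; lra.
move=> k s t w st; have := cP k t w; have := cP k s w; have := ler_norm c.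
rewrite !ler_norml /dN; lra.
Qed.

Lemma compensator_increment_bound a b : exists2 C, 0 < C & forall k s t w,
  a <= s -> s <= t -> t <= b -> dL k s t w <= C.
Proof.
have [c cP] := c_L_bnd H a; have [c' c'P] := c_L_bnd H b.
exists (`|c| + `|c'| + 1); first by have := normr_ge0 c; have := normr_ge0 c'; lra.
move=> k s t w sa st tb.
have := c_L_mono H k w sa; have := c_L_mono H k w tb.
have := cP k w; have := c'P k w; have := ler_norm c; have := ler_norm c'.
rewrite !ler_norml /dL; lra.
Qed.

(** [qerr] compares the quadratic covariation of the martingales along a subdivision with the number
    of common jumps. [jerr] makes the same comparison for the jump parts alone, and [jerr4] compares
    fourth powers of jumps with jumps; both vanish when every cell holds at most one jump. *)
Let qerr k l a b m w := \sum_(q < m.+1)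
  (dM k (pt a b m q) (pt a b m q.+1) w * dM l (pt a b m q) (pt a b m q.+1) w
   - (k == l)%:R * dN k (pt a b m q) (pt a b m q.+1) w).
Let jerr k l a b m w := \sum_(q < m.+1)
  `|dN k (pt a b m q) (pt a b m q.+1) w * dN l (pt a b m q) (pt a b m q.+1) w
   - (k == l)%:R * dN k (pt a b m q) (pt a b m q.+1) w|.
Let jerr4 k a b m w := \sum_(q < m.+1)
  `|dN k (pt a b m q) (pt a b m q.+1) w ^+ 4 - dN k (pt a b m q) (pt a b m q.+1) w|.

Lemma sum_dN k a b m w : \sum_(q < m.+1) dN k (pt a b m q) (pt a b m q.+1) w = dN k a b w.
Proof. exact: (sum_subdivision (fun t => N k t w)). Qed.

Lemma sum_dL k a b m w : \sum_(q < m.+1) dL k (pt a b m q) (pt a b m q.+1) w = dL k a b w.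
Proof. exact: (sum_subdivision (fun t => L k t w)). Qed.

Lemma ptS a b m q : a <= b -> pt a b m q <= pt a b m q.+1.
Proof. by move=> ab; exact: subdivision_mono. Qed.

Lemma fine_compensator a b e : a <= b -> 0 < e -> exists m0, forall m, (m0 <= m)%N ->
  forall k q w, dL k (pt a b m q) (pt a b m q.+1) w <= e.
Proof.
move=> ab e0; have [h h0 hP] := c_L_cont H e0.
have [m0 m0P] := subdivision_mesh ab h0; exists m0 => m m0m k q w.
by apply: hP; [exact: ptS | rewrite subdivisionS; exact: m0P].
Qed.

(** In the expansion of [(nk - lk) * (nl - ll)], every term except [nk * nl] contains a compensator
    increment, uniformly small on a fine subdivision. What multiplies this small factor sums to the
    total variation over [a, b], at most [2 * C + C']. *)
Lemma qerr_le k l a b e : a <= b -> 0 < e -> exists m0, forall m, (m0 <= m)%N ->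
  forall w, `|qerr k l a b m w| <= e + jerr k l a b m w.
Proof.
move=> ab e0; have [C C0 CP] := total_bound; have [C' C'0 C'P] := compensator_increment_bound a b.
have e'0 : 0 < e / (2 * C + C') by apply: divr_gt0 => //; lra.
have [m0 m0P] := fine_compensator ab e'0; exists m0 => m m0m w.
set e' := e / _ in e'0 m0P.
apply: (le_trans (ler_norm_sum _ _ _)).
have -> : e = e' * (2 * C + C') by rewrite /e'; field; lra.
apply: (@le_trans _ _ (e' * (dN k a b w + dN l a b w + dL k a b w) + jerr k l a b m w)); last first.
  rewrite lerD2r ler_pM2l//.
  have := CP k a b w ab; have := CP l a b w ab; have := C'P k a b w (lexx a) ab (lexx b); lra.
rewrite -(sum_dN k a b m) -(sum_dN l a b m) -(sum_dL k a b m) -!big_split /= mulr_sumr -big_split /=.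
apply: ler_sum => q _.
have k0 := dN_ge0 k w (ptS m q ab); have l0 := dN_ge0 l w (ptS m q ab).
have Lk0 := dL_ge0 k w (ptS m q ab); have Ll0 := dL_ge0 l w (ptS m q ab).
have Lk1 := m0P m m0m k q w; have Ll1 := m0P m m0m l q w.
have dME k' : dM k' (pt a b m q) (pt a b m q.+1) w =
  dN k' (pt a b m q) (pt a b m q.+1) w - dL k' (pt a b m q) (pt a b m q.+1) w.
  by rewrite /dM /dN /dL; ring.
rewrite !dME.
move: k0 l0 Lk0 Ll0 Lk1 Ll1.
set nk := dN k _ _ _; set nl := dN l _ _ _; set lk := dL k _ _ _; set ll := dL l _ _ _.
move=> k0 l0 Lk0 Ll0 Lk1 Ll1.
have -> : (nk - lk) * (nl - ll) - (k == l)%:R * nk =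
  (nk * nl - (k == l)%:R * nk) + (lk * ll - nk * ll - lk * nl) by ring.
apply: (le_trans (ler_normD _ _)); rewrite [leLHS]addrC lerD2r.
have P1 : 0 <= lk * ll <= e' * lk by rewrite mulr_ge0//= mulrC ler_wpM2r.
have P2 : 0 <= nk * ll <= e' * nk by rewrite mulr_ge0//= mulrC ler_wpM2r.
have P3 : 0 <= lk * nl <= e' * nl by rewrite mulr_ge0//= ler_wpM2r.
rewrite ler_norml; lra.
Qed.

Lemma jerr_eventually0 k l a b w : a <= b ->
  exists m0, forall m, (m0 <= m)%N -> jerr k l a b m w = 0.
Proof.
move=> ab; have [m0 m0P] := c_simple H w ab; exists m0 => m m0m.
apply: big1 => q _; have [Dk Dkl] := m0P m m0m q (ltn_ord q) k l.
apply/eqP; rewrite normr_eq0; apply/eqP.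
rewrite -/(pt a b m q) -/(pt a b m q.+1) -/(dN _ _ _ _) in Dk Dkl *.
have [kl|kl] := eqVneq k l; last by rewrite mul0r subr0 -[RHS](Dkl kl).
by rewrite -kl mul1r; case: Dk => ->; rewrite ?mul0r ?mul1r ?subrr.
Qed.

Lemma jerr4_eventually0 k a b w : a <= b ->
  exists m0, forall m, (m0 <= m)%N -> jerr4 k a b m w = 0.
Proof.
move=> ab; have [m0 m0P] := c_simple H w ab; exists m0 => m m0m.
apply: big1 => q _; have [Dk _] := m0P m m0m q (ltn_ord q) k k.
apply/eqP; rewrite normr_eq0; apply/eqP.
by case: Dk => Dk; rewrite /dN Dk ?expr0n ?expr1n ?subrr.
Qed.

Lemma jerr_measurable k l a b m : measurable_fun setT (jerr k l a b m).
Proof.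
suff : bounded_measurable (jerr k l a b m) by case.
apply: bounded_measurable_sum => q _; apply: bounded_measurable_norm.
apply: bounded_measurableB.
  by apply: bounded_measurableM; exact: dN_bounded.
by apply: bounded_measurableZ; exact: dN_bounded.
Qed.

Lemma jerr4_measurable k a b m : measurable_fun setT (jerr4 k a b m).
Proof.
suff : bounded_measurable (jerr4 k a b m) by case.
apply: bounded_measurable_sum => q _; apply: bounded_measurable_norm.
apply: bounded_measurableB; last exact: dN_bounded.
by apply: bounded_measurableX; exact: dN_bounded.
Qed.

(** A bound independent of the subdivision, as domination requires: each term is at most [(C + 1)]
    times the increment of [N k], and these increments telescope. *)
Lemma jerr_bound k l a b : a <= b -> exists C, forall m w, `|jerr k l a b m w| <= C.
Proof.
move=> ab; have [C C0 CP] := total_bound; exists ((C + 1) * C) => m w.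
rewrite ger0_norm; last by apply: sumr_ge0.
apply: (@le_trans _ _ ((C + 1) * dN k a b w)); last by rewrite ler_wpM2l//; [lra|exact: CP].
rewrite -(sum_dN k a b m) mulr_sumr; apply: ler_sum => q _.
have k0 := dN_ge0 k w (ptS m q ab); have l0 := dN_ge0 l w (ptS m q ab).
have l1 := CP l _ _ w (ptS m q ab).
rewrite mulrC -mulrBl normrM (ger0_norm k0) ler_wpM2r// ler_norml.
by case: (k == l) => /=; lra.
Qed.

Lemma jerr4_bound k a b : a <= b -> exists C, forall m w, `|jerr4 k a b m w| <= C.
Proof.
move=> ab; have [C C0 CP] := total_bound; exists ((C ^+ 3 + 1) * C) => m w.
have C30 : 0 <= C ^+ 3 by rewrite exprn_ge0// ltW.
rewrite ger0_norm; last by apply: sumr_ge0.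
apply: (@le_trans _ _ ((C ^+ 3 + 1) * dN k a b w)); last by rewrite ler_wpM2l//; [lra|exact: CP].
rewrite -(sum_dN k a b m) mulr_sumr; apply: ler_sum => q _.
have k0 := dN_ge0 k w (ptS m q ab); have k1 := CP k _ _ w (ptS m q ab).
have k3 : 0 <= dN k (pt a b m q) (pt a b m q.+1) w ^+ 3 <= C ^+ 3.
  by rewrite exprn_ge0//= lerXn2r ?nnegrE// ltW.
rewrite exprSr -{3}[dN _ _ _ _]mul1r -mulrBl normrM (ger0_norm k0) ler_wpM2r// ler_norml.
lra.
Qed.

(** Only the difference [N - L] is known to be adapted. The jumps are recovered from it: sums of
    squared increments of M along ever finer subdivisions converge on every path to the number of
    jumps. *)
Lemma dN_ad k a b : a <= b -> ad b (dN k a b).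
Proof.
move=> ab; split; last by have [_] := dN_bounded k a b.
pose h m w := \sum_(q < m.+1) dM k (pt a b m q) (pt a b m q.+1) w ^+ 2.
apply: (@measurable_fun_cvg _ (g_sigma_algebraType (F b)) R setT h).
- move=> m; suff : ad b (h m) by case.
  apply: bounded_measurable_sum => q _; apply: bounded_measurableX.
  apply: (@ad_mono (pt a b m q.+1)); first exact: subdivision_le.
  by apply: dM_ad; exact: ptS.
- move=> w _; apply/cvgrPdist_le => e e0.
  have [m0 m0P] := qerr_le k k ab e0; have [m1 m1P] := jerr_eventually0 k k w ab.
  exists (maxn m0 m1) => // m /=; rewrite geq_max => /andP[m0m m1m].
  have := m0P m m0m w; rewrite m1P// addr0 distrC /qerr eqxx.
  under eq_bigr do rewrite mul1r -expr2.
  by rewrite sumrB sum_dN.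
Qed.

Lemma dL_ad k a b : a <= b -> ad b (dL k a b).
Proof.
move=> ab; have -> : dL k a b = (fun w => dN k a b w - dM k a b w).
  by apply/funext => w; rewrite /dL /dN /dM; ring.
by apply: bounded_measurableB; [exact: dN_ad|exact: dM_ad].
Qed.

Lemma qerr_cvg0 k l a b e : a <= b -> 0 < e -> exists m0, forall m, (m0 <= m)%N ->
  \int[P]_w `|qerr k l a b m w| <= e.
Proof.
move=> ab e0; have e20 : 0 < e / 2 by lra.
have [m0 m0P] := qerr_le k l ab e20; have [C CP] := jerr_bound k l ab.
have [m1 m1P] := Rint_eventually0 P (jerr_measurable k l a b) CP
  (fun w => jerr_eventually0 k l w ab) e20.
exists (maxn m0 m1) => m /=; rewrite geq_max => /andP[m0m m1m].
have bj : bounded_measurable (jerr k l a b m).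
  by split; [exact: jerr_measurable | exists C].
apply: (@le_trans _ _ (\int[P]_w (e / 2 + `|jerr k l a b m w|))).
  apply: Rint_le.
  - apply: bounded_measurable_norm; apply: bounded_measurable_sum => q _.
    apply: bounded_measurableB.
      by apply: bounded_measurableM; exact: dM_bounded.
    by apply: bounded_measurableZ; exact: dN_bounded.
  - apply: bounded_measurableD; first exact: bounded_measurable_cst.
    exact: bounded_measurable_norm.
  - move=> w; apply: (le_trans (m0P m m0m w)).
    by rewrite lerD2l ler_norm.
rewrite Rint_add; [|exact: bounded_measurable_cst|exact: bounded_measurable_norm].
rewrite Rint_cst.
by have := m1P m m1m; lra.
Qed.

(** The product is telescoped over a subdivision. By the product rule each cell contributes its term
    of [qerr] and two cross terms, which are centered because their first factor belongs to the past
    of the cell. *)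
Lemma second_moment k l a b W : a <= b -> ad a W ->
  \int[P]_w (W w * (dM k a b w * dM l a b w - (k == l)%:R * dN k a b w)) = 0.
Proof.
move=> ab adW; have bW := ad_bounded_measurable adW.
have [c Wc] := bW.2.
have c0 : 0 <= c by apply: le_trans (Wc point).
set I := Rintegral _ _ _.
(* The integral does not depend on [m], while the right-hand side tends to 0. *)
suff key m : `|I| <= c * \int[P]_w `|qerr k l a b m w|.
  apply/eqP; rewrite -normr_le0; apply/ler_addgt0Pr => e e0; rewrite add0r.
  have e'0 : 0 < e / (c + 1) by apply: divr_gt0 => //; lra.
  have [m0 m0P] := qerr_cvg0 k l ab e'0.
  apply: (le_trans (key m0)); apply: (@le_trans _ _ ((c + 1) * (e / (c + 1)))).
    by apply: ler_pM => //; [exact: Rintegral_ge0|lra|exact: m0P].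
  by rewrite le_eqVlt; apply/orP; left; apply/eqP; field; lra.
have bq : bounded_measurable (qerr k l a b m).
  apply: bounded_measurable_sum => q _; apply: bounded_measurableB.
    by apply: bounded_measurableM; exact: dM_bounded.
  by apply: bounded_measurableZ; exact: dN_bounded.
(* The cross terms: the past of one martingale times the new increment of the other. *)
pose A q w := W w * dM k a (pt a b m q) w * dM l (pt a b m q) (pt a b m q.+1) w.
pose B q w := W w * dM l a (pt a b m q) w * dM k (pt a b m q) (pt a b m q.+1) w.
have bA q : bounded_measurable (A q).
  by apply: bounded_measurableM; [apply: bounded_measurableM => //|]; exact: dM_bounded.
have bB q : bounded_measurable (B q).
  by apply: bounded_measurableM; [apply: bounded_measurableM => //|]; exact: dM_bounded.
have adWM k' q : ad (pt a b m q) (fun w => W w * dM k' a (pt a b m q) w).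
  have aq : a <= pt a b m q by exact: subdivision_ge.
  by apply: bounded_measurableM; [exact: ad_mono adW|exact: dM_ad].
have A0 q : \int[P]_w A q w = 0 by apply: martingale_orthogonal => //; exact: ptS.
have B0 q : \int[P]_w B q w = 0 by apply: martingale_orthogonal => //; exact: ptS.
have -> : I = \int[P]_w (W w * qerr k l a b m w + \sum_(q < m.+1) (A q w + B q w)).
  apply: eq_Rintegral => w _; rewrite /qerr mulr_sumr -big_split /=.
  pose f t := W w * (dM k a t w * dM l a t w - (k == l)%:R * dN k a t w).
  have := sum_subdivision f a b m.
  have -> : f a = 0 by rewrite /f /dM /dN; ring.
  rewrite subr0 -/(f b) => <-.
  by apply: eq_bigr => q _; rewrite /f /A /B /dM /dN -/pt; ring.
rewrite Rint_add; last 2 first.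
- exact: bounded_measurableM.
- by apply: bounded_measurable_sum => q _; exact: bounded_measurableD.
rewrite Rint_sum; last by move=> q _; exact: bounded_measurableD.
rewrite [X in _ + X]big1 ?addr0; last by move=> q _; rewrite Rint_add// A0 B0 addr0.
apply: (le_trans (Rint_norm P (bounded_measurableM bW bq))).
have bqn := bounded_measurable_norm bq.
rewrite -Rint_scale//; apply: Rint_le.
- by apply: bounded_measurable_norm; exact: bounded_measurableM.
- exact: bounded_measurableZ.
- by move=> w; rewrite normrM ler_wpM2r.
Qed.

(** The fourth power of M is telescoped over a fine subdivision. Modulo centered terms, the squared
    increment in [8 * x^2 * y^2] is replaced first by the jump, then by the compensator increment
    [V]. Finally the current value of M is replaced by its terminal value, so that the [V] add up to
    the compensator over [a, b]. *)
Lemma fourth_moment_step k a b e : a <= b -> 0 < e ->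
  \int[P]_w (dM k a b w ^+ 4) <=
  8 * \int[P]_w (dM k a b w ^+ 2 * dL k a b w) + 3 * \int[P]_w dN k a b w + e.
Proof.
move=> ab e0; have [C C0 CP] := total_bound; have [C' C'0 C'P] := compensator_increment_bound a b.
(* [e' * K] collects all errors proportional to the largest compensator increment and is kept below
   [e / 2]; the other half of [e] is [3 * (e / 6)], from the fourth powers of the jumps. The bound
   [e' <= 1] gives [V^4 <= e' * V]. *)
pose K := 16 * (C + C') ^+ 2 + 3 * C'.
have K0 : 0 < K by rewrite /K addr_gt0 ?mulr_gt0 ?exprn_gt0//; lra.
pose e' := Num.min 1 (e / (2 * K)).
have e'0 : 0 < e' by rewrite lt_min ltr01/= divr_gt0//; lra.
have e'1 : e' <= 1 by rewrite ge_min lexx.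
have e'K : e' * K <= e / 2.
  rewrite -ler_pdivlMr//; apply: (@le_trans _ _ (e / (2 * K))).
    by rewrite ge_min lexx orbT.
  by rewrite le_eqVlt; apply/orP; left; apply/eqP; field; lra.
have [m0 m0P] := fine_compensator ab e'0.
have [C4 C4P] := jerr4_bound k ab.
have e60 : 0 < e / 6 by lra.
have [m1 m1P] := Rint_eventually0 P (jerr4_measurable k a b) C4P
  (fun w => jerr4_eventually0 k w ab) e60.
pose m := maxn m0 m1.
have {}m0P k' q w : dL k' (pt a b m q) (pt a b m q.+1) w <= e'.
  by apply: m0P; exact: leq_maxl.
have {}m1P := m1P m (leq_maxr _ _).
pose X q w := dM k a (pt a b m q) w.
pose D q w := dM k (pt a b m q) (pt a b m q.+1) w.
pose U q w := dN k (pt a b m q) (pt a b m q.+1) w.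
pose V q w := dL k (pt a b m q) (pt a b m q.+1) w.
have pS q := ptS m q ab.
have pa q : a <= pt a b m q by exact: subdivision_ge.
have pb (q : 'I_m.+1) : pt a b m q.+1 <= b by exact: subdivision_le.
have pb' (q : 'I_m.+1) : pt a b m q <= b by exact: le_trans (pS q) (pb q).
have bX q : bounded_measurable (X q) by exact: dM_bounded.
have bD q : bounded_measurable (D q) by exact: dM_bounded.
have bU q : bounded_measurable (U q) by exact: dN_bounded.
have bV q : bounded_measurable (V q) by exact: dL_bounded.
have adX q : ad (pt a b m q) (X q) by exact: dM_ad.
have U0 q w : 0 <= U q w by exact: dN_ge0.
have V0 q w : 0 <= V q w by exact: dL_ge0.
have DE q w : D q w = U q w - V q w by rewrite /D /U /V /dM /dN /dL; ring.
have XS q w : X q.+1 w = X q w + D q w by rewrite /X /D /dM; ring.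
have XC q w : (q <= m.+1)%N -> `|X q w| <= C + C'.
  move=> qm; have := dN_ge0 k w (pa q); have := dL_ge0 k w (pa q).
  have := CP k _ _ w (pa q).
  have := C'P k _ _ w (lexx a) (pa q) (subdivision_le ab qm).
  rewrite (_ : X q w = dN k a (pt a b m q) w - dL k a (pt a b m q) w); last first.
    by rewrite /X /dM /dN /dL; ring.
  rewrite ler_norml; lra.
have bM2 : bounded_measurable (fun w => dM k a b w ^+ 2).
  by apply: bounded_measurableX; exact: dM_bounded.
have bL : bounded_measurable (dL k a b) by exact: dL_bounded.
(* (x + y)^4 - x^4 - 4 x^3 y <= 8 x^2 y^2 + 3 y^4, and the increment 4 x^3 y
   has mean zero *)
have cell q : (q < m.+1)%N ->
  \int[P]_w (X q.+1 w ^+ 4 - X q w ^+ 4) <=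
  \int[P]_w (8 * (dM k a b w ^+ 2 * V q w) +
     (16 * (C + C') * e' * (U q w + V q w) + 3 * D q w ^+ 4)).
  move=> qm; have pbq := pb (Ordinal qm); have pbq' := pb' (Ordinal qm).
  have o3 : \int[P]_w (X q w ^+ 3 * D q w) = 0.
    apply: (@martingale_orthogonal k _ _ (fun w => X q w ^+ 3)); first exact: pS.
    by apply: bounded_measurableX; exact: adX.
  have o2 : \int[P]_w (X q w ^+ 2 * (D q w * D q w - (k == k)%:R * U q w)) = 0.
    apply: (@second_moment k k _ _ (fun w => X q w ^+ 2)); first exact: pS.
    by apply: bounded_measurableX; exact: adX.
  have o1 : \int[P]_w (X q w ^+ 2 * D q w) = 0.
    apply: (@martingale_orthogonal k _ _ (fun w => X q w ^+ 2)); first exact: pS.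
    by apply: bounded_measurableX; exact: adX.
  (* [V q] is only known at the end of the cell, so the passage to the terminal value starts from
     [X q.+1] rather than [X q]. *)
  have oV : \int[P]_w ((2 * X q.+1 w * V q w) * dM k (pt a b m q.+1) b w) = 0.
    apply: martingale_orthogonal => //.
    apply: bounded_measurableM; last exact: dL_ad.
    by apply: bounded_measurableZ; exact: adX.
  have bX3D : bounded_measurable (fun w => X q w ^+ 3 * D q w).
    by apply: bounded_measurableM => //; exact: bounded_measurableX.
  have bX2D : bounded_measurable (fun w => X q w ^+ 2 * D q w).
    by apply: bounded_measurableM => //; exact: bounded_measurableX.
  have bQ : bounded_measurable (fun w => X q w ^+ 2 * (D q w * D q w - (k == k)%:R * U q w)).
    apply: bounded_measurableM; first exact: bounded_measurableX.
    apply: bounded_measurableB; first exact: bounded_measurableM.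
    exact: bounded_measurableZ.
  have bXV : bounded_measurable
      (fun w => (2 * X q.+1 w * V q w) * dM k (pt a b m q.+1) b w).
    apply: bounded_measurableM; last exact: dM_bounded.
    by apply: bounded_measurableM => //; exact: bounded_measurableZ.
  have bR : bounded_measurable (fun w => 8 * (dM k a b w ^+ 2 * V q w) +
     (16 * (C + C') * e' * (U q w + V q w) + 3 * D q w ^+ 4)).
    apply: bounded_measurableD.
      by apply: bounded_measurableZ; exact: bounded_measurableM.
    apply: bounded_measurableD.
      by apply: bounded_measurableZ; exact: bounded_measurableD.
    by apply: bounded_measurableZ; exact: bounded_measurableX.
  have bX4 : bounded_measurable (fun w => X q.+1 w ^+ 4 - X q w ^+ 4).
    by apply: bounded_measurableB; exact: bounded_measurableX.
  pose Z w := 4 * (X q w ^+ 3 * D q w) + 8 * (X q w ^+ 2 * (D q w * D q w - (k == k)%:R * U q w))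
     + 8 * (X q w ^+ 2 * D q w) - 8 * ((2 * X q.+1 w * V q w) * dM k (pt a b m q.+1) b w).
  have b1 := bounded_measurableZ 4 bX3D.
  have b2 := bounded_measurableZ 8 bQ.
  have b3 := bounded_measurableZ 8 bX2D.
  have b4 := bounded_measurableZ 8 bXV.
  have bZ : bounded_measurable Z.
    apply: bounded_measurableB => //; apply: bounded_measurableD => //.
    exact: bounded_measurableD.
  have Z0 : \int[P]_w Z w = 0.
    rewrite Rint_sub//; last first.
      by apply: bounded_measurableD => //; exact: bounded_measurableD.
    rewrite Rint_add//; last exact: bounded_measurableD.
    by rewrite Rint_add// !Rint_scale// o3 o2 o1 oV; ring.
  rewrite -[leLHS]subr0 -Z0 -Rint_sub//; apply: Rint_le => //.
    exact: bounded_measurableB.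
  move=> w; rewrite /Z eqxx mul1r.
  have XSb : dM k a b w = X q.+1 w + dM k (pt a b m q.+1) b w.
    by rewrite /X /dM; ring.
  have x1 := XC q w (ltnW qm); have x2 := XC q.+1 w qm.
  have vq := m0P k q w; have u0 := U0 q w; have v0 := V0 q w.
  rewrite -/(V q w) in vq.
  move: XSb x1 x2 vq u0 v0; rewrite XS.
  have := DE q w.
  set x := X q w; set dd := D q w; set u := U q w; set v := V q w.
  set y := dM k (pt a b m q.+1) b w => ddE -> x1 x2 vq u0 v0.
  set c := C + C' in x1 x2 *.
  have c0 : 0 < c by rewrite /c; lra.
  have T1 : 4 * x * dd ^+ 3 <= 2 * x ^+ 2 * dd ^+ 2 + 2 * dd ^+ 4.
    have := mulr_ge0 (sqr_ge0 dd) (sqr_ge0 (x - dd)).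
    have -> : dd ^+ 2 * (x - dd) ^+ 2 = x ^+ 2 * dd ^+ 2 - 2 * x * dd ^+ 3 + dd ^+ 4 by ring.
    lra.
  (* Moving the square from the left to the right end of the cell costs a factor [v <= e']. *)
  have T2 : 8 * v * (x ^+ 2 - (x + dd) ^+ 2) <= 16 * c * e' * (u + v).
    have -> : x ^+ 2 - (x + dd) ^+ 2 = - dd * (x + (x + dd)) by ring.
    apply: (@le_trans _ _ (8 * v * (`|dd| * (2 * c)))).
      rewrite ler_wpM2l//; first lra.
      apply: (le_trans (ler_norm _)); rewrite normrM normrN ler_wpM2l//.
      by rewrite (le_trans (ler_normD _ _))//; lra.
    have dd1 : `|dd| <= u + v by rewrite ddE ler_norml; lra.
    have -> : 8 * v * (`|dd| * (2 * c)) = 16 * c * (v * `|dd|) by ring.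
    have -> : 16 * c * e' * (u + v) = 16 * c * (e' * (u + v)) by ring.
    rewrite ler_wpM2l//; first lra.
    exact: ler_pM.
  (* This square, left over from the expansion at the terminal value, has the right sign and is
     dropped. *)
  have T3 : 0 <= 8 * v * y ^+ 2.
    by rewrite mulr_ge0 ?sqr_ge0//; lra.
  have E1 : (x + dd) ^+ 4 - x ^+ 4 =
    4 * (x ^+ 3 * dd) + 6 * x ^+ 2 * dd ^+ 2 + 4 * x * dd ^+ 3 + dd ^+ 4 by ring.
  have E2 : 8 * (x ^+ 2 * (dd * dd - u)) = 8 * x ^+ 2 * dd ^+ 2 - 8 * x ^+ 2 * u by ring.
  have E3 : 8 * (x ^+ 2 * dd) = 8 * x ^+ 2 * u - 8 * x ^+ 2 * v.
    by rewrite [in LHS]ddE; ring.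
  have E4 : 8 * ((x + dd + y) ^+ 2 * v) =
    8 * (x + dd) ^+ 2 * v + 8 * (2 * (x + dd) * v * y) + 8 * v * y ^+ 2 by ring.
  have E5 : 8 * v * (x ^+ 2 - (x + dd) ^+ 2) = 8 * x ^+ 2 * v - 8 * (x + dd) ^+ 2 * v by ring.
  rewrite E1 E2 E3 E4; rewrite E5 in T2; lra.
have bX4 q : bounded_measurable (fun w => X q.+1 w ^+ 4 - X q w ^+ 4).
  by apply: bounded_measurableB; exact: bounded_measurableX.
have -> : \int[P]_w (dM k a b w ^+ 4) =
    \sum_(q < m.+1) \int[P]_w (X q.+1 w ^+ 4 - X q w ^+ 4).
  rewrite -Rint_sum//; apply: eq_Rintegral => w _.
  have := sum_subdivision (fun t => dM k a t w ^+ 4) a b m.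
  rewrite -/pt /= => ->; rewrite [dM k a a w](_ : _ = 0); last by rewrite /dM subrr.
  by rewrite expr0n subr0.
apply: (le_trans (y := \sum_(q < m.+1) \int[P]_w (8 * (dM k a b w ^+ 2 * V q w) +
        (16 * (C + C') * e' * (U q w + V q w) + 3 * D q w ^+ 4)))).
  by apply: ler_sum => q _; exact: cell (ltn_ord q).
have bMV q : bounded_measurable (fun w => dM k a b w ^+ 2 * V q w).
  exact: bounded_measurableM.
have bUV q : bounded_measurable (fun w => U q w + V q w) by exact: bounded_measurableD.
have bD4 q : bounded_measurable (fun w => D q w ^+ 4) by exact: bounded_measurableX.
have bj : bounded_measurable (jerr4 k a b m).
  by split; [exact: jerr4_measurable | exists C4].
rewrite -Rint_sum; last first.
  move=> q _; apply: bounded_measurableD; first exact: bounded_measurableZ.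
  by apply: bounded_measurableD; exact: bounded_measurableZ.
have bA := bounded_measurableZ 8 (bounded_measurableM bM2 bL).
have bB := bounded_measurableZ 3 (dN_bounded k a b).
have bC := bounded_measurableZ 3 (bounded_measurable_norm bj).
apply: (@le_trans _ _ (\int[P]_w (8 * (dM k a b w ^+ 2 * dL k a b w) + 3 * dN k a b w
   + (e' * K + 3 * `|jerr4 k a b m w|)))).
  apply: Rint_le.
  - apply: bounded_measurable_sum => q _; apply: bounded_measurableD.
      exact: bounded_measurableZ.
    by apply: bounded_measurableD; exact: bounded_measurableZ.
  - apply: bounded_measurableD; first exact: bounded_measurableD.
    by apply: bounded_measurableD => //; exact: bounded_measurable_cst.
  move=> w; rewrite !big_split /= -!mulr_sumr.
  apply: (@le_trans _ _ (8 * (dM k a b w ^+ 2 * dL k a b w) +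
    (16 * (C + C') * e' * (dN k a b w + dL k a b w) + 3 * \sum_(q < m.+1) D q w ^+ 4))).
    rewrite le_eqVlt; apply/orP; left; apply/eqP; congr (_ * (_ * _) + (_ * _ + _)).
      exact: sum_dL.
    by rewrite big_split; congr (_ + _); [exact: sum_dN|exact: sum_dL].
  have nC := CP k a b w ab; have lC := C'P k a b w (lexx a) ab (lexx b).
  have n0 := dN_ge0 k w ab; have l0 := dL_ge0 k w ab.
  (* If [V <= U] the increment lies between 0 and the jump [U], and [U^4] is [U] up to [jerr4].
     Otherwise it is at most [V <= e' <= 1] in absolute value. *)
  have H4 : \sum_(q < m.+1) D q w ^+ 4 <= dN k a b w + e' * C' + `|jerr4 k a b m w|.
    apply: (@le_trans _ _ (dN k a b w + e' * dL k a b w + jerr4 k a b m w)); last first.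
      by rewrite lerD ?ler_norm// lerD2l ler_wpM2l// ltW.
    rewrite -(sum_dN k a b m) -(sum_dL k a b m) mulr_sumr -!big_split /=.
    apply: ler_sum => q _; rewrite DE.
    have u0 := U0 q w; have v0 := V0 q w; have v1 := m0P k q w.
    rewrite -/(U q w) -/(V q w) in v1 *.
    have [vu|uv] := leP (V q w) (U q w).
      apply: (@le_trans _ _ (U q w ^+ 4)); first by rewrite lerXn2r ?nnegrE; lra.
      have := ler_norm (U q w ^+ 4 - U q w).
      have := mulr_ge0 (ltW e'0) v0; lra.
    apply: (@le_trans _ _ (V q w ^+ 4)).
      have -> : (U q w - V q w) ^+ 4 = (V q w - U q w) ^+ 4 by ring.
      by rewrite lerXn2r ?nnegrE; lra.
    have : V q w ^+ 4 <= e' * V q w.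
      rewrite exprSr ler_wpM2r//; apply: le_trans (v1).
      rewrite exprSr ler_piMl// expr_le1//; lra.
    have := normr_ge0 (U q w ^+ 4 - U q w); lra.
  have -> : e' * K = 16 * (C + C') * e' * (C + C') + 3 * (e' * C').
    by rewrite /K; ring.
  have H1 : 16 * (C + C') * e' * (dN k a b w + dL k a b w) <= 16 * (C + C') * e' * (C + C').
    rewrite ler_wpM2l; [by []| |lra].
    by rewrite !mulr_ge0//; lra.
  lra.
have bE : bounded_measurable (fun w => e' * K + 3 * `|jerr4 k a b m w|).
  by apply: bounded_measurableD => //; exact: bounded_measurable_cst.
rewrite Rint_add//; last exact: bounded_measurableD.
rewrite Rint_add// !Rint_scale//; [|exact: dN_bounded|exact: bounded_measurableM].
rewrite lerD2l Rint_add//; last exact: bounded_measurable_cst.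
rewrite Rint_cst Rint_scale//; last exact: bounded_measurable_norm.
lra.
Qed.

(** From [8 * x^2 * y <= x^4 / 2 + 32 * y^2], half of the fourth moment moves to the left-hand side.
    This is legitimate because the stopped processes are bounded, so that the fourth moment is
    finite. *)
Lemma fourth_moment k a b : a <= b ->
  \int[P]_w (dM k a b w ^+ 4) <=
  64 * \int[P]_w (dL k a b w ^+ 2) + 6 * \int[P]_w dN k a b w.
Proof.
move=> ab.
have step : \int[P]_w (dM k a b w ^+ 4) <=
  8 * \int[P]_w (dM k a b w ^+ 2 * dL k a b w) + 3 * \int[P]_w dN k a b w.
  by apply/ler_addgt0Pr => e e0; exact: fourth_moment_step.
have bM := dM_bounded k a b; have bL := dL_bounded k a b.
have bM4 := bounded_measurableX 4 bM; have bL2 := bounded_measurableX 2 bL.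
have bM2L := bounded_measurableM (bounded_measurableX 2 bM) bL.
have : 8 * \int[P]_w (dM k a b w ^+ 2 * dL k a b w) <=
   2^-1 * \int[P]_w (dM k a b w ^+ 4) + 32 * \int[P]_w (dL k a b w ^+ 2).
  have b1 := bounded_measurableZ 2^-1 bM4; have b2 := bounded_measurableZ 32 bL2.
  rewrite -!Rint_scale// -Rint_add//; apply: Rint_le.
  - exact: bounded_measurableZ.
  - exact: bounded_measurableD.
  move=> w; have := sqr_ge0 (dM k a b w ^+ 2 - 8 * dL k a b w).
  set x := dM k a b w; set y := dL k a b w.
  have -> : (x ^+ 2 - 8 * y) ^+ 2 = x ^+ 4 - 16 * (x ^+ 2 * y) + 64 * y ^+ 2 by ring.
  lra.
lra.
Qed.

(* The two increments share the jumps in the intersection of their intervals;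
   subtracting these gives mean zero conditionally on the past of [a + h]. *)
Definition lagged_product k l h a b w :=
  dM k a b w * dM l (a + h) (b + h) w - (k == l)%:R * dN k (Num.min (a + h) b) b w.

Lemma lagged_product_ad k l h a b : 0 <= h -> a <= b -> ad (b + h) (lagged_product k l h a b).
Proof.
move=> h0 ab; apply: bounded_measurableB.
  apply: bounded_measurableM; last by apply: dM_ad; lra.
  by apply: (@ad_mono b); [lra|exact: dM_ad].
apply: bounded_measurableZ; apply: (@ad_mono b); first lra.
by apply: dN_ad; rewrite ge_min lexx orbT.
Qed.

(** If the lag reaches the length, the second increment lies after the first. Otherwise the
    intervals are cut at [a + h] and [b]: the common part [a + h, b] is handled by [second_moment],
    and in the remaining products one increment comes after everything else. *)
Lemma lagged_product_centered k l h a b W : 0 <= h -> a <= b -> ad (a + h) W ->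
  \int[P]_w (W w * lagged_product k l h a b w) = 0.
Proof.
move=> h0 ab adW; have bW := ad_bounded_measurable adW.
have bM k' s t : bounded_measurable (dM k' s t) by exact: dM_bounded.
have [bah|abh] := leP b (a + h).
  rewrite -(@martingale_orthogonal l (a + h) (b + h) (fun w => W w * dM k a b w)).
  - by apply: eq_Rintegral => w _; rewrite /lagged_product min_r// /dN subrr; ring.
  - lra.
  - by apply: bounded_measurableM => //; apply: (ad_mono bah); exact: dM_ad.
set c := a + h in adW abh *.
have ac : a <= c by rewrite /c; lra.
have o1 : \int[P]_w ((W w * dM k a c w) * dM l c (b + h) w) = 0.
  apply: martingale_orthogonal; first by rewrite /c; lra.
  by apply: bounded_measurableM => //; exact: dM_ad.
have o2 : \int[P]_w ((W w * dM k c b w) * dM l b (b + h) w) = 0.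
  apply: martingale_orthogonal; first by lra.
  apply: bounded_measurableM; first by apply: (ad_mono (ltW abh)).
  by apply: dM_ad; exact: ltW.
have o3 := second_moment k l (ltW abh) adW.
have b1 := bounded_measurableM (bounded_measurableM bW (bM k a c)) (bM l c (b + h)).
have b2 := bounded_measurableM (bounded_measurableM bW (bM k c b)) (bM l b (b + h)).
have b3 := bounded_measurableM bW (bounded_measurableB
  (bounded_measurableM (bM k c b) (bM l c b)) (bounded_measurableZ (k == l)%:R (dN_bounded k c b))).
transitivity (\int[P]_w ((W w * dM k a c w) * dM l c (b + h) w +
   (W w * dM k c b w) * dM l b (b + h) w +
   W w * (dM k c b w * dM l c b w - (k == l)%:R * dN k c b w))).
  apply: eq_Rintegral => w _; rewrite /lagged_product min_l -/c; last exact: ltW.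
  by rewrite /dM /dN; ring.
rewrite Rint_add//; last exact: bounded_measurableD.
by rewrite Rint_add// o1 o2 o3 !addr0.
Qed.

(** Pythagoras: the partial sum is known at [s m], hence it is a valid weight for the next centered
    term. *)
Lemma orthogonal_sum (s : nat -> R) (Y : nat -> Om -> R) :
  (forall p, s p <= s p.+1) ->
  (forall p, ad (s p.+1) (Y p)) ->
  (forall p W, ad (s p) W -> \int[P]_w (W w * Y p w) = 0) ->
  forall m, \int[P]_w ((\sum_(p < m) Y p w) ^+ 2) = \sum_(p < m) \int[P]_w (Y p w ^+ 2).
Proof.
move=> sS adY YW.
have bY p : bounded_measurable (Y p) by exact: ad_bounded_measurable (adY p).
have adS m : ad (s m) (fun w => \sum_(p < m) Y p w).
  apply: bounded_measurable_sum => p _; apply: ad_mono (adY p).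
  have : (p.+1 <= m)%N by [].
  move: (p.+1) => q; elim: m {p} => [|m IH]; first by rewrite leqn0 => /eqP ->.
  by rewrite leq_eqVlt => /predU1P[->//|]; rewrite ltnS => /IH; move/le_trans; apply.
elim=> [|m IH].
  under eq_Rintegral do rewrite big_ord0 expr0n /=.
  by rewrite Rint_cst big_ord0.
rewrite big_ord_recr /= -IH.
have bS : bounded_measurable (fun w => \sum_(p < m) Y p w).
  exact: ad_bounded_measurable (adS m).
have b1 := bounded_measurableX 2 bS; have b2 := bounded_measurableX 2 (bY m).
have b3 := bounded_measurableZ 2 (bounded_measurableM bS (bY m)).
have SY0 : \int[P]_w ((\sum_(p < m) Y p w) * Y m w) = 0 by exact: YW.
transitivity (\int[P]_w ((\sum_(p < m) Y p w) ^+ 2 + Y m w ^+ 2 +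
   2 * ((\sum_(p < m) Y p w) * Y m w))).
  by apply: eq_Rintegral => w _; rewrite big_ord_recr /=; ring.
rewrite Rint_add//; last exact: bounded_measurableD.
rewrite Rint_add// Rint_scale; last exact: bounded_measurableM.
by rewrite SY0 mulr0 addr0.
Qed.

Lemma M_sum_sqr k (x y : nat -> R) m : (forall p, x p <= y p) -> (forall p, y p <= x p.+1) ->
  \int[P]_w ((\sum_(p < m) dM k (x p) (y p) w) ^+ 2) =
  \sum_(p < m) \int[P]_w dN k (x p) (y p) w.
Proof.
move=> xy yx; rewrite (@orthogonal_sum x (fun p => dM k (x p) (y p))).
- apply: eq_bigr => p _.
  have := @second_moment k k (x p) (y p) (fun=> 1) (xy p) (bounded_measurable_cst _ 1).
  under eq_Rintegral do rewrite mul1r eqxx mul1r.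
  rewrite Rint_sub; [|by apply: bounded_measurableM; exact: dM_bounded|exact: dN_bounded].
  move/eqP; rewrite subr_eq0 => /eqP <-.
  by apply: eq_Rintegral => w _; rewrite expr2.
- by move=> p; exact: le_trans (xy p) (yx p).
- by move=> p; apply: (ad_mono (yx p)); exact: dM_ad.
- by move=> p W; exact: martingale_orthogonal.
Qed.

(** Although a cell and the translate of another may overlap, the products are orthogonal along the
    times [a + p * D + h]: product [p] is centered given the past of that time and known at the next
    one. Each square is at most [2 * (x * y)^2 + 2 * z^2], and [2 * (x * y)^2 <= x^4 + y^4]. *)
Lemma lagged_sum_sqr k l h a D m c c' : 0 <= h -> 0 <= D ->
  (forall k' s, \int[P]_w (dM k' s (s + D) w ^+ 4) <= c) ->
  (forall k' s t, s <= t -> t <= s + D -> \int[P]_w (dN k' s t w ^+ 2) <= c') ->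
  \int[P]_w ((\sum_(p < m) lagged_product k l h (a + p%:R * D) (a + p%:R * D + D) w) ^+ 2)
   <= m%:R * (2 * c + 2 * c').
Proof.
move=> h0 D0 M4 N2; rewrite (@orthogonal_sum (fun p => a + p%:R * D + h)
  (fun p => lagged_product k l h (a + p%:R * D) (a + p%:R * D + D))).
- rewrite mulr_natl -[m in _ *+ m]card_ord -sumr_const; apply: ler_sum => p _.
  set s := a + _.
  have bM k' u v := bounded_measurableX 4 (dM_bounded k' u v).
  have bN u v := bounded_measurableX 2 (dN_bounded k u v).
  apply: (@le_trans _ _ (\int[P]_w (dM k s (s + D) w ^+ 4 + dM l (s + h) (s + h + D) w ^+ 4 +
     2 * dN k (Num.min (s + h) (s + D)) (s + D) w ^+ 2))).
    apply: Rint_le.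
    - apply: bounded_measurableX; apply: ad_bounded_measurable.
      by apply: lagged_product_ad => //; lra.
    - apply: bounded_measurableD; last exact: bounded_measurableZ.
      exact: bounded_measurableD.
    move=> w; rewrite /lagged_product (addrAC s h D).
    set x := dM k _ _ w; set y := dM l _ _ w; set z := dN k _ _ w.
    have A1 : (x * y - (k == l)%:R * z) ^+ 2 <= 2 * (x * y) ^+ 2 + 2 * z ^+ 2.
      case: (k == l) => /=; last by rewrite mul0r subr0; have := sqr_ge0 z; have := sqr_ge0 (x * y); lra.
      rewrite mul1r; rewrite -subr_ge0.
      by rewrite (_ : _ - _ = (x * y + z) ^+ 2) ?sqr_ge0//; ring.
    apply: (le_trans A1).
    have := sqr_ge0 (x ^+ 2 - y ^+ 2).
    have -> : (x ^+ 2 - y ^+ 2) ^+ 2 = x ^+ 4 + y ^+ 4 - 2 * (x * y) ^+ 2 by ring.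
    lra.
  rewrite Rint_add; [|exact: bounded_measurableD|exact: bounded_measurableZ].
  rewrite Rint_add// Rint_scale//.
  have := M4 k s; have := M4 l (s + h).
  have := @N2 k (Num.min (s + h) (s + D)) (s + D).
  rewrite ge_min lexx orbT => /(_ isT).
  rewrite (_ : s + D <= _ = true); last by rewrite lerD2r le_min; lra.
  move=> /(_ isT); lra.
- by move=> p; rewrite -natr1; lra.
- move=> p; rewrite (_ : a + p.+1%:R * D + h = a + p%:R * D + D + h); last by rewrite -natr1; ring.
  by apply: lagged_product_ad => //; lra.
- by move=> p W; apply: lagged_product_centered => //; lra.
Qed.

End compensated_counting_theory.

(** * Neumann series and the spectral radius *)

Section neumann_series.
Variable R : realType.
Local Notation normc := ComplexField.Normc.normc.

Lemma char_poly_roots n (A : 'M[R[i]]_n) : exists2 s : seq R[i],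
  (char_poly A = \prod_(a <- s) ('X - a%:P)) & (forall a, a \in s -> eigenvalue A a).
Proof.
have [s sE] := closed_field_poly_normal (char_poly A).
have lc : lead_coef (char_poly A) = 1 by exact: (monicP (char_poly_monic A)).
exists s; first by rewrite sE lc scale1r.
by move=> a sa; rewrite eigenvalue_root_char sE lc scale1r root_prod_XsubC.
Qed.

(** A supremum is informative only for a bounded set; here the sum of the moduli of the roots of the
    characteristic polynomial is an upper bound. *)
Lemma eigenvalue_norm_le n (A : 'M[R]_n) (a : R[i]) :
  eigenvalue (map_mx (real_complex R) A) a -> normc a <= spectral_radius A.
Proof.
move=> ea; apply: ub_le_sup; last by exists a.
have [s sE _] := char_poly_roots (map_mx (real_complex R) A).
exists (\sum_(b <- s) normc b) => _ [b /= eb <-].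
have bs : b \in s by move: eb; rewrite eigenvalue_root_char sE root_prod_XsubC.
rewrite (big_rem b)//= lerDl; apply: sumr_ge0 => c _.
by case: c => x y /=; exact: sqrtr_ge0.
Qed.

(** Summing the recursion gives [S <= x 0 + r * S + W] for every partial sum, and [r < 1] allows
    solving for [S]. *)
Lemma affine_recursion_summable (x w : nat -> R) (r W : R) :
  (forall m, 0 <= x m) -> 0 <= r -> r < 1 ->
  (forall m, x m.+1 <= r * x m + w m) ->
  (forall m, \sum_(k < m) w k <= W) ->
  exists C, forall m, \sum_(k < m) x k <= C.
Proof.
move=> x0 r0 r1 xS wW; exists ((x 0%N + W) / (1 - r)) => m.
rewrite ler_pdivlMr; last lra.
suff : \sum_(k < m) x k <= x 0%N + r * \sum_(k < m) x k + W by lra.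
case: m => [|m].
  by rewrite big_ord0 mulr0; have := wW 0%N; rewrite big_ord0; have := x0 0%N; lra.
rewrite [leLHS]big_ord_recl /= -addrA lerD2l.
apply: (@le_trans _ _ (r * \sum_(k < m) x k + \sum_(k < m) w k)).
  by rewrite mulr_sumr -big_split /=; apply: ler_sum => k _; exact: xS.
rewrite lerD// ler_wpM2l// big_ord_recr /= lerDl//.
Qed.

(** Induction on the roots, with [B] absorbing the factors already treated. The identity
    [A^(k+1) B = a A^k B + A^k (A - a) B] is an affine recursion of ratio [|a| < 1] whose source is
    summable by induction. No diagonalization is involved, so multiple roots are harmless. *)
Lemma annihilated_powers_summable n (A : 'M[R[i]]_n.+1) (s : seq R[i]) (B : 'M[R[i]]_n.+1) :
  (forall a, a \in s -> normc a < 1) ->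
  horner_mx A (\prod_(a <- s) ('X - a%:P)) * B = 0 ->
  forall i j, exists C, forall m, \sum_(k < m) normc ((A ^+ k * B) i j) <= C.
Proof.
elim: s B => [|a s IH] B s1.
  rewrite big_nil rmorph1 mul1r => -> i j; exists 0 => m.
  rewrite big1// => k _; rewrite mulr0 mxE; exact: ComplexField.Normc.normc0.
rewrite big_cons mulrC rmorphM /= -mulrA => sB0 i j.
have [|W WP] := IH _ _ sB0 i j.
  by move=> b bs; apply: s1; rewrite inE bs orbT.
apply: (@affine_recursion_summable (fun k => normc ((A ^+ k * B) i j))
  (fun k => normc ((A ^+ k * (horner_mx A ('X - a%:P) * B)) i j)) (normc a) W _ _ _ _ WP).
- by move=> m; case: (_ i j) => x y /=; exact: sqrtr_ge0.
- by case: (a) => x y /=; exact: sqrtr_ge0.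
- by apply: s1; rewrite inE eqxx.
- move=> m; rewrite rmorphB /= horner_mx_X horner_mx_C.
  have -> : A ^+ m.+1 * B = a *: (A ^+ m * B) + A ^+ m * ((A - a%:M) * B).
    rewrite mulrBl mulrBr mulrA -exprSr [a%:M * B]mul_scalar_mx -scalerAr.
    by rewrite addrC subrK.
  rewrite !mxE; apply: (le_trans (@le_normcD R _ _)).
  by rewrite ComplexField.Normc.normcM.
Qed.

Lemma powers_summable n (A : 'M[R]_n) : spectral_radius A < 1 ->
  forall i j, exists C, forall m, \sum_(k < m) `|(A ^+ k) i j| <= C.
Proof.
move=> rho i j.
have n0 : (0 < n)%N by case: n i {j A rho} => [[]|].
case: n n0 A rho i j => // n' _ A rho i j.
have [s sE s_eig] := char_poly_roots (map_mx (real_complex R) A).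
have s1 a : a \in s -> normc a < 1.
  by move=> /s_eig /eigenvalue_norm_le /le_lt_trans; apply.
(* By Cayley-Hamilton the identity matrix is annihilated by the full list of roots. *)
have := @annihilated_powers_summable _ (map_mx (real_complex R) A) s 1 s1.
rewrite -sE Cayley_Hamilton mul0r => /(_ erefl i j)[C CP]; exists C => m.
apply: le_trans (CP m); rewrite le_eqVlt; apply/orP; left; apply/eqP.
apply: eq_bigr => k _; rewrite mulr1.
have -> : map_mx (real_complex R) A ^+ k = map_mx (real_complex R) (A ^+ k).
  elim: (nat_of_ord k) => [|q IH]; first by rewrite !expr0 map_mx1.
  by rewrite !exprS IH; exact: (esym (map_mxM _ _ _)).
rewrite mxE /=.
by rewrite expr0n /= addr0 sqrtr_sqr.
Qed.

Lemma neumann_series n (A : 'M[R]_n) : spectral_radius A < 1 ->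
  forall i j, (fun m => \sum_(k < m) (A ^+ k) i j) @ \oo --> invmx (1%:M - A) i j.
Proof.
move=> rho.
have cvS i j : cvgn (fun m => \sum_(k < m) (A ^+ k) i j).
  have [C CP] := powers_summable rho i j.
  rewrite (_ : (fun m => _) = series (fun k => (A ^+ k) i j)); last by rewrite seriesEord.
  apply: normed_cvg; apply: nondecreasing_is_cvgn.
    by apply/nondecreasing_seqP => m; rewrite /normed_series_of seriesSr lerDl normr_ge0.
  by exists C => _ [m _ <-]; rewrite /normed_series_of seriesEord; exact: CP.
(* The entrywise limit satisfies [(1 - A) S = 1], because [A^m] tends to 0; this also provides the
   invertibility of [1 - A]. *)
pose S : 'M[R]_n := \matrix_(i, j) limn (fun m => \sum_(k < m) (A ^+ k) i j).
have SP i j : (fun m => \sum_(k < m) (A ^+ k) i j) @ \oo --> S i j.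
  by rewrite mxE; exact: cvS.
have A0 i j : (fun m => (A ^+ m) i j) @ \oo --> (0 : R).
  have := cvg_series_cvg_0 (u_ := fun k => (A ^+ k) i j); apply.
  by rewrite seriesEord; exact: cvS.
have AS : (1%:M - A) *m S = 1%:M.
  apply/matrixP => i j.
  have L1 : (fun m => \sum_l (1%:M - A) i l * \sum_(k < m) (A ^+ k) l j) @ \oo
      --> ((1%:M - A) *m S) i j.
    rewrite mxE; apply: (@cvg_big _ _ _ _ _ _ _ _ _
      (fun l m => (1%:M - A) i l * \sum_(k < m) (A ^+ k) l j)
      (fun l => (1%:M - A) i l * S l j)).
      exact: add_continuous.
    by move=> l _; apply: cvgMl_tmp; exact: SP.
  have L2 : (fun m => \sum_l (1%:M - A) i l * \sum_(k < m) (A ^+ k) l j) @ \oo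
      --> (1%:M - 0 : 'M[R]_n) i j.
    have -> : (fun m => \sum_l (1%:M - A) i l * \sum_(k < m) (A ^+ k) l j) =
        (fun m => (1%:M : 'M[R]_n) i j - (A ^+ m) i j).
      apply/funext => m.
      transitivity (((1%:M - A) *m \sum_(k < m) A ^+ k) i j).
        by rewrite [RHS]mxE; apply: eq_bigr => l _; rewrite summxE.
      have -> : (1%:M - A) *m \sum_(k < m) A ^+ k = 1%:M - A ^+ m.
        elim: m => [|m IH]; first by rewrite big_ord0 mulmx0 expr0 subrr.
        rewrite big_ord_recr /= mulmxDr IH mulmxBl mul1mx.
        by rewrite -[A *m A ^+ m]/(A * A ^+ m) -exprS addrA subrK.
      by rewrite !mxE.
    by rewrite !mxE; apply: cvgB; [exact: cvg_cst|exact: A0].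
  have := cvg_unique _ L1 L2; rewrite subr0; exact.
have [Au _] := mulmx1_unit AS.
have -> : invmx (1%:M - A) = S by rewrite -[RHS](mulKmx Au) AS mulmx1.
exact: SP.
Qed.

End neumann_series.

(** * Lebesgue measure under translation *)

Section lebesgue_translation.
Context (R : realType).
Local Notation mu := (@lebesgue_measure R).

Lemma measurable_shift (c : R) :
  measurable_fun setT ((fun x => x + c) : measurableTypeR R -> measurableTypeR R).
Proof. by apply: measurable_funD => //; exact: measurable_cst. Qed.

Lemma lebesgue_measure_shift (c : R) (A : set R) : measurable A ->
  pushforward mu ((fun x => x + c) : _ -> measurableTypeR R) A = mu A.
Proof.
move=> mA.
apply/esym.
have := @lebesgue_measure_unique R (pushforward mu ((fun x => x + c) : measurableTypeR R -> measurableTypeR R)).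
apply => //; first exact: measurable_shift.
move=> mphi _ [[a b]] _ <-.
transitivity (mu `](a - c)%R, (b - c)%R]%classic); last first.
  congr (mu _); apply/seteqP.
  by split => x /=; rewrite !in_itv /= lerBrDr ltrBlDr.
rewrite !lebesgue_measure_itv/= !lte_fin ltrD2r.
by case: ifP => // _; rewrite -!EFinB; congr (_%:E); ring.
Qed.

Lemma integral_shift (c : R) (f : R -> \bar R) :
  measurable_fun setT f -> (forall x, (0 <= f x)%E) ->
  (\int[mu]_x f (x + c)%R = \int[mu]_x f x)%E.
Proof.
move=> mf f0.
transitivity (integral (pushforward mu ((fun x : measurableTypeR R => (x + c)%R) : _ -> measurableTypeR R)) setT f).
  by rewrite ge0_integral_pushforward//; exact: measurable_shift.
apply: eq_measure_integral => [|mphi A mA _]; first exact: measurable_shift.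
exact: lebesgue_measure_shift.
Qed.

(** Tonelli and the substitution [t = r + s]. Stated against a test function with values in the
    extended reals, the identity makes sense even where the convolution is infinite. *)
Lemma convolution_integral (a b : R -> R) (f : R -> \bar R) :
  measurable_fun setT a -> measurable_fun setT b -> measurable_fun setT f ->
  (forall x, 0 <= a x) -> (forall x, 0 <= b x) -> (forall x, 0 <= f x)%E ->
  (\int[mu]_t ((\int[mu]_s (a (t - s) * b s)%:E) * f t) =
   \int[mu]_r ((a r)%:E * \int[mu]_s ((b s)%:E * f (r + s)%R)))%E.
Proof.
move=> ma mb mf a0 b0 f0.
pose g (z : measurableTypeR R * measurableTypeR R) := ((a (z.1 - z.2) * b z.2)%:E * f z.1)%E.
pose h (z : measurableTypeR R * measurableTypeR R) := ((a z.1 * b z.2)%:E * f (z.1 + z.2)%R)%E.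
have m1 : measurable_fun setT (fst : measurableTypeR R * measurableTypeR R -> R) by exact: measurable_fst.
have m2 : measurable_fun setT (snd : measurableTypeR R * measurableTypeR R -> R) by exact: measurable_snd.
have mg : measurable_fun setT g.
  apply: emeasurable_funM; last exact: (measurableT_comp mf m1).
  apply/measurable_EFinP; apply: measurable_funM; last exact: (measurableT_comp mb m2).
  by apply: (measurableT_comp ma); exact: measurable_funB.
have mh : measurable_fun setT h.
  apply: emeasurable_funM; last first.
    by apply: (measurableT_comp mf); exact: measurable_funD.
  apply/measurable_EFinP; apply: measurable_funM; last exact: (measurableT_comp mb m2).
  exact: (measurableT_comp ma m1).
have g0 z : (0 <= g z)%E by rewrite mule_ge0// lee_fin mulr_ge0.
have h0 z : (0 <= h z)%E by rewrite mule_ge0// lee_fin mulr_ge0.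
transitivity (\int[mu]_t \int[mu]_s g (t, s))%E.
  apply: eq_integral => t _; rewrite -ge0_integralZr//; last first.
    by move=> s _; rewrite lee_fin mulr_ge0.
  apply/measurable_EFinP; apply: measurable_funM => //.
  by apply: (measurableT_comp ma); apply: measurable_funB => //; exact: measurable_cst.
rewrite (@fubini_tonelli _ _ _ _ R mu mu g mg g0).
transitivity (\int[mu]_s \int[mu]_t h (t, s))%E.
  apply: eq_integral => s _.
  rewrite -(@integral_shift s (fun t => g (t, s))).
  - apply: eq_integral => t _; rewrite /g /h /=.
    by rewrite (_ : t + s - s = t)//; ring.
  - exact: (measurableT_comp mg (pair2_measurable s)).
  - by move=> t; exact: g0.
rewrite -(@fubini_tonelli _ _ _ _ R mu mu h mh h0).
apply: eq_integral => r _; rewrite -ge0_integralZl//.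
- by apply: eq_integral => s _; rewrite /h /= EFinM muleA.
- apply: emeasurable_funM; first exact/measurable_EFinP.
  by apply: (measurableT_comp mf); apply: measurable_funD => //; exact: measurable_cst.
- by move=> s _; rewrite mule_ge0// lee_fin.
- by rewrite lee_fin.
Qed.

End lebesgue_translation.

(** * Measures given by a density *)

Section density.
Context d (T : measurableType d) (R : realType) (mu : {measure set T -> \bar R}).
Variable g : T -> R.
Hypothesis mg : measurable_fun setT g.
Hypothesis g0 : forall x, 0 <= g x.
Local Open Scope ereal_scope.

Definition density (A : set T) := \int[mu]_(x in A) (g x)%:E.

Let density0 : density set0 = 0. Proof. by rewrite /density integral_set0. Qed.
Let density_ge0 A : 0 <= density A.
Proof. by apply: integral_ge0 => x _; rewrite lee_fin. Qed.
Let density_sigma_additive : semi_sigma_additive density.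
Proof.
move=> F mF tF mUF; rewrite /density ge0_integral_bigcup//.
  apply: is_cvg_nneseries => n _ _; exact: density_ge0.
  by apply: measurable_funTS; exact/measurable_EFinP.
by move=> x _; rewrite lee_fin.
Qed.

Definition density_measure : {measure set T -> \bar R} :=
  HB.pack density (isMeasure.Build _ _ _ density density0 density_ge0 density_sigma_additive).

Import HBNNSimple.

Lemma integral_density (f : T -> \bar R) : measurable_fun setT f -> (forall x, 0 <= f x) ->
  \int[density_measure]_x f x = \int[mu]_x ((g x)%:E * f x).
Proof.
move=> mf f0; pose f_ := nnsfun_approx measurableT mf.
have cf x : (f_ n x)%:E @[n --> \oo] --> f x by exact: cvg_nnsfun_approx.
have ndf x m n : (m <= n)%N -> (f_ m x)%:E <= (f_ n x)%:E.
  by move=> mn; rewrite lee_fin; exact/lefP/nd_nnsfun_approx.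
transitivity (limn (fun n => \int[density_measure]_x (f_ n x)%:E)).
  rewrite -monotone_convergence//.
  - by apply: eq_integral => x _; exact/esym/cvg_lim.
  - by move=> n; exact/measurable_EFinP/measurable_funP.
  - by move=> n x _; rewrite lee_fin.
  - by move=> x _ m n mn; exact: ndf.
transitivity (limn (fun n => \int[mu]_x ((g x)%:E * (f_ n x)%:E))); last first.
  rewrite -monotone_convergence//.
  - apply: eq_integral => x _; apply/cvg_lim => //.
    by apply: cvgeZl => //; exact: cf.
  - move=> n; apply: emeasurable_funM; first exact/measurable_EFinP.
    exact/measurable_EFinP/measurable_funP.
  - by move=> n x _; rewrite mule_ge0// lee_fin.
  - by move=> x _ m n mn; rewrite lee_wpmul2l ?lee_fin//; exact: ndf.
congr (limn _); apply/funext => n; set h := f_ n.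
have mh r : measurable (h @^-1` [set r]) by exact: measurable_funPTI.
transitivity (\sum_(r \in range h) \int[density_measure]_x (r * \1_(h @^-1` [set r]) x)%:E).
  under eq_integral do rewrite fimfunE -fsumEFin//.
  rewrite ge0_integral_fsum//.
  - by move=> r; exact/measurable_EFinP/measurable_funM.
  - by move=> r x _; rewrite nnfun_muleindic_ge0.
transitivity (\sum_(r \in range h) \int[mu]_x ((g x)%:E * (r * \1_(h @^-1` [set r]) x)%:E)).
  apply: eq_fsbigr => r /set_mem[x _ <-].
  rewrite (integralZl_indic _ (fun r => h @^-1` [set r]))//; last by move=> ?; rewrite preimage_nnfun0.
  rewrite integral_indic// setIT /= /density integral_mkcond.
  under [RHS]eq_integral do rewrite EFinM muleCA.
  rewrite ge0_integralZl//.
  - by congr (_ * _); apply: eq_integral => y _; rewrite epatch_indic.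
  - by apply: emeasurable_funM; apply/measurable_EFinP => //; exact: measurable_indic.
  - by move=> y _; rewrite mule_ge0// lee_fin.
  - by rewrite lee_fin.
rewrite -ge0_integral_fsum//.
- apply: eq_integral => x _; rewrite [in RHS]fimfunE -fsumEFin//.
  rewrite -ge0_mule_fsumr// => r; exact: nnfun_muleindic_ge0.
- move=> r; apply: emeasurable_funM; apply/measurable_EFinP => //.
  by apply: measurable_funM => //; exact: measurable_indic.
- by move=> r x _; rewrite mule_ge0 ?lee_fin//; exact: nnfun_muleindic_ge0.
Qed.

End density.

(** * The cluster measure *)

(** Extension by zero lets convolutions run over the whole line, where the Lebesgue measure is
    translation invariant. *)
Definition onpos (R : realType) (a : R -> R) : R -> R := fun t => if 0 <= t then a t else 0.

Section onpos_theory.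
Context (R : realType).
Local Notation mu := (@lebesgue_measure R).

Lemma onpos_measurable (a : R -> R) : measurable_fun `[(0 : R), +oo[ a -> measurable_fun setT (onpos a).
Proof.
move=> ma; rewrite (_ : onpos a = a \_ `[0, +oo[%classic).
  by apply/(measurable_restrictT _ _).1.
by apply/funext => t; rewrite /onpos patchE mem_setE in_itv /= andbT.
Qed.

Lemma integral_onpos (a : R -> R) (f : R -> \bar R) :
  (\int[mu]_(t in `[0%R, +oo[) ((a t)%:E * f t) = \int[mu]_t ((onpos a t)%:E * f t))%E.
Proof.
rewrite integral_mkcond; apply: eq_integral => t _.
rewrite /onpos patchE mem_setE in_itv /= andbT.
by case: ifP => // _; rewrite mul0e.
Qed.

Lemma integral_onpos1 (a : R -> R) :
  (\int[mu]_(t in `[0%R, +oo[) (a t)%:E = \int[mu]_t (onpos a t)%:E)%E.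
Proof.
rewrite integral_mkcond; apply: eq_integral => t _.
rewrite /onpos patchE mem_setE in_itv /= andbT.
by case: ifP.
Qed.

End onpos_theory.

(* [lebesgue_measure] lives on [measurableTypeR R], which has the same measurable
   sets as [R] but is a different structure. *)
Section real_copy.
Context (R : realType) (m : {measure set (measurableTypeR R) -> \bar R}).

Let id_measurable : measurable_fun setT (fun x : measurableTypeR R => x : R).
Proof. by move=> _ A mA; rewrite setTI. Qed.

Definition real_copy : {measure set R -> \bar R} :=
  measure_function_pushforward__canonical__measure_function_Measure m id_measurable.

Lemma integral_real_copy (f : R -> \bar R) : measurable_fun setT f -> (forall x, 0 <= f x)%E ->
  (\int[real_copy]_x f x = \int[m]_x f x)%E.
Proof. by move=> mf f0; rewrite /real_copy ge0_integral_pushforward. Qed.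

End real_copy.

Section convolution_powers.
Context (R : realType) (d : nat).
Local Notation mu := (@lebesgue_measure R).
Variable phi : R -> 'M[R]_d.
Hypothesis mphi : forall i j, measurable_fun `[(0 : R), +oo[ (fun t : R => phi t i j).
Hypothesis phi0 : forall i j t, 0 <= t -> 0 <= phi t i j.
Hypothesis phi_int : forall i j,
  (\int[mu]_(t in `[0%R, +oo[) (phi t i j)%:E < +oo)%E.
Local Notation K := (branching_matrix phi).

Let p n i j := onpos (fun t => phi_pow phi n.+1 t i j).

(* [phi_pow] takes a junk value where the convolution is infinite; [conv] does
   not. *)
Let conv n i j t := (\sum_(l < d) \int[mu]_s (p 0 i l (t - s) * p n l j s)%:E)%E.

Lemma phi_powS n t i j : 0 <= t ->
  phi_pow phi n.+2 t i j = fine (\int[mu]_(s in `[0%R, t]) (\sum_(l < d) phi (t - s) i l * phi_pow phi n.+1 s l j)%:E)%E.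
Proof.
move=> t0; rewrite /phi_pow /= /convolve mxE; congr fine.
by apply: eq_integral => s _; rewrite mxE.
Qed.

Lemma branchingE i j : (K i j)%:E = (\int[mu]_t (p 0 i j t)%:E)%E.
Proof.
rewrite /branching_matrix mxE fineK.
  by rewrite integral_onpos1.
rewrite ge0_fin_numE; first exact: phi_int.
by apply: integral_ge0 => t; rewrite /= in_itv /= andbT lee_fin; exact: phi0.
Qed.

(** The induction hypothesis on [phi_pow]. Its last clause makes the mass finite, which keeps the
    next convolution finite almost everywhere. *)
Let good n := forall i j, [/\ measurable_fun setT (p n i j), (forall t, 0 <= p n i j t) &
  (\int[mu]_t (p n i j t)%:E = ((K ^+ n.+1) i j)%:E)%E].

Let good0 : good 0.
Proof.
move=> i j; split.
- by apply: onpos_measurable; exact: mphi.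
- by move=> t; rewrite /p /onpos; case: ifP => //; exact: phi0.
- by rewrite expr1 branchingE.
Qed.

Let convE n i j t : good n -> 0 <= t ->
  conv n i j t = (\int[mu]_(s in `[0%R, t]) (\sum_(l < d) phi (t - s) i l * phi_pow phi n.+1 s l j)%:E)%E.
Proof.
move=> gn t0; rewrite /conv [RHS]integral_mkcond -ge0_integral_sum//.
- apply: eq_integral => s _; rewrite patchE mem_setE in_itv /= /p /onpos subr_ge0.
  case: (boolP (0 <= s)) => s0; case: (boolP (s <= t)) => st //=; rewrite sumEFin//.
  + by congr (_%:E); rewrite big1// => l _; rewrite mul0r.
  + by congr (_%:E); rewrite big1// => l _; rewrite mulr0.
  + by congr (_%:E); rewrite big1// => l _; rewrite mul0r.
- move=> l; have [m0 _ _] := good0 i l; have [mn _ _] := gn l j.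
  apply/measurable_EFinP; apply: measurable_funM => //.
  by apply: (measurableT_comp m0); apply: measurable_funB => //; exact: measurable_cst.
- move=> l s _; rewrite lee_fin mulr_ge0//; first by have [_ + _] := good0 i l; apply.
  by have [_ + _] := gn l j; apply.
Qed.

Let conv_ge0 n i j t : good n -> (0 <= conv n i j t)%E.
Proof.
move=> gn; apply: sume_ge0 => l _; apply: integral_ge0 => s _; rewrite lee_fin mulr_ge0//.
  by have [_ + _] := good0 i l; apply.
by have [_ + _] := gn l j; apply.
Qed.

Let conv_neg n i j t : good n -> t < 0 -> conv n i j t = 0%E.
Proof.
move=> gn t0; apply: big1 => l _; rewrite integral0_eq// => s _.
rewrite /p /onpos subr_ge0; case: ifP => st; last by rewrite mul0r.
case: ifP => s0; last by rewrite mulr0.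
by have := le_lt_trans (le_trans s0 st) t0; rewrite ltxx.
Qed.

Let conv1_measurable n (i j l : 'I_d) : good n ->
  measurable_fun setT (fun t : R => \int[mu]_s (p 0 i l (t - s) * p n l j s)%:E)%E.
Proof.
move=> gn; have [m0 p00 _] := good0 i l; have [mn pn0 _] := gn l j.
pose g (z : measurableTypeR R * measurableTypeR R) := (p 0 i l (z.1 - z.2) * p n l j z.2)%:E.
apply: (@measurable_fun_fubini_tonelli_F _ _ _ _ R mu g).
  have m1 : measurable_fun setT (fst : measurableTypeR R * measurableTypeR R -> R) by exact: measurable_fst.
  have m2 : measurable_fun setT (snd : measurableTypeR R * measurableTypeR R -> R) by exact: measurable_snd.
  apply/measurable_EFinP; apply: measurable_funM; last exact: (measurableT_comp mn m2).
  by apply: (measurableT_comp m0); exact: measurable_funB.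
by move=> z; rewrite lee_fin mulr_ge0.
Qed.

Let conv_measurable n i j : good n -> measurable_fun setT (conv n i j).
Proof. by move=> gn; apply: emeasurable_sum => l; exact: conv1_measurable. Qed.

Let conv_test n i j (f : R -> \bar R) : good n ->
  measurable_fun setT f -> (forall x, 0 <= f x)%E ->
  (\int[mu]_t (conv n i j t * f t) =
   \sum_(l < d) \int[mu]_r ((p 0 i l r)%:E * \int[mu]_s ((p n l j s)%:E * f (r + s)%R)))%E.
Proof.
move=> gn mf f0.
transitivity (\sum_(l < d) \int[mu]_t ((\int[mu]_s (p 0 i l (t - s) * p n l j s)%:E) * f t))%E.
  rewrite -ge0_integral_sum//.
  - apply: eq_integral => t _; rewrite ge0_sume_distrl// => l _.
    apply: integral_ge0 => s _; rewrite lee_fin mulr_ge0//; first by have [_ + _] := good0 i l; apply.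
    by have [_ + _] := gn l j; apply.
  - by move=> l; apply: emeasurable_funM => //; exact: conv1_measurable.
  - move=> l t _; rewrite mule_ge0//.
    apply: integral_ge0 => s _; rewrite lee_fin mulr_ge0//; first by have [_ + _] := good0 i l; apply.
    by have [_ + _] := gn l j; apply.
apply: eq_bigr => l _; have [m0 p00 _] := good0 i l; have [mn pn0 _] := gn l j.
exact: convolution_integral.
Qed.

Let conv_mass n i j : good n -> (\int[mu]_t conv n i j t = ((K ^+ n.+2) i j)%:E)%E.
Proof.
move=> gn; have := @conv_test n i j (cst 1%E) gn (measurable_cst _) (fun=> lee01).
under eq_integral do rewrite mule1; move=> ->.
have -> : (K ^+ n.+2) i j = \sum_(l < d) K i l * (K ^+ n.+1) l j by rewrite exprS mxE.
rewrite -sumEFin; apply: eq_bigr => l _.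
have [m0 p00 i0] := good0 i l; have [mn pn0 I1] := gn l j.
under eq_integral.
  move=> r _; under eq_integral do rewrite mule1.
  rewrite I1; over.
rewrite ge0_integralZr//.
- by rewrite i0 expr1.
- exact/measurable_EFinP.
- by move=> r _; rewrite lee_fin.
- by rewrite -I1; apply: integral_ge0 => r _; rewrite lee_fin.
Qed.

(** The convolution has a finite integral, hence is finite almost everywhere, and [fine] alters it
    only on a null set, invisible to every test function. *)
Let conv_pow n i j : good n ->
  measurable_fun setT (p n.+1 i j) /\ (forall t, 0 <= p n.+1 i j t) /\
  (forall f, measurable_fun setT f -> (forall x, 0 <= f x)%E ->
    \int[mu]_t ((p n.+1 i j t)%:E * f t) = \int[mu]_t (conv n i j t * f t))%E.
Proof.
move=> gn.
have pE t : p n.+1 i j t = fine (conv n i j t).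
  rewrite /p /onpos; case: ifPn => t0; first by rewrite phi_powS// convE.
  by rewrite conv_neg// ltNge.
have mp : measurable_fun setT (p n.+1 i j).
  rewrite (_ : p n.+1 i j = fine \o conv n i j); last by apply/funext => t; rewrite pE.
  by apply: measurableT_comp => //; exact: conv_measurable.
have p0 t : 0 <= p n.+1 i j t by rewrite pE fine_ge0//; exact: conv_ge0.
split => //; split => // f mf f0.
apply: ge0_ae_eq_integral => //.
- by apply: emeasurable_funM => //; exact/measurable_EFinP.
- by apply: emeasurable_funM => //; exact: conv_measurable.
- by move=> t _; rewrite mule_ge0// lee_fin.
- by move=> t _; rewrite mule_ge0//; exact: conv_ge0.
have ic : mu.-integrable setT (conv n i j).
  apply/integrableP; split; first exact: conv_measurable.
  under eq_integral do rewrite gee0_abs ?conv_ge0//.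
  by rewrite conv_mass// ltry.
have [N [mN N0 NP]] := integrable_ae measurableT ic; exists N; split => // t /= Ht.
by apply: NP => /= Hfin; apply: Ht => _; rewrite pE fineK//; exact: Hfin.
Qed.

Lemma phi_pow_good n : good n.
Proof.
elim: n => [|n gn]; first exact: good0.
move=> i j; have [mp [p0 pI]] := conv_pow i j gn; split => //.
rewrite -(conv_mass i j gn).
have := pI (cst 1%E) (measurable_cst _) (fun=> lee01).
by under eq_integral do rewrite mule1; under [X in _ = X -> _]eq_integral do rewrite mule1.
Qed.

Lemma phi_pow_convl n i j (f : R -> \bar R) : measurable_fun setT f -> (forall x, 0 <= f x)%E ->
  (\int[mu]_t ((p n.+1 i j t)%:E * f t) =
   \sum_(l < d) \int[mu]_r ((p 0 i l r)%:E * \int[mu]_s ((p n l j s)%:E * f (r + s)%R)))%E.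
Proof.
move=> mf f0; have [_ [_ pI]] := conv_pow i j (phi_pow_good n).
by rewrite pI// conv_test//; exact: phi_pow_good.
Qed.

Let inner_measurable (a : R -> R) (f : R -> \bar R) :
  measurable_fun setT a -> (forall x, 0 <= a x) ->
  measurable_fun setT f -> (forall x, 0 <= f x)%E ->
  measurable_fun setT (fun r : R => \int[mu]_s ((a s)%:E * f (r + s)%R))%E.
Proof.
move=> ma a0 mf f0.
pose g (z : measurableTypeR R * measurableTypeR R) := ((a z.2)%:E * f (z.1 + z.2)%R)%E.
apply: (@measurable_fun_fubini_tonelli_F _ _ _ _ R mu g).
  have m1 : measurable_fun setT (fst : measurableTypeR R * measurableTypeR R -> R) by exact: measurable_fst.
  have m2 : measurable_fun setT (snd : measurableTypeR R * measurableTypeR R -> R) by exact: measurable_snd.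
  apply: emeasurable_funM; first by apply/measurable_EFinP; exact: (measurableT_comp ma m2).
  by apply: (measurableT_comp mf); exact: measurable_funD.
by move=> z; rewrite mule_ge0// lee_fin.
Qed.

Let inner_ge0 (a : R -> R) (f : R -> \bar R) r : (forall x, 0 <= a x) -> (forall x, 0 <= f x)%E ->
  (0 <= \int[mu]_s ((a s)%:E * f (r + s)%R))%E.
Proof. by move=> a0 f0; apply: integral_ge0 => s _; rewrite mule_ge0// lee_fin. Qed.

(* The defining recursion convolves on the left; associativity lets one
   convolve on the right instead. *)
Lemma phi_pow_convr n i j (f : R -> \bar R) : measurable_fun setT f -> (forall x, 0 <= f x)%E ->
  (\int[mu]_t ((p n.+1 i j t)%:E * f t) =
   \sum_(l < d) \int[mu]_r ((p n i l r)%:E * \int[mu]_s ((p 0 l j s)%:E * f (r + s)%R)))%E.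
Proof.
elim: n i j f => [|n IH] i j f mf f0; first exact: phi_pow_convl.
rewrite (@phi_pow_convl n.+1 i j f mf f0).
have shf r : measurable_fun setT (fun s : R => f (r + s)%R).
  by apply: (measurableT_comp mf); apply: measurable_funD => //; exact: measurable_cst.
(* The symmetric triple integral at [r + s + u]: grouping [(s, u)] gives the left recursion,
   grouping [(r, s)] the right one. *)
transitivity (\sum_(l < d) \sum_(q < d) \int[mu]_r ((p 0 i l r)%:E *
    \int[mu]_s ((p n l q s)%:E * \int[mu]_u ((p 0 q j u)%:E * f (r + (s + u))%R))))%E.
  apply: eq_bigr => l _; have [m0 p00 _] := good0 i l.
  rewrite -ge0_integral_sum//.
  - apply: eq_integral => r _; rewrite (IH l j (fun s => f (r + s)%R))//.
    rewrite ge0_sume_distrr// => q _; apply: integral_ge0 => s _.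
    have [_ p1 _] := phi_pow_good n l q; have [_ p2 _] := good0 q j.
    rewrite mule_ge0 ?lee_fin//; apply: integral_ge0 => u _.
    by rewrite mule_ge0 ?lee_fin.
  - move=> q; have [mn pn _] := phi_pow_good n l q; have [mq pq _] := good0 q j.
    apply: emeasurable_funM; first exact/measurable_EFinP.
    under eq_fun do under eq_integral do under eq_integral do rewrite addrA.
    apply: (@inner_measurable _ (fun x => \int[mu]_u ((p 0 q j u)%:E * f (x + u)%R))%E) => //.
      exact: inner_measurable.
    by move=> x; exact: inner_ge0.
  - move=> q r _; have [mn pn _] := phi_pow_good n l q; have [mq pq _] := good0 q j.
    rewrite mule_ge0 ?lee_fin//; apply: integral_ge0 => s _; rewrite mule_ge0 ?lee_fin//.
    by apply: integral_ge0 => u _; rewrite mule_ge0 ?lee_fin.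
rewrite exchange_big /=; apply: eq_bigr => q _; have [mq pq _] := good0 q j.
rewrite (@phi_pow_convl n i q (fun r => \int[mu]_s ((p 0 q j s)%:E * f (r + s)%R))%E).
- apply: eq_bigr => l _; apply: eq_integral => r _; congr (_ * _)%E.
  by apply: eq_integral => s _; congr (_ * _)%E; apply: eq_integral => u _; rewrite addrA.
- exact: inner_measurable.
- by move=> x; exact: inner_ge0.
Qed.

Hypothesis rho_lt1 : spectral_radius K < 1.
Local Notation S := (invmx (1%:M - K)).

Let Psi i j t := (\sum_(n <oo) (p n i j t)%:E)%E.

Let Psi_measurable i j : measurable_fun setT (Psi i j).
Proof.
apply: ge0_emeasurable_sum => n; first by move=> t _ _; rewrite lee_fin; have [_ + _] := phi_pow_good n i j; apply.
by move=> _; apply/measurable_EFinP; have [] := phi_pow_good n i j.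
Qed.

Let Psi_ge0 i j t : (0 <= Psi i j t)%E.
Proof. by apply: nneseries_ge0 => n _ _; rewrite lee_fin; have [_ + _] := phi_pow_good n i j; apply. Qed.

Let Psi_test i j (f : R -> \bar R) : measurable_fun setT f -> (forall x, 0 <= f x)%E ->
  (forall x, f x \is a fin_num) ->
  (\int[mu]_t (Psi i j t * f t) = \sum_(n <oo) \int[mu]_t ((p n i j t)%:E * f t))%E.
Proof.
move=> mf f0 ffin; rewrite -integral_nneseries//.
- apply: eq_integral => t _; rewrite -(fineK (ffin t)) muleC -nneseriesZl//.
    by apply: eq_eseriesr => n _; rewrite muleC.
  by move=> n _; rewrite lee_fin; have [_ + _] := phi_pow_good n i j; apply.
- move=> n; apply: emeasurable_funM => //; apply/measurable_EFinP.
  by have [] := phi_pow_good n i j.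
- by move=> n t _; rewrite mule_ge0// lee_fin; have [_ + _] := phi_pow_good n i j; apply.
Qed.

Let Psi_mass i j : (\int[mu]_t Psi i j t = (S i j - (i == j)%:R)%:E)%E.
Proof.
have := @Psi_test i j (cst 1%E) (measurable_cst _) (fun=> lee01) (fun=> isT).
under eq_integral do rewrite mule1; move=> ->.
rewrite (eq_eseriesr (g := fun n => ((K ^+ n.+1) i j)%:E)); last first.
  by move=> n _; under eq_integral do rewrite mule1; have [] := phi_pow_good n i j.
apply/cvg_lim => //; apply: cvg_EFin; first by apply: nearW => n; rewrite sumEFin.
(* The masses start at [K^1], the Neumann series at the identity. *)
rewrite (_ : _ \o _ = fun m => \sum_(k < m.+1) (K ^+ k) i j - (i == j)%:R); last first.
  apply/funext => m; rewrite /= sumEFin /= big_mkord big_ord_recl expr0 mxE.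
  by rewrite addrAC subrr add0r.
apply: cvgB; last exact: cvg_cst.
by have := neumann_series rho_lt1 (i := i) (j := j); rewrite -cvg_shiftS.
Qed.

Lemma psiE i j t : onpos (fun t => psi phi t i j) t = fine (Psi i j t).
Proof.
rewrite /onpos /Psi; case: ifPn => t0; last first.
  rewrite eseries0//= => n _ _; rewrite /p /onpos.
  by rewrite (negbTE t0).
rewrite /psi mxE; congr fine.
pose u n := (onpos (fun t => phi_pow phi n t i j) t)%:E.
transitivity (\sum_(1 <= n <oo) u n)%E.
  by apply: eq_eseriesr => n _; rewrite /u /onpos t0.
have u0 n : (0 <= u n)%E.
  case: n => [|n]; last by rewrite lee_fin; have [_ + _] := phi_pow_good n i j; apply.
  by rewrite lee_fin /u /onpos t0 /phi_pow /=; exact: phi0.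
by rewrite -(nneseries_addn 1 u0); apply: eq_eseriesr => n _; rewrite addn1.
Qed.

Let q i j := onpos (fun t => psi phi t i j).

Lemma psi_measurable i j : measurable_fun setT (q i j).
Proof.
rewrite (_ : q i j = fine \o Psi i j); last by apply/funext => t; rewrite /q psiE.
exact: measurableT_comp.
Qed.

Lemma psi_ge0 i j t : 0 <= q i j t.
Proof. by rewrite /q psiE fine_ge0. Qed.

Let psi_test i j (f : R -> \bar R) : measurable_fun setT f -> (forall x, 0 <= f x)%E ->
  (\int[mu]_t ((q i j t)%:E * f t) = \int[mu]_t (Psi i j t * f t))%E.
Proof.
move=> mf f0; apply: ge0_ae_eq_integral => //.
- by apply: emeasurable_funM => //; apply/measurable_EFinP; exact: psi_measurable.
- by apply: emeasurable_funM => //; exact: Psi_measurable.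
- by move=> t _; rewrite mule_ge0// lee_fin psi_ge0.
- by move=> t _; rewrite mule_ge0.
have ic : mu.-integrable setT (Psi i j).
  apply/integrableP; split; first exact: Psi_measurable.
  under eq_integral do rewrite gee0_abs//.
  by rewrite Psi_mass ltry.
have [N [mN N0 NP]] := integrable_ae measurableT ic; exists N; split => // t /= Ht.
by apply: NP => /= Hfin; apply: Ht => _; rewrite /q psiE fineK//; exact: Hfin.
Qed.

Lemma psi_mass i j : (\int[mu]_t (q i j t)%:E = (S i j - (i == j)%:R)%:E)%E.
Proof.
rewrite -Psi_mass; have := @psi_test i j (cst 1%E) (measurable_cst _) (fun=> lee01).
by under eq_integral do rewrite mule1; under [X in _ = X -> _]eq_integral do rewrite mule1.
Qed.

(** The renewal equation [psi = phi + psi * phi] in tested form, by summing [phi_pow_convr]. The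
    kernel stands on the left, as in the path identity, where it acts on compensators built from
    [phi]. The bound [c] keeps the inner integrals finite, as [Psi_test] asks. *)
Lemma psi_convr i j (f : R -> R) c : measurable_fun setT f -> (forall x, 0 <= f x) ->
  (forall x, f x <= c) ->
  (\int[mu]_t ((q i j t)%:E * (f t)%:E) = \int[mu]_t ((p 0 i j t)%:E * (f t)%:E) +
   \sum_(l < d) \int[mu]_r ((q i l r)%:E * \int[mu]_s ((p 0 l j s)%:E * (f (r + s)%R)%:E)))%E.
Proof.
move=> mf f0 fc; have mEf : measurable_fun setT (EFin \o f) by exact/measurable_EFinP.
have Ef0 x : (0 <= (f x)%:E)%E by rewrite lee_fin.
pose g l r := (\int[mu]_s ((p 0 l j s)%:E * (f (r + s)%R)%:E))%E.
have mg l : measurable_fun setT (g l).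
  have [m0 p00 _] := good0 l j.
  exact: (@inner_measurable _ (EFin \o f)).
have g0 l r : (0 <= g l r)%E.
  have [m0 p00 _] := good0 l j.
  exact: (@inner_ge0 _ (EFin \o f)).
have gfin l r : g l r \is a fin_num.
  have [m0 p00 i0] := good0 l j.
  rewrite ge0_fin_numE//; apply: (@le_lt_trans _ _ (\int[mu]_s ((p 0 l j s)%:E * c%:E))%E).
    apply: ge0_le_integral => //.
    - by move=> s _; rewrite mule_ge0 ?lee_fin.
    - apply: emeasurable_funM; first exact/measurable_EFinP.
      by apply: (measurableT_comp mEf); apply: measurable_funD => //; exact: measurable_cst.
    - by apply: emeasurable_funM; [exact/measurable_EFinP|exact: measurable_cst].
    - by move=> s _; rewrite lee_wpmul2l ?lee_fin.
  have c0 : 0 <= c by exact: le_trans (f0 0) (fc 0).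
  rewrite ge0_integralZr//.
  - by rewrite i0 ltry.
  - exact/measurable_EFinP.
  - by move=> s _; rewrite lee_fin.
rewrite psi_test// Psi_test//.
have pI0 n : (0 <= \int[mu]_t ((p n i j t)%:E * (f t)%:E))%E.
  have [_ pn _] := phi_pow_good n i j.
  by apply: integral_ge0 => t _; rewrite mule_ge0 ?lee_fin.
rewrite nneseries_recl//; congr (_ + _)%E.
rewrite -(@nneseries_addn _ (fun n => \int[mu]_t ((p n i j t)%:E * (f t)%:E))%E)//.
under eq_eseriesr do rewrite addn1.
under eq_eseriesr => n _ do rewrite (@phi_pow_convr n i j (EFin \o f) mEf Ef0).
rewrite nneseries_sum; last first.
  move=> l n _; have [_ pn _] := phi_pow_good n i l.
  by apply: integral_ge0 => r _; rewrite mule_ge0 ?lee_fin//; exact: g0.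
apply: eq_bigr => l _.
by rewrite (@psi_test i l (g l))// Psi_test.
Qed.

Lemma offspring_integralE l j y : (\int[mu]_(t in `[0, y]) phi t l j)%:E =
  (\int[mu]_t ((p 0 l j t)%:E * (\1_(`]-oo, y]%classic) t)%:E))%E.
Proof.
have [m0 p00 i0] := good0 l j.
have E : (\int[mu]_(t in `[0%R, y]) (phi t l j)%:E)%E =
    (\int[mu]_t ((p 0 l j t)%:E * (\1_(`]-oo, y]%classic) t)%:E))%E.
  rewrite integral_mkcond; apply: eq_integral => t _.
  rewrite patchE indicE !mem_setE !in_itv /= /p /onpos.
  by case: (0 <= t); case: (t <= y); rewrite ?mule1 ?mule0 ?mul0e.
rewrite /Rintegral E fineK// ge0_fin_numE; last first.
  by apply: integral_ge0 => t _; rewrite mule_ge0 ?lee_fin.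
apply: (@le_lt_trans _ _ (\int[mu]_t (p 0 l j t)%:E)%E); last by rewrite i0 ltry.
apply: ge0_le_integral => //.
- by move=> t _; rewrite mule_ge0 ?lee_fin.
- by apply: emeasurable_funM; apply/measurable_EFinP => //; exact: measurable_indic.
- exact/measurable_EFinP.
- by move=> t _; rewrite -EFinM lee_fin ler_piMr// indicE; case: (_ \in _).
Qed.

(** The kernel is a genuine measure because [psi] is measurable and nonnegative, and finite because
    [psi] has mass [S - Id]. The final clause is the renewal equation tested on the indicator of a
    half-line. Apart from this list the construction stays hidden. *)
Lemma cluster_kernel : exists kap : 'I_d -> 'I_d -> {finite_measure set R -> \bar R},
  [/\ forall i j, cluster_measure phi i j = kap i j :> (set R -> \bar R),
      forall i j, kap i j setT = (S i j)%:E,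
      forall i j, kap i j `]-oo, (0 : R)[%classic = 0%E,
      forall i j (f : R -> \bar R), measurable_fun setT f -> (forall x, 0 <= f x)%E ->
        (\int[kap i j]_x f x = (i == j)%:R%:E * f 0%R +
           \int[mu]_(s in `[0%R, +oo[) ((psi phi s i j)%:E * f s))%E &
      forall i j (x : R), kap i j `]-oo, x]%classic = (((i == j) && (0 <= x)%R)%:R%:E +
        \sum_(l < d) \int[kap i l]_s (\int[mu]_(t in `[0%R, (x - s)%R]) phi t l j)%:E)%E].
Proof.
pose D (i j : 'I_d) : {measure set R -> \bar R} :=
  if i == j then (\d_(0 : R) : {measure set R -> \bar R}) else (mzero : {measure set R -> \bar R}).
pose Q i j : {measure set R -> \bar R} :=
  real_copy (density_measure mu (psi_measurable i j) (psi_ge0 i j)).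
pose M i j : {measure set R -> \bar R} := measure_add (D i j) (Q i j).
have DE i j A : D i j A = ((i == j)%:R%:E * \d_(0%R : R) A)%E.
  by rewrite /D; case: ifP => _; rewrite ?mul1e// mul0e.
have ME i j A : M i j A = ((i == j)%:R%:E * \d_(0%R : R) A + \int[mu]_(x in A) (q i j x)%:E)%E.
  by rewrite -[LHS]/(measure_add (D i j) (Q i j) A) measure_addE DE.
have MT i j : M i j setT = (S i j)%:E.
  rewrite ME psi_mass diracT mule1 -EFinD; congr (_%:E).
  by rewrite addrC subrK.
have fin i j : fin_num_fun (M i j) by apply: lty_fin_num_fun; rewrite MT ltry.
pose kap i j : {finite_measure set R -> \bar R} :=
  HB.pack_for (FiniteMeasure.type R R) (Measure.sort (M i j))
    (@Measure_isFinite.Build _ _ _ (M i j) (fin i j)).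
have kE i j (f : R -> \bar R) : measurable_fun setT f -> (forall x, 0 <= f x)%E ->
        (\int[kap i j]_x f x = (i == j)%:R%:E * f 0%R +
           \int[mu]_(s in `[0%R, +oo[) ((psi phi s i j)%:E * f s))%E.
  move=> mf f0; transitivity (\int[measure_add (D i j) (Q i j)]_x f x)%E; first exact: eq_measure_integral.
  rewrite ge0_integral_measure_add//; congr (_ + _)%E; last first.
    by rewrite integral_onpos /Q integral_real_copy// integral_density.
  rewrite /D; case: ifP => _; last by rewrite integral_measure_zero mul0e.
  by rewrite integral_dirac// diracT !mul1e.
exists kap; split => //.
- move=> i j; apply/funext => A; rewrite /cluster_measure mxE -[RHS]/(M i j A) ME.
  congr (_ + _)%E; rewrite integral_mkcondr; apply: eq_integral => s _.
  by rewrite patchE mem_setE in_itv /= andbT /q /onpos; case: ifP.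
- move=> i j; rewrite -[LHS]/(M i j _) ME diracE memNset; last by rewrite /= in_itv /= ltxx.
  rewrite mule0 add0e integral0_eq// => s; rewrite /= in_itv /= => s0.
  by rewrite /q /onpos leNgt s0.
- move=> i j x; rewrite -[LHS]/(M i j _) ME.
  have mI : measurable_fun setT (\1_(`]-oo, x]%classic) : R -> R) by exact: measurable_indic.
  have I0 y : 0 <= \1_(`]-oo, x]%classic) y :> R by rewrite indicE.
  have I1 y : \1_(`]-oo, x]%classic) y <= 1 :> R by rewrite indicE; case: (_ \in _).
  have mEI : measurable_fun setT (EFin \o (\1_(`]-oo, x]%classic) : R -> R)).
    exact/measurable_EFinP.
  have -> : (\int[mu]_(t in `]-oo, x]) (q i j t)%:E =
      \int[mu]_t ((q i j t)%:E * (\1_(`]-oo, x]%classic) t)%:E))%E.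
    by rewrite integral_mkcond; apply: eq_integral => t _; rewrite epatch_indic.
  rewrite (psi_convr i j mI I0 I1).
  have PhiE l r : (\int[mu]_(t in `[0%R, (x - r)%R]) phi t l j)%:E =
      (\int[mu]_s ((p 0 l j s)%:E * (\1_(`]-oo, x]%classic) (r + s))%:E))%E.
    rewrite offspring_integralE; apply: eq_integral => t _.
    by rewrite !indicE !mem_setE !in_itv /= lerBrDl.
  have mPhi l : measurable_fun setT (fun r : R => (\int[mu]_(t in `[0%R, (x - r)%R]) phi t l j)%:E).
    under eq_fun do rewrite PhiE.
    have [m0 p00 i0] := good0 l j.
    exact: (@inner_measurable _ (EFin \o \1_(`]-oo, x]%classic))).
  have Phi0 l r : (0 <= (\int[mu]_(t in `[0%R, (x - r)%R]) phi t l j)%:E)%E.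
    have [m0 p00 i0] := good0 l j.
    by rewrite PhiE; apply: integral_ge0 => s _; rewrite mule_ge0 ?lee_fin.
  have -> : (\sum_(l < d) \int[kap i l]_s (\int[mu]_(t in `[0%R, (x - s)%R]) phi t l j)%:E =
     \sum_(l < d) ((i == l)%:R%:E * (\int[mu]_(t in `[0%R, x]) phi t l j)%:E) +
     \sum_(l < d) \int[mu]_r ((q i l r)%:E *
       \int[mu]_s ((p 0 l j s)%:E * (\1_(`]-oo, x]%classic) (r + s))%:E)))%E.
    rewrite -big_split /=; apply: eq_bigr => l _.
    rewrite kE// subr0; congr (_ + _)%E.
    by rewrite integral_onpos; apply: eq_integral => r _; rewrite PhiE.
  congr (_ + _)%E.
    by rewrite diracE mem_setE in_itv /=; case: (i == j); rewrite ?mul1e ?mul0e.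
  congr (_ + _)%E.
  rewrite (bigD1 i)//= eqxx mul1e offspring_integralE big1 ?adde0// => l /negbTE li.
  by rewrite eq_sym li mul0e.
Qed.

End convolution_powers.

(** * The two forms of the limit *)

Section tent_theory.
Context (R : realType).

Lemma tent_ge0 (D x : R) : 0 <= tent D x.
Proof. by rewrite /tent le_max lexx orbT. Qed.

Lemma tent_le1 (D x : R) : 0 < D -> tent D x <= 1.
Proof.
by move=> D0; rewrite /tent ge_max ler01 andbT gerBl divr_ge0// ltW.
Qed.

Lemma tentN (D x : R) : tent D (- x) = tent D x.
Proof. by rewrite /tent normrN. Qed.

Lemma tent_measurable (D : R) : measurable_fun setT (tent D).
Proof.
apply: measurable_maxr; last exact: measurable_cst.
apply: measurable_funB; first exact: measurable_cst.
by apply: measurable_funM; [exact: normr_measurable|exact: measurable_cst].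
Qed.

End tent_theory.

Lemma SigmaE (R : realType) d (mu : 'cV[R]_d) (phi : R -> 'M[R]_d) k l :
  Sigma mu phi k l = (\sum_q invmx (1%:M - branching_matrix phi) k q * mu q 0) *+ (k == l).
Proof. by rewrite /Sigma !mxE; case: eqVneq => [->|] //=; rewrite mxE. Qed.

Section limit_covariance.
Context (R : realType) (d : nat).
Local Notation leb := (@lebesgue_measure R).
Variables (mu : 'cV[R]_d) (phi : R -> 'M[R]_d).
Hypothesis mu0 : forall i, 0 <= mu i 0.
Hypothesis mphi : forall i j, measurable_fun `[(0 : R), +oo[ (fun t : R => phi t i j).
Hypothesis phi0 : forall i j t, 0 <= t -> 0 <= phi t i j.
Hypothesis phi_int : forall i j,
  (\int[leb]_(t in `[0%R, +oo[) (phi t i j)%:E < +oo)%E.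
Hypothesis rho_lt1 : spectral_radius (branching_matrix phi) < 1.
Local Notation S := (invmx (1%:M - branching_matrix phi)).

(** The difference [S - Id] is the mass of [psi]. *)
Lemma resolvent_ge i j : (i == j)%:R <= S i j.
Proof.
rewrite -subr_ge0 -lee_fin -(psi_mass mphi phi0 phi_int rho_lt1).
by apply: integral_ge0 => t _; rewrite lee_fin; exact: psi_ge0.
Qed.

Lemma resolvent_ge0 i j : 0 <= S i j.
Proof. by apply: le_trans (resolvent_ge i j). Qed.

Lemma Sigma_ge0 k l : 0 <= Sigma mu phi k l.
Proof.
rewrite SigmaE mulrn_wge0// sumr_ge0// => q _.
by rewrite mulr_ge0//; exact: resolvent_ge0.
Qed.

Let q i j := onpos (fun t => psi phi t i j).
Let mq i j : measurable_fun setT (q i j).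
Proof. by apply: psi_measurable. Qed.
Let q0 i j t : 0 <= q i j t.
Proof. by apply: psi_ge0. Qed.
Let q_mass i j : (\int[leb]_t (q i j t)%:E = (S i j - (i == j)%:R)%:E)%E.
Proof. by apply: psi_mass. Qed.

Variables (D u : R).
Hypothesis D0 : 0 < D.

(** The product of two copies of [delta_0 + psi] has four parts; [J00], [J01], [J10], [J11] are the
    integrals of the tent against them. Both forms of the limit are reduced to the same combination
    [total] of these four. *)
Let J00 : \bar R := (tent D u)%:E.
Let J01 j l : \bar R := (\int[leb]_t ((q j l t)%:E * (tent D (t - u))%:E))%E.
Let J10 i k : \bar R := (\int[leb]_s ((q i k s)%:E * (tent D (s + u))%:E))%E.
Let J11 i k j l : \bar R := (\int[leb]_s ((q i k s)%:E *
  \int[leb]_t ((q j l t)%:E * (tent D (t - s - u))%:E)))%E.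

Let tent_shift c : measurable_fun setT (fun t : R => tent D (t + c)).
Proof.
apply: measurableT_comp; first exact: tent_measurable.
by apply: measurable_funD => //; exact: measurable_cst.
Qed.

Let inner_le j l c : (0 <= \int[leb]_t ((q j l t)%:E * (tent D (t + c))%:E) <= (S j l)%:E)%E.
Proof.
apply/andP; split.
  by apply: integral_ge0 => t _; rewrite mule_ge0 ?lee_fin ?tent_ge0//; exact: q0.
apply: (@le_trans _ _ (\int[leb]_t (q j l t)%:E)%E).
  apply: ge0_le_integral => //.
  - by move=> t _; rewrite mule_ge0 ?lee_fin ?tent_ge0//; exact: q0.
  - by apply: emeasurable_funM; apply/measurable_EFinP; [exact: mq|exact: tent_shift].
  - by apply/measurable_EFinP; exact: mq.
  - by move=> t _; rewrite -EFinM lee_fin ler_piMr ?tent_le1//; exact: q0.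
rewrite q_mass lee_fin.
by have := ler0n R (j == l); lra.
Qed.

Let J01_ge0 j l : (0 <= J01 j l)%E. Proof. by case/andP: (inner_le j l (- u)). Qed.
Let J10_ge0 i k : (0 <= J10 i k)%E. Proof. by case/andP: (inner_le i k u). Qed.
Let J01_fin j l : J01 j l \is a fin_num.
Proof.
rewrite ge0_fin_numE ?J01_ge0//; case/andP: (inner_le j l (- u)) => _ /le_lt_trans; apply.
exact: ltry.
Qed.
Let J10_fin i k : J10 i k \is a fin_num.
Proof.
rewrite ge0_fin_numE ?J10_ge0//; case/andP: (inner_le i k u) => _ /le_lt_trans; apply.
exact: ltry.
Qed.

Let g2 i k j l (z : measurableTypeR R * measurableTypeR R) : \bar R :=
  ((q i k z.1 * q j l z.2)%:E * (tent D (z.2 - z.1 - u))%:E)%E.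

Let g2_measurable i k j l : measurable_fun setT (g2 i k j l).
Proof.
have m1 : measurable_fun setT (fst : measurableTypeR R * measurableTypeR R -> R) by exact: measurable_fst.
have m2 : measurable_fun setT (snd : measurableTypeR R * measurableTypeR R -> R) by exact: measurable_snd.
apply: emeasurable_funM; apply/measurable_EFinP.
  by apply: measurable_funM; [exact: (measurableT_comp (mq i k) m1)|exact: (measurableT_comp (mq j l) m2)].
apply: (measurableT_comp (tent_measurable D)).
by apply: measurable_funB; [exact: measurable_funB|exact: measurable_cst].
Qed.

Let g2_ge0 i k j l z : (0 <= g2 i k j l z)%E.
Proof. by rewrite mule_ge0 ?lee_fin ?tent_ge0// mulr_ge0//; exact: q0. Qed.

Let J11E i k j l : (\int[leb \x leb]_z g2 i k j l z)%E = J11 i k j l.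
Proof.
rewrite (@fubini_tonelli1 _ _ _ _ R leb leb (g2 i k j l) (g2_measurable i k j l) (g2_ge0 i k j l)).
apply: eq_integral => s _; rewrite /fubini_F -ge0_integralZl//.
- by apply: eq_integral => t _; rewrite /g2 /= EFinM muleA.
- apply: emeasurable_funM; apply/measurable_EFinP; first exact: mq.
  by under eq_fun do rewrite -addrA; exact: tent_shift.
- by move=> t _; rewrite mule_ge0 ?lee_fin ?tent_ge0//; exact: q0.
- by rewrite lee_fin; exact: q0.
Qed.

Let J11_ge0 i k j l : (0 <= J11 i k j l)%E.
Proof. by rewrite -J11E; apply: integral_ge0 => z _; exact: g2_ge0. Qed.

Let J11_measurable i k j l :
  measurable_fun setT (fun s : R => ((q i k s)%:E * \int[leb]_t ((q j l t)%:E * (tent D (t - s - u))%:E))%E).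
Proof.
have := @measurable_fun_fubini_tonelli_F _ _ _ _ R leb (g2 i k j l) (g2_measurable i k j l) (g2_ge0 i k j l).
congr (measurable_fun _ _); apply/funext => s; rewrite /fubini_F -ge0_integralZl//.
+ by apply: eq_integral => t _; rewrite /g2 /= EFinM muleA.
+ apply: emeasurable_funM; apply/measurable_EFinP; first exact: mq.
  by under eq_fun do rewrite -addrA; exact: tent_shift.
+ by move=> t _; rewrite mule_ge0 ?lee_fin ?tent_ge0//; exact: q0.
+ by rewrite lee_fin; exact: q0.
Qed.

Let J11_fin i k j l : J11 i k j l \is a fin_num.
Proof.
rewrite ge0_fin_numE ?J11_ge0//.
apply: (@le_lt_trans _ _ (\int[leb]_s ((q i k s)%:E * (S j l)%:E))%E).
  apply: ge0_le_integral => //.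
  - move=> s _; rewrite mule_ge0 ?lee_fin//.
    by under eq_integral do rewrite -addrA; case/andP: (inner_le j l (- s - u)).
  - exact: J11_measurable.
  - by apply: emeasurable_funM; [apply/measurable_EFinP; exact: mq|exact: measurable_cst].
  - move=> s _; rewrite lee_wpmul2l ?lee_fin//.
    by under eq_integral do rewrite -addrA; case/andP: (inner_le j l (- s - u)).
rewrite ge0_integralZr//.
- by rewrite q_mass -EFinM ltry.
- by apply/measurable_EFinP; exact: mq.
- by move=> s _; rewrite lee_fin; exact: q0.
- by rewrite lee_fin; exact: resolvent_ge0.
Qed.

Let total i k j l : \bar R :=
  ((i == k)%:R%:E * ((j == l)%:R%:E * J00 + J01 j l) + ((j == l)%:R%:E * J10 i k + J11 i k j l))%E.

Variable kap : 'I_d -> 'I_d -> {finite_measure set R -> \bar R}.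
Hypothesis kapE : forall i j, cluster_measure phi i j = kap i j :> (set R -> \bar R).
Hypothesis kap_int : forall i j (f : R -> \bar R), measurable_fun setT f -> (forall x, 0 <= f x)%E ->
        (\int[kap i j]_x f x = (i == j)%:R%:E * f 0%R +
           \int[leb]_(s in `[0%R, +oo[) ((psi phi s i j)%:E * f s))%E.

(** Cutting off outside the quadrant turns the integral over a product of half-lines into one over
    the plane, where Tonelli applies. *)
Let h (z : R * R) : \bar R := if (0 <= z.1) && (0 <= z.2) then (tent D (z.2 - z.1 - u))%:E else 0%E.

Let h_measurable : measurable_fun setT h.
Proof.
have m1 : measurable_fun setT (fst : R * R -> R) by exact: measurable_fst.
have m2 : measurable_fun setT (snd : R * R -> R) by exact: measurable_snd.
apply: measurable_fun_ifT.
- by apply: measurable_and; apply: measurable_fun_ler => //; exact: measurable_cst.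
- apply/measurable_EFinP; apply: (measurableT_comp (tent_measurable D)).
  by apply: measurable_funB; [exact: measurable_funB|exact: measurable_cst].
- exact: measurable_cst.
Qed.

Let h_ge0 z : (0 <= h z)%E.
Proof. by rewrite /h; case: ifP => // _; rewrite lee_fin tent_ge0. Qed.

Let cluster_tent_fubini i k j l :
  (\int[kap i k \x kap j l]_(st in `[0%R, +oo[ `*` `[0%R, +oo[)
      (tent D (st.2 - st.1 - u))%:E = \int[kap i k]_s fubini_F (kap j l) h s)%E.
Proof.
transitivity (\int[kap i k \x kap j l]_z h z)%E.
  rewrite integral_mkcond; apply: eq_integral => z _.
  rewrite patchE /h (_ : (z \in _) = (0 <= z.1) && (0 <= z.2))//.
  apply/idP/andP => [/set_mem[]|[z1 z2]]; first by rewrite /= !in_itv /= !andbT.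
  by apply/mem_set; split; rewrite /= in_itv /= andbT.
exact: (@fubini_tonelli1 _ _ _ _ R (kap i k) (kap j l) h h_measurable h_ge0).
Qed.

Lemma cluster_tent i k j l :
  (\int[kap i k \x kap j l]_(st in `[0%R, +oo[ `*` `[0%R, +oo[)
      (tent D (st.2 - st.1 - u))%:E)%E = total i k j l.
Proof.
rewrite cluster_tent_fubini.
have FE s : 0 <= s -> fubini_F (kap j l) h s =
   ((j == l)%:R%:E * (tent D (s + u))%:E + \int[leb]_t ((q j l t)%:E * (tent D (t - s - u))%:E))%E.
  move=> s0; rewrite /fubini_F kap_int//; last first.
    exact: (measurableT_comp h_measurable (pair1_measurable s)).
  congr (_ + _)%E.
    (* The atom at [t = 0] gives [tent D (- s - u)]; evenness brings it to the form [s + u] of the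
       limit. *)
    by rewrite /h /= s0 lexx /= sub0r -opprD tentN.
  rewrite integral_onpos; apply: eq_integral => t _.
  rewrite /h /= s0 /=; case: ifP => // t0.
  by rewrite /q /onpos t0 !mul0e.
rewrite kap_int; last 2 first.
- exact: measurable_fun_fubini_tonelli_F.
- by move=> s; apply: integral_ge0 => t _; exact: h_ge0.
rewrite FE// /total; congr (_ + _)%E.
  by rewrite add0r; under eq_integral do rewrite subr0.
rewrite integral_onpos.
transitivity (\int[leb]_s ((j == l)%:R%:E * ((q i k s)%:E * (tent D (s + u))%:E) +
   (q i k s)%:E * \int[leb]_t ((q j l t)%:E * (tent D (t - s - u))%:E)))%E.
  apply: eq_integral => s _; rewrite /q /onpos; case: ifP => s0; last by rewrite !mul0e mule0 adde0.
  rewrite FE// ge0_muleDr; first by rewrite muleCA.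
    by rewrite mule_ge0 ?lee_fin ?tent_ge0.
  by under eq_integral do rewrite -addrA; case/andP: (inner_le j l (- s - u)).
rewrite ge0_integralD//.
- rewrite ge0_integralZl//.
  + by apply: emeasurable_funM; apply/measurable_EFinP; [exact: mq|exact: tent_shift].
  + by move=> s _; rewrite mule_ge0 ?lee_fin ?tent_ge0.
- by move=> s _; rewrite !mule_ge0 ?lee_fin ?tent_ge0.
- apply: emeasurable_funM; first exact: measurable_cst.
  by apply: emeasurable_funM; apply/measurable_EFinP; [exact: mq|exact: tent_shift].
- move=> s _; rewrite mule_ge0 ?lee_fin//.
  by under eq_integral do rewrite -addrA; case/andP: (inner_le j l (- s - u)).
- exact: J11_measurable.
Qed.

Let totalE i k j l : total i k j l = ((i == k)%:R * ((j == l)%:R * tent D u + fine (J01 j l)) +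
    ((j == l)%:R * fine (J10 i k) + fine (J11 i k j l)))%:E.
Proof.
rewrite /total -[J01 j l]fineK ?J01_fin// -[J10 i k]fineK ?J10_fin//.
by rewrite -[J11 i k j l]fineK ?J11_fin.
Qed.

Let total_fin i k j l : total i k j l \is a fin_num.
Proof. by rewrite totalE. Qed.

Let sig k := Sigma mu phi k k.

Lemma limit_cov_measureE i j :
  limit_cov_measure mu phi D u i j = \sum_k sig k * fine (total i k j k).
Proof.
rewrite /limit_cov_measure mxE; apply: eq_bigr => k _.
rewrite (bigD1 k)//= big1 ?addr0; last first.
  move=> l lk; rewrite !kapE integral0_eq// => z _.
  by rewrite SigmaE eq_sym (negbTE lk) mulr0n mulr0.
rewrite !kapE -[sig k]/(fine (sig k)%:E) -fineM//.
rewrite -cluster_tent -ge0_integralZl//.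
- by congr fine; apply: eq_integral => z _; rewrite EFinM muleC.
- by apply: measurableX; exact: measurable_itv.
- apply: measurable_funTS; apply/measurable_EFinP; apply: (measurableT_comp (tent_measurable D)).
  by apply: measurable_funB; [exact: measurable_funB|exact: measurable_cst].
- by move=> z _; rewrite lee_fin tent_ge0.
- by rewrite lee_fin; exact: Sigma_ge0.
Qed.

Let sigE k : sig k = (invmx (1%:M - branching_matrix phi) *m mu)^T 0 k.
Proof. by rewrite /sig /Sigma [LHS]mxE eqxx mulr1n. Qed.

Let mulmx_Sigma (A : 'M[R]_d) i k : (A *m Sigma mu phi) i k = A i k * sig k.
Proof. by rewrite sigE /Sigma mul_mx_diag [LHS]mxE. Qed.

Let Sigma_mulmx (A : 'M[R]_d) i k : (Sigma mu phi *m A) i k = sig i * A i k.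
Proof. by rewrite sigE /Sigma mul_diag_mx [LHS]mxE. Qed.

Let sig0 k : (0 <= (sig k)%:E)%E. Proof. by rewrite lee_fin; exact: Sigma_ge0. Qed.

Let pick_sum (i : 'I_d) (f : 'I_d -> R) : \sum_k (i == k)%:R * f k = f i.
Proof.
rewrite (bigD1 i)//= eqxx mul1r big1 ?addr0// => k /negbTE ki.
by rewrite eq_sym ki mul0r.
Qed.

Lemma limit_covE i j :
  limit_cov mu phi D u i j = \sum_k sig k * fine (total i k j k).
Proof.
under eq_bigr do rewrite totalE.
have -> : \sum_k sig k * ((i == k)%:R * ((j == k)%:R * tent D u + fine (J01 j k)) +
    ((j == k)%:R * fine (J10 i k) + fine (J11 i k j k))) =
  tent D u * Sigma mu phi i j + \sum_k sig k * fine (J11 i k j k) +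
    sig j * fine (J10 i j) + sig i * fine (J01 j i).
  transitivity (\sum_k (i == k)%:R * (sig k * ((j == k)%:R * tent D u + fine (J01 j k))) +
    (\sum_k (j == k)%:R * (sig k * fine (J10 i k)) + \sum_k sig k * fine (J11 i k j k))).
    by rewrite -!big_split /=; apply: eq_bigr => k _; ring.
  rewrite !pick_sum (_ : Sigma mu phi i j = (j == i)%:R * sig i); first by ring.
  by rewrite /sig !SigmaE eqxx mulr1n mulr_natl eq_sym.
rewrite /limit_cov 7!mxE; congr (_ + _ + _ + _).
- rewrite mxE /Rintegral.
  have -> : \sum_k sig k * fine (J11 i k j k) =
      fine (\sum_k (sig k)%:E * \int[leb \x leb]_z g2 i k j k z)%E.
    under [in RHS]eq_bigr => k _ do rewrite J11E -[J11 i k j k]fineK ?J11_fin// -EFinM.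
    by rewrite sumEFin.
  congr fine; under [in RHS]eq_bigr => k _ do rewrite -ge0_integralZl//.
  rewrite -ge0_integral_sum//; last 2 first.
  + by move=> k; apply: emeasurable_funM; [exact: measurable_cst|exact: g2_measurable].
  + by move=> k z _; rewrite mule_ge0//; exact: g2_ge0.
  rewrite integral_mkcond; apply: eq_integral => z _; rewrite patchE.
  rewrite (_ : (z \in _) = (0 <= z.1) && (0 <= z.2)); last first.
    apply/idP/andP => [/set_mem[]|[z1 z2]]; first by rewrite /= !in_itv /= !andbT.
    by apply/mem_set; split; rewrite /= in_itv /= andbT.
  rewrite /g2 /q /onpos; case: ifP => [/andP[-> ->]|z12]; last first.
    rewrite big1// => k _; case: (0 <= z.1) z12 => /= z2; last by rewrite mul0r mul0e mule0.
    by rewrite z2 mulr0 mul0e mule0.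
  rewrite !mxE mulr_sumr -sumEFin; apply: eq_bigr => k _.
  by rewrite -!EFinM mulmx_Sigma ?mxE; congr (_%:E); ring.
- rewrite mxE /Rintegral -[sig j]/(fine (sig j)%:E) -fineM//; congr fine.
  rewrite -ge0_integralZl//; last 2 first.
  + by apply: emeasurable_funM; apply/measurable_EFinP; [exact: mq|exact: tent_shift].
  + by move=> s _; rewrite mule_ge0 ?lee_fin ?tent_ge0.
  rewrite integral_mkcond; apply: eq_integral => s _.
  rewrite patchE mem_setE in_itv /= andbT /q /onpos.
  case: ifP => s0; last by rewrite mul0e mule0.
  by rewrite mxE mulmx_Sigma -!EFinM; congr (_%:E); ring.
- rewrite mxE /Rintegral -[sig i]/(fine (sig i)%:E) -fineM//; congr fine.
  rewrite -ge0_integralZl//; last 2 first.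
  + by apply: emeasurable_funM; apply/measurable_EFinP; [exact: mq|exact: tent_shift].
  + by move=> s _; rewrite mule_ge0 ?lee_fin ?tent_ge0.
  rewrite integral_mkcond; apply: eq_integral => s _.
  rewrite patchE mem_setE in_itv /= andbT /q /onpos.
  case: ifP => s0; last by rewrite mul0e mule0.
  by rewrite mxE Sigma_mulmx mxE -!EFinM; congr (_%:E); ring.
Qed.

Lemma cluster_integral_congr i j (f g : R -> \bar R) :
  measurable_fun setT f -> measurable_fun setT g ->
  (forall x, 0 <= f x)%E -> (forall x, 0 <= g x)%E -> (forall x, 0 <= x -> f x = g x) ->
  (\int[kap i j]_x f x = \int[kap i j]_x g x)%E.
Proof.
move=> mf mg f0 g0 fg; rewrite !kap_int// fg//; congr (_ + _)%E.
by apply: eq_integral => s /set_mem; rewrite /= in_itv /= andbT => s0; rewrite fg.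
Qed.

(** The form in which the limit meets the covariation error. The inner and outer integrals may run
    over the whole line because [kap] lives on the nonnegative half-line. *)
Lemma limit_cov_kernelE i j :
  limit_cov mu phi D u i j =
  \sum_k sig k * \int[kap i k]_s \int[kap j k]_t tent D (t - s - u).
Proof.
rewrite limit_covE; apply: eq_bigr => k _; congr (_ * _).
rewrite -cluster_tent cluster_tent_fubini /Rintegral; congr fine.
have m1 : measurable_fun setT (fst : R * R -> R) by exact: measurable_fst.
have m2 : measurable_fun setT (snd : R * R -> R) by exact: measurable_snd.
pose g (z : R * R) : \bar R := (tent D (z.2 - z.1 - u))%:E.
have mg : measurable_fun setT g.
  apply/measurable_EFinP; apply: (measurableT_comp (@tent_measurable R D)).
  by apply: measurable_funB; [exact: measurable_funB|exact: measurable_cst].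
have g0 z : (0 <= g z)%E by rewrite lee_fin tent_ge0.
have gfin s : (\int[kap j k]_t g (s, t))%E \is a fin_num.
  apply: integrable_fin_num => //; apply: bounded_measurable_integrable; split.
    have -> : (fun t => tent D ((s, t).2 - (s, t).1 - u)) = (fun t => tent D (t + (- s - u))).
      by apply/funext => t; rewrite addrA.
    exact: tent_shift.
  by exists 1 => t; rewrite ger0_norm ?tent_ge0// tent_le1.
transitivity (\int[kap i k]_s fubini_F (kap j k) g s)%E; last first.
  by apply: eq_integral => s _; apply/esym/fineK; exact: gfin.
have mgF := @measurable_fun_fubini_tonelli_F _ _ _ _ R (kap j k) g mg g0.
have mhF := @measurable_fun_fubini_tonelli_F _ _ _ _ R (kap j k) h h_measurable h_ge0.
apply: cluster_integral_congr => //.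
- by move=> s; apply: integral_ge0 => t _; exact: h_ge0.
- by move=> s; apply: integral_ge0.
move=> s s0; apply: cluster_integral_congr.
- exact: (measurableT_comp h_measurable (pair1_measurable s)).
- exact: (measurableT_comp mg (pair1_measurable s)).
- by move=> t; exact: h_ge0.
- by [].
- by move=> t t0; rewrite /h /g /= s0 t0.
Qed.

Lemma limit_cov_equiv i j :
  limit_cov mu phi D u i j = limit_cov_measure mu phi D u i j.
Proof. by rewrite limit_covE limit_cov_measureE. Qed.

End limit_covariance.

(** * Stopped Hawkes processes *)

(** The compensator of mark [k] accumulated by one jump of mark [j] up to age [x]. At negative ages
    the interval is empty and the value is 0. *)
Definition offspring (R : realType) d (phi : R -> 'M[R]_d) k j x : R :=
  \int[lebesgue_measure]_(t in `[0, x]) phi t k j.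

Section offspring_theory.
Context (R : realType) (d : nat).
Local Notation leb := (@lebesgue_measure R).
Variables (phi : R -> 'M[R]_d).
Hypothesis mphi : forall i j, measurable_fun `[(0 : R), +oo[ (fun t : R => phi t i j).
Hypothesis phi0 : forall i j t, 0 <= t -> 0 <= phi t i j.
Hypothesis phi_int : forall i j,
  (\int[leb]_(t in `[0%R, +oo[) (phi t i j)%:E < +oo)%E.
Local Notation K := (branching_matrix phi).
Local Notation Phi := (offspring phi).
Local Notation p i j := (onpos (fun t => phi t i j)).

Let mp i j : measurable_fun setT (p i j).
Proof. by apply: onpos_measurable; exact: mphi. Qed.

Let p0 i j t : 0 <= p i j t.
Proof. by rewrite /onpos; case: ifP => //; exact: phi0. Qed.

Let pI i j : (\int[leb]_t (p i j t)%:E = (K i j)%:E)%E.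
Proof. by rewrite (branchingE phi0 phi_int). Qed.

Lemma offspringE i j x : (Phi i j x)%:E = (\int[leb]_(t in `]-oo, x]) (p i j t)%:E)%E.
Proof.
rewrite /offspring (offspring_integralE mphi phi0 phi_int) [RHS]integral_mkcond.
by apply: eq_integral => t _; rewrite epatch_indic.
Qed.

Lemma offspring_incr i j x y : x <= y ->
  (Phi i j y)%:E = ((Phi i j x)%:E + \int[leb]_(t in `]x, y]) (p i j t)%:E)%E.
Proof.
move=> xy; rewrite !offspringE (@itv_bndbnd_setU _ _ -oo%O (BRight x))// ?bnd_simp//.
rewrite ge0_integral_setU//=.
- by apply/measurable_EFinP; apply: measurable_funTS; exact: mp.
- by move=> t _; rewrite lee_fin; exact: p0.
- apply/disj_setPS => t /= []; rewrite !in_itv /= => tx /andP[xt _].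
  by move: xt; rewrite ltNge tx.
Qed.

Lemma offspring_mono i j x y : x <= y -> Phi i j x <= Phi i j y.
Proof.
move=> xy; rewrite -lee_fin (offspring_incr i j xy) leeDl//.
by apply: integral_ge0 => t _; rewrite lee_fin.
Qed.

Lemma offspring_le0 i j x : x <= 0 -> Phi i j x = 0.
Proof.
rewrite /offspring le_eqVlt => /predU1P[->|x0]; last first.
  by rewrite set_itv_ge ?Rintegral_set0// bnd_simp -ltNge.
by rewrite set_itv1 Rintegral_set1.
Qed.

Lemma offspring_ge0 i j x : 0 <= Phi i j x.
Proof.
by rewrite -lee_fin offspringE; apply: integral_ge0 => t _; rewrite lee_fin.
Qed.

Lemma offspring_leK i j x : Phi i j x <= K i j.
Proof.
rewrite -lee_fin offspringE -pI; apply: ge0_subset_integral => //.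
  by apply/measurable_EFinP; exact: mp.
by move=> t _; rewrite lee_fin.
Qed.

(** Absolute continuity of the integral, applied to the sum of all entries of [phi] so that a single
    [h] serves every pair of marks. *)
Lemma offspring_modulus e : 0 < e -> exists2 h, 0 < h &
  forall i j x y, x <= y -> y - x <= h -> Phi i j y - Phi i j x <= e.
Proof.
move=> e0; pose g t := \sum_i \sum_j p i j t.
have g0 t : 0 <= g t by apply: sumr_ge0 => i _; apply: sumr_ge0.
have mg : measurable_fun setT g.
  by apply: measurable_sum => i; apply: measurable_sum => j; exact: mp.
have ig : leb.-integrable setT (EFin \o g).
  apply/integrableP; split; first exact/measurable_EFinP.
  under eq_integral do rewrite /= ger0_norm//.
  rewrite (_ : (\int[leb]_t (g t)%:E = (\sum_i \sum_j K i j)%:E)%E) ?ltry//.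
  rewrite /g; under eq_integral do rewrite -sumEFin.
  rewrite ge0_integral_sum//; last 2 first.
  - by move=> i; apply/measurable_EFinP; apply: measurable_sum => j; exact: mp.
  - by move=> i t _; rewrite lee_fin; exact: sumr_ge0.
  rewrite -sumEFin; apply: eq_bigr => i _.
  under eq_integral do rewrite -sumEFin.
  rewrite ge0_integral_sum//; last 2 first.
  - by move=> j; apply/measurable_EFinP; exact: mp.
  - by move=> j t _; rewrite lee_fin.
  by rewrite -sumEFin; apply: eq_bigr => j _; rewrite pI.
have [h [h0 hP]] := integral_normr_continuous ig e0.
(* Halving passes from the strict inequality on the measure to the weak one on the length. *)
exists (h / 2); first by rewrite divr_gt0.
move=> i j x y xy yx.
have leb_xy : (leb `]x, y]%classic < h%:E)%E.
  rewrite lebesgue_measure_itv /= lte_fin; case: ifP => _; last by rewrite lte_fin.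
  by rewrite -EFinB lte_fin; lra.
have Hh := hP _ (measurable_itv _) leb_xy.
rewrite -lee_fin EFinB (offspring_incr i j xy) addeAC subee// add0e.
apply: (@le_trans _ _ (\int[leb]_(t in `]x, y]) `|g t|)%:E); last first.
  by rewrite lee_fin ltW.
have ig' : leb.-integrable `]x, y]%classic (EFin \o g) by exact: integrableS ig.
rewrite /Rintegral fineK; last first.
  by apply: integrable_fin_num => //; exact: integrable_norm ig'.
apply: ge0_le_integral => //.
- by move=> t _; rewrite lee_fin.
- by apply/measurable_EFinP; apply: measurable_funTS; exact: mp.
- by apply/measurable_EFinP; apply: measurable_funTS; exact: measurableT_comp.
- move=> t _; rewrite lee_fin ger0_norm// /g (bigD1 i)//= (bigD1 j)//= -addrA lerDl.
  by apply: addr_ge0; apply: sumr_ge0 => // k _; exact: sumr_ge0.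
Qed.

Lemma offspring_measurable i j : measurable_fun setT (Phi i j).
Proof. by apply: nondecreasing_measurable => // x y xy; exact: offspring_mono. Qed.

Lemma delayedE i j (x : R) : (fun s : R => if x < s then phi (s - x) i j else 0) =
  (fun s : R => \1_(`]x, +oo[%classic) s * p i j (s - x)).
Proof.
apply/funext => s; rewrite indicE mem_setE in_itv /= andbT /onpos subr_ge0.
by case: ltP => xs; rewrite ?mul0r// (ltW xs) mul1r.
Qed.

Lemma delayed_measurable i j (x : R) :
  measurable_fun setT (fun s : R => if x < s then phi (s - x) i j else 0).
Proof.
rewrite delayedE; apply: measurable_funM; first exact: measurable_indic.
by apply: (measurableT_comp (mp i j)); apply: measurable_funB => //; exact: measurable_cst.
Qed.

(* the compensator accumulated on [0, y] by one jump at time [x] *)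
Lemma integral_delayed i j (x y : R) : 0 <= x ->
  (\int[leb]_(s in `[0%R, y]) (if (x < s)%R then phi (s - x) i j else 0%R)%:E
   = (Phi i j (y - x))%:E)%E.
Proof.
move=> x0; rewrite offspringE.
pose f2 (t : R) := (((fun t => (p i j t)%:E) \_ `]-oo, (y - x)%R]%classic) t : \bar R)%E.
have mf2 : measurable_fun setT f2.
  apply/(measurable_restrictT _ _).1 => //; apply: measurable_funTS.
  by apply/measurable_EFinP; exact: mp.
have f20 t : (0 <= f2 t)%E by rewrite /f2 patchE; case: ifP => // _; rewrite lee_fin.
have mf2s : measurable_fun setT (fun s : R => f2 (s - x)).
  by apply: (measurableT_comp mf2); apply: measurable_funB => //; exact: measurable_cst.
rewrite integral_mkcond [RHS]integral_mkcond -[RHS](@integral_shift R (- x) f2)//.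
have f1E : ((fun s => (if (x < s)%R then phi (s - x) i j else 0)%:E) \_ `[0%R, y]%classic) =
    (fun s : R => (\1_(`]x, +oo[%classic) s)%:E * f2 (s - x)%R)%E.
  apply/funext => s; rewrite /f2 !patchE indicE !mem_setE !in_itv /= andbT lerD2r.
  rewrite /onpos subr_ge0; case: ltP => xs /=; last by rewrite mul0e; case: ifP.
  rewrite mul1e (ltW xs) (le_trans x0 (ltW xs)) /=.
  by case: ifP.
rewrite f1E; apply: ae_eq_integral => //.
  by apply: emeasurable_funM => //; apply/measurable_EFinP; exact: measurable_indic.
(* A jump acts on the intensity only strictly after its time, whereas the translated [phi] already
   counts age 0; the two integrands differ at most at [x]. *)
exists [set x]; split; [exact: measurable_set1|exact: lebesgue_measure_set1|].
move=> s /= ; apply: contra_notP => /eqP sx _.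
rewrite indicE mem_setE in_itv /= andbT; case: ltgtP sx => // xs _; first by rewrite mul1e.
rewrite mul0e /f2 patchE; case: ifP => // _.
by rewrite /onpos subr_ge0 leNgt xs.
Qed.

End offspring_theory.

Section stopped_processes.
Context {disp : measure_display} {Omega : measurableType disp} {R : realType} {d : nat}.
Variables (T : nat -> Omega -> \bar R) (Z : nat -> Omega -> 'I_d).
Variables (mu : 'cV[R]_d) (phi : R -> 'M[R]_d).

Definition stopped_time n (t : R) w : R := fine (Order.min t%:E (T n w)).

Definition stopped_count n (k : 'I_d) (t : R) w : R :=
  \sum_(1 <= m < n.+1) ((T m w <= t%:E)%E && (Z m w == k))%:R.

(** Closed form of the integral of the intensity up to the minimum of [t] and the [n]-th jump time.
    The maximum with 0 extends it by 0 to negative times, which occur when paths are shifted. *)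
Definition stopped_compensator n (k : 'I_d) (t : R) w : R :=
  mu k 0 * Num.max (stopped_time n t w) 0 +
  \sum_(1 <= m < n.+1) (if (T m w <= t%:E)%E
    then offspring phi k (Z m w) (stopped_time n t w - fine (T m w)) else 0).

End stopped_processes.

Section marked_point_process_theory.
Context {disp : measure_display} {Omega : measurableType disp} {R : realType} {d : nat}.
Variables (T : nat -> Omega -> \bar R) (Z : nat -> Omega -> 'I_d).
Hypothesis mpp : marked_point_process T Z.

Lemma T_gt0 n w : (1 <= n)%N -> (0 < T n w)%E.
Proof. by case: mpp => _ _ + _ _; apply. Qed.

Lemma T_mono m n w : (1 <= m)%N -> (m <= n)%N -> (T m w <= T n w)%E.
Proof.
move=> m1; elim: n => [|n IH]; first by rewrite leqn0 => /eqP m0; rewrite m0 in m1.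
rewrite leq_eqVlt => /predU1P[->//|]; rewrite ltnS => mn.
by apply: le_trans (IH mn) _; case: mpp => _ _ _ + _; apply; exact: leq_trans mn.
Qed.

Lemma T_lt m n w : (1 <= m)%N -> (m < n)%N -> (T m w < +oo)%E -> (T m w < T n w)%E.
Proof.
move=> m1 mn Tm; apply: (@lt_le_trans _ _ (T m.+1 w)); last exact: T_mono.
by case: mpp => _ _ _ _; apply.
Qed.

Lemma T_measurable n : (1 <= n)%N -> measurable_fun setT (T n).
Proof. by case: mpp => + _ _ _ _; apply. Qed.

Lemma Z_measurable n i : (1 <= n)%N -> measurable (Z n @^-1` [set i]).
Proof. by case: mpp => _ + _ _ _; apply. Qed.

Lemma jump_measurable m (t : R) i : (1 <= m)%N ->
  measurable_fun setT (fun w => ((T m w <= t%:E)%E && (Z m w == i))%:R : R).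
Proof.
move=> m1; rewrite (_ : (fun w => _) = \1_([set w | (T m w <= t%:E)%E] `&` Z m @^-1` [set i])).
  apply: measurable_indic; apply: measurableI; last exact: Z_measurable.
  have := emeasurable_fun_infty_c (measurableT) (T_measurable m1) t%:E.
  by rewrite setTI.
apply/funext => w; rewrite indicE; congr (nat_of_bool _)%:R; apply/idP/idP.
  by move=> /andP[Tt /eqP Zi]; rewrite mem_set.
by rewrite inE => -[/= -> /= ->]; rewrite eqxx.
Qed.

Lemma stopped_timeE n t w : (1 <= n)%N -> (stopped_time T n t w)%:E = Order.min t%:E (T n w).
Proof.
move=> n1; rewrite /stopped_time; case: leP => // Tt.
by move: (T_gt0 w n1) Tt; case: (T n w) => [r| |].
Qed.

Lemma stopped_time_le n t w : (1 <= n)%N -> stopped_time T n t w <= t.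
Proof. by move=> n1; rewrite -lee_fin stopped_timeE// ge_min lexx. Qed.

Lemma stopped_time_ge0 n t w : (1 <= n)%N -> 0 <= t -> 0 <= stopped_time T n t w.
Proof. by move=> n1 t0; rewrite -lee_fin stopped_timeE// le_min lee_fin t0 ltW// T_gt0. Qed.

Lemma stopped_time_neg n t w : (1 <= n)%N -> t <= 0 -> stopped_time T n t w = t.
Proof.
move=> n1 t0; apply: EFin_inj; rewrite stopped_timeE// min_l//.
by apply: ltW; apply: le_lt_trans (T_gt0 w n1); rewrite lee_fin.
Qed.

Lemma stopped_time_mono n s t w : (1 <= n)%N -> s <= t ->
  stopped_time T n s w <= stopped_time T n t w <= stopped_time T n s w + (t - s).
Proof.
move=> n1 st; rewrite -!lee_fin EFinD !stopped_timeE//; apply/andP; split.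
  by rewrite le_min !ge_min lexx orbT andbT lee_fin st.
have [sT|Ts] := leP s%:E (T n w).
  by rewrite ge_min -EFinD lee_fin addrC subrK lexx.
by rewrite ge_min leeDl ?orbT// lee_fin subr_ge0.
Qed.

Lemma T_le_stopped m n t w : (1 <= m)%N -> (m <= n)%N ->
  (T m w <= (stopped_time T n t w)%:E)%E = (T m w <= t%:E)%E.
Proof.
move=> m1 mn; rewrite stopped_timeE ?(leq_trans m1 mn)// le_min.
by rewrite T_mono// andbT.
Qed.

Lemma T_gt_stopped m n t w : (1 <= n)%N -> (n < m)%N -> ((stopped_time T n t w)%:E < T m w)%E.
Proof.
move=> n1 nm; have [Tn|] := ltP (T n w) +oo%E.
  apply: le_lt_trans (T_lt n1 nm Tn).
  by rewrite stopped_timeE// ge_min lexx orbT.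
rewrite leye_eq => /eqP Tn; apply: (@lt_le_trans _ _ +oo%E); first exact: ltry.
by rewrite -Tn; apply: T_mono => //; exact: ltnW.
Qed.

Lemma counting_process_stopped n k t w : (1 <= n)%N ->
  counting_process T Z k (stopped_time T n t w) w = (stopped_count T Z n k t w)%:E.
Proof.
move=> n1; rewrite /counting_process (nneseries_split 1 n); last first.
  by move=> m _; rewrite lee_fin.
rewrite [X in (_ + X)%E]eseries0 ?adde0; last first.
  by move=> m nm _; rewrite leNgt T_gt_stopped.
rewrite sumEFin; congr (_%:E); rewrite /stopped_count add1n.
by apply: eq_big_nat => m /andP[m1 mn]; rewrite T_le_stopped.
Qed.

Lemma counting_process_measurable k t : measurable_fun setT (counting_process T Z k t).
Proof.
pose u m w : \bar R := ((T m w <= t%:E)%E && (Z m w == k))%:R%:E.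
have u0 m w : (0 <= u m w)%E by rewrite lee_fin.
rewrite (_ : counting_process T Z k t = fun w => (\sum_(m <oo) u m.+1 w)%E); last first.
  apply/funext => w; rewrite /counting_process -(@nneseries_addn _ (fun m => u m w))//.
  by apply: eq_eseriesr => m _; rewrite addn1.
apply: ge0_emeasurable_sum => [m w _ _|m _]; first exact: u0.
by apply/measurable_EFinP; exact: jump_measurable.
Qed.

End marked_point_process_theory.

(** Nothing is known about jump index 0, so the sign is assumed only from index 1 on; the term at 0
    is overwritten by 0 before the shift. *)
Lemma nneseries_addnS (R : realType) (u : nat -> \bar R) :
  (forall m, (1 <= m)%N -> (0 <= u m)%E) ->
  (\sum_(m <oo) u m.+1 = \sum_(1 <= m <oo) u m)%E.
Proof.
move=> u0; pose v m := if m is m'.+1 then u m else 0%E.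
transitivity (\sum_(1 <= m <oo) v m)%E.
  rewrite -(@nneseries_addn _ v); last by case=> [|m]//; exact: u0.
  by apply: eq_eseriesr => m _; rewrite addn1.
apply/congr_lim/funext => k; rewrite big_nat_cond [RHS]big_nat_cond.
by apply: eq_bigr => -[|m].
Qed.

Section stopped_compensator_theory.
Context {disp : measure_display} {Omega : measurableType disp} {R : realType} {d : nat}.
Local Notation leb := (@lebesgue_measure R).
Variables (T : nat -> Omega -> \bar R) (Z : nat -> Omega -> 'I_d).
Variables (mu : 'cV[R]_d) (phi : R -> 'M[R]_d).
Hypothesis mpp : marked_point_process T Z.
Hypothesis mu0 : forall i, 0 <= mu i 0.
Hypothesis mphi : forall i j, measurable_fun `[(0 : R), +oo[ (fun t : R => phi t i j).
Hypothesis phi0 : forall i j t, 0 <= t -> 0 <= phi t i j.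
Hypothesis phi_int : forall i j,
  (\int[leb]_(t in `[0%R, +oo[) (phi t i j)%:E < +oo)%E.
Local Notation p i j := (onpos (fun t => phi t i j)).

Let mp i j : measurable_fun setT (p i j).
Proof. by apply: onpos_measurable; exact: mphi. Qed.

Let past i m s w : R := if (T m w < s%:E)%E then phi (s - fine (T m w)) i (Z m w) else 0.

Let past_ge0 i m s w : (1 <= m)%N -> 0 <= past i m s w.
Proof.
move=> m1; rewrite /past; case: ifP => // Ts; apply: phi0.
move: Ts (T_gt0 mpp w m1); case: (T m w) => [r| |]//=.
by rewrite !lte_fin subr_ge0 => /ltW.
Qed.

Lemma intensityE i s w : intensity T Z mu phi i s w =
  ((mu i 0)%:E + \sum_(1 <= m <oo) (past i m s w)%:E)%E.
Proof.
rewrite /intensity; congr (_ + _)%E.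
pose v j m : \bar R := (((T m w < s%:E)%E && (Z m w == j))%:R%:E * (past i m s w)%:E)%E.
have v0 j m : (1 <= m)%N -> (0 <= v j m)%E.
  by move=> m1; rewrite mule_ge0 ?lee_fin// past_ge0.
have E j : (\int[jump_measure T Z j w]_(r in `]0%R, s[) (phi (s - r) i j)%:E =
    \sum_(1 <= m <oo) v j m)%E.
  pose f m : {measure set R -> \bar R} := if (T m w < +oo)%E && (Z m w == j)
                    then (\d_(fine (T m w)) : {measure set R -> \bar R})
                    else mzero.
  transitivity (\int[mseries (fun m => f m.+1) 0]_(r in `]0%R, s[) (phi (s - r) i j)%:E)%E.
    apply: eq_measure_integral => A mA _; rewrite /jump_measure /mseries.
    by apply: esym; exact: (@nneseries_addnS _ (fun m => f m A)).
  have mg : measurable_fun `]0, s[ (fun r : R => (phi (s - r) i j)%:E).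
    apply: (eq_measurable_fun (fun r : R => (p i j (s - r))%:E)).
      move=> r; rewrite inE /= in_itv /= => /andP[r0 rs].
      by rewrite /onpos subr_ge0 (ltW rs).
    apply: measurable_funTS; apply/measurable_EFinP; apply: (measurableT_comp (mp i j)).
    by apply: measurable_funB => //; exact: measurable_cst.
  rewrite ge0_integral_measure_series//; last first.
    by move=> r; rewrite /= in_itv /= => /andP[_ rs]; rewrite lee_fin phi0// subr_ge0 ltW.
  rewrite -(@nneseries_addnS _ (v j) (v0 j)).
  apply: eq_eseriesr => m _; rewrite /f /v /past.
  have := T_gt0 mpp w (ltn0Sn m).
  case: (T m.+1 w) => [r| |]//= r0; rewrite ?ltxx /= ?integral_measure_zero ?mule0//.
  rewrite ltry /=; case: (eqVneq (Z m.+1 w) j) => [->|_].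
    rewrite integral_dirac// diracE mem_setE in_itv /= lte_fin -(lte_fin 0) r0 /=.
    by case: ifP => _; rewrite ?mul1e ?mul0e ?mule0.
  by rewrite integral_measure_zero andbF mul0e.
under eq_bigr do rewrite E.
under eq_bigr => j _ do rewrite -(@nneseries_addnS _ (v j) (v0 j)).
rewrite -nneseries_sum => [|j m _]; last exact: v0.
rewrite -(@nneseries_addnS _ (fun m => (past i m s w)%:E)) => [|m m1]; last by rewrite lee_fin past_ge0.
apply: eq_eseriesr => m _; rewrite (bigD1 (Z m.+1 w))//= big1 ?adde0; last first.
  by move=> j; rewrite eq_sym => /negbTE jZ; rewrite /v jZ andbF mul0e.
rewrite /v eqxx andbT /past; case: ifP => _; first by rewrite mul1e.
by rewrite mul0e.
Qed.

(** Sum and integral are exchanged, and each jump contributes its [offspring] mass by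
    [integral_delayed]. Jumps after the [n]-th come later than the stopping time and contribute
    nothing. *)
Lemma intensity_integral n i t w : (1 <= n)%N -> 0 <= t ->
  (\int[leb]_(s in `[0%R, stopped_time T n t w]) intensity T Z mu phi i s w =
   (stopped_compensator T Z mu phi n i t w)%:E)%E.
Proof.
move=> n1 t0; set y := stopped_time T n t w.
have y0 : 0 <= y by exact: (stopped_time_ge0 mpp).
pose pm (m : nat) (s : measurableTypeR R) : \bar R := (past i m s w)%:E.
have mpast m : (1 <= m)%N -> measurable_fun setT (pm m).
  move=> m1; apply/measurable_EFinP; have := T_gt0 mpp w m1; rewrite /past.
  case: (T m w) => [r r0| _|]//.
    rewrite /= (_ : (fun s => _) = (fun s : R => if r < s then phi (s - r) i (Z m w) else 0)).
      exact: delayed_measurable.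
    by apply/funext => s; rewrite lte_fin.
have pastI m : (1 <= m)%N -> (\int[leb]_(s in `[0%R, y]) pm m s =
  (if (T m w < +oo)%E then offspring phi i (Z m w) (y - fine (T m w)) else 0)%:E)%E.
  move=> m1; have := T_gt0 mpp w m1; rewrite /pm /past.
  case: (T m w) => [r r0| _|]//.
    rewrite ltry /= -integral_delayed//; last by rewrite -lee_fin ltW.
  by rewrite ltxx integral0_eq.
under eq_integral do rewrite intensityE -(@nneseries_addnS _ (fun m => (past i m _ w)%:E) (fun m m1 => past_ge0 i _ w m1)).
rewrite ge0_integralD//; last 3 first.
- by move=> s _; rewrite lee_fin.
- by move=> s _; apply: nneseries_ge0 => m _ _; rewrite lee_fin past_ge0.
- apply: (@measurable_funTS _ _ _ _ _ (fun s : R => (\sum_(m <oo) pm m.+1 s)%E)).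
  apply: ge0_emeasurable_sum => [m s _ _|m _]; first by rewrite lee_fin past_ge0.
  exact: mpast.
have -> : (\int[leb]_(_ in `[0%R, y]) (mu i 0)%:E = (mu i 0 * y)%:E)%E.
  have Ey : leb `[0, y]%classic = y%:E.
    rewrite lebesgue_measure_itv /= lte_fin.
    by case: ltP => y1; [rewrite sube0|congr (_%:E); apply/eqP; rewrite eq_le y0 y1].
  rewrite EFinM -Ey; apply: integral_cst; exact: measurable_itv.
rewrite /stopped_compensator -/y EFinD max_l//; congr (_ + _)%E.
rewrite integral_nneseries//; last 2 first.
- by move=> m; apply: measurable_funTS; exact: mpast.
- by move=> m s _; rewrite lee_fin past_ge0.
rewrite (@nneseries_addnS _ (fun m => \int[leb]_(s in `[0%R, y]) pm m s)%E); last first.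
  by move=> m m1; apply: integral_ge0 => s _; rewrite lee_fin past_ge0.
rewrite (nneseries_split 1 n); last first.
  by move=> m m1; apply: integral_ge0 => s _; rewrite lee_fin past_ge0.
rewrite [X in (_ + X)%E]eseries0 ?adde0; last first.
  move=> m nm _; have nm' : (n < m)%N by rewrite add1n in nm.
  have m1 : (1 <= m)%N by exact: leq_trans nm'.
  rewrite pastI//; have := @T_gt_stopped _ _ _ _ _ _ mpp m n t w n1 nm'; rewrite -/y.
  case: (T m w) => [r| |]//=; rewrite ?ltry lte_fin => yr.
  by rewrite offspring_le0// subr_le0 ltW.
rewrite add1n -sumEFin; apply: eq_big_nat => m /andP[m1 mn].
rewrite pastI//; have := @T_le_stopped _ _ _ _ _ _ mpp m n t w m1 mn; rewrite -/y.
case: ifP => [Tm Tt|/negbT]; last first.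
  rewrite ltey negbK => /eqP ->; rewrite leNgt ltry.
  by rewrite leNgt ltry.
case: ifP Tt => [//|_ /negbT]; rewrite -ltNge.
by move: Tm; case: (T m w) => [r| |]//= _; rewrite lte_fin => yr; rewrite offspring_le0// subr_le0 ltW.
Qed.

Lemma stopped_compensatedE n i t w : (1 <= n)%N -> 0 <= t ->
  stopped_compensated T Z mu phi n i t w =
  (stopped_count T Z n i t w - stopped_compensator T Z mu phi n i t w)%:E.
Proof.
move=> n1 t0; rewrite /stopped_compensated -/(stopped_time T n t w).
by rewrite counting_process_stopped// intensity_integral.
Qed.

Lemma stopped_count_mono n k s t w : s <= t -> stopped_count T Z n k s w <= stopped_count T Z n k t w.
Proof.
move=> st; apply: ler_sum => m _; rewrite ler_nat; case: (Z m w == k); last by rewrite !andbF.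
by rewrite !andbT; case: leP => // Ts; rewrite (le_trans Ts)// lee_fin.
Qed.

Lemma stopped_count_le0 n k t w : t <= 0 -> stopped_count T Z n k t w = 0.
Proof.
move=> t0; rewrite /stopped_count big_nat_cond big1// => m /andP[/andP[m1 _] _].
by rewrite leNgt (le_lt_trans _ (T_gt0 mpp w m1))// lee_fin.
Qed.

Lemma stopped_count_ge0 n k t w : 0 <= stopped_count T Z n k t w.
Proof. by apply: sumr_ge0. Qed.

Lemma stopped_count_sum n t w :
  \sum_k stopped_count T Z n k t w = \sum_(1 <= m < n.+1) (T m w <= t%:E)%E%:R.
Proof.
rewrite exchange_big /=; apply: eq_bigr => m _.
rewrite (bigD1 (Z m w))//= eqxx andbT big1 ?addr0// => k /negbTE kZ.
by rewrite eq_sym kZ andbF.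
Qed.

Lemma stopped_count_total_le n t w : \sum_k stopped_count T Z n k t w <= n%:R.
Proof.
rewrite stopped_count_sum; apply: (@le_trans _ _ (\sum_(1 <= m < n.+1) 1)).
  by apply: ler_sum => m _; rewrite -[1]/(1%:R) ler_nat; case: (_ <= _)%E.
by rewrite sumr_const_nat subn1.
Qed.

Lemma stopped_count_le n k t w : stopped_count T Z n k t w <= n%:R.
Proof.
apply: le_trans (stopped_count_total_le n t w).
by rewrite (bigD1 k)//= lerDl sumr_ge0// => *; exact: stopped_count_ge0.
Qed.

Lemma stopped_count_measurable n k t : measurable_fun setT (stopped_count T Z n k t).
Proof.
have -> : stopped_count T Z n k t = (fun w => \sum_(m <- index_iota 1 n.+1 | (1 <= m)%N)
    ((T m w <= t%:E)%E && (Z m w == k))%:R : R).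
  apply/funext => w; rewrite /stopped_count big_nat_cond [RHS]big_nat_cond.
  by apply: eq_bigl => m; case: (1 <= m)%N; rewrite ?andbT.
have -> : (fun w => \sum_(m <- index_iota 1 n.+1 | (1 <= m)%N)
    ((T m w <= t%:E)%E && (Z m w == k))%:R : R) = (fun w => \sum_(m <- [seq m <- index_iota 1 n.+1 | (1 <= m)%N])
    (if (1 <= m)%N then ((T m w <= t%:E)%E && (Z m w == k))%:R else 0)).
  by apply/funext => w; rewrite big_filter; apply: eq_bigr => m ->.
apply: measurable_sum => m; have [m1|_] := boolP (1 <= m)%N; last exact: measurable_cst.
exact: (jump_measurable mpp).
Qed.

Lemma stopped_compensator_le0 n k t w : (1 <= n)%N -> t <= 0 ->
  stopped_compensator T Z mu phi n k t w = 0.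
Proof.
move=> n1 t0; rewrite /stopped_compensator (stopped_time_neg mpp)// max_r// mulr0 add0r.
rewrite big_nat_cond big1// => m /andP[/andP[m1 _] _].
by rewrite leNgt (le_lt_trans _ (T_gt0 mpp w m1))// lee_fin.
Qed.

Let jump_compensator n k m t w := if (T m w <= t%:E)%E
    then offspring phi k (Z m w) (stopped_time T n t w - fine (T m w)) else 0.

Let jump_compensator_incr n k m s t w e h : (1 <= n)%N -> (1 <= m)%N -> (m <= n)%N -> s <= t -> t - s <= h ->
  (forall i j x y, x <= y -> y - x <= h -> offspring phi i j y - offspring phi i j x <= e) ->
  0 <= jump_compensator n k m t w - jump_compensator n k m s w <= e.
Proof.
move=> n1 m1 mn st tsh He; have /andP[y1 y2] := stopped_time_mono mpp w n1 st.
have e0 : 0 <= e.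
  by have := He k k 0 0 (lexx _); rewrite !subrr; apply; lra.
rewrite /jump_compensator.
have := @T_le_stopped _ _ _ _ _ _ mpp m n s w m1 mn.
have := @T_le_stopped _ _ _ _ _ _ mpp m n t w m1 mn.
have T0 := T_gt0 mpp w m1.
have [Tt|Tt] := boolP (T m w <= t%:E)%E; last first.
  have [Ts|Ts _ _] := boolP (T m w <= s%:E)%E; last by rewrite subrr lexx.
  by move: Tt; rewrite (le_trans Ts)// lee_fin.
case: (T m w) T0 Tt => [r| |]// _; rewrite !lee_fin /= => rt yt ys.
have [rs|rs] := boolP (r <= s).
  apply/andP; split; first by rewrite subr_ge0 offspring_mono// lerD2r.
  by apply: He; lra.
rewrite subr0 offspring_ge0//=.
(* The jump lies between [s] and [t], so its contribution starts from [offspring] at age 0, which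
   vanishes. *)
have := He k (Z m w) 0 (stopped_time T n t w - r).
rewrite (offspring_le0 _ _ _ (lexx 0)) subr0 subr0; apply; first by rewrite subr_ge0.
by rewrite -ltNge in rs; have := stopped_time_le mpp t w n1; lra.
Qed.

(** At most [n] jumps contribute, each with the deterministic modulus of [offspring]. The
    immigration part grows at rate at most [c], whence the share [e / (n + c)]. *)
Lemma stopped_compensator_modulus n e : (1 <= n)%N -> 0 < e -> exists2 h, 0 < h & forall k s t w,
  s <= t -> t - s <= h ->
  0 <= stopped_compensator T Z mu phi n k t w - stopped_compensator T Z mu phi n k s w <= e.
Proof.
move=> n1 e0; pose c := 1 + \sum_k mu k 0.
have c0 : 0 < c by rewrite ltr_pwDl// sumr_ge0.
pose e' := e / (n%:R + c).
have nc0 : 0 < n%:R + c by rewrite ltr_wpDl.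
have e'0 : 0 < e' by rewrite divr_gt0.
have [h h0 hP] := offspring_modulus mphi phi0 phi_int e'0.
exists (Num.min h e'); first by rewrite lt_min h0.
move=> k s t w st; rewrite le_min => /andP[tsh tse].
have /andP[y1 y2] := stopped_time_mono mpp w n1 st.
rewrite /stopped_compensator opprD addrACA -mulrBr -sumrB.
have A1 : 0 <= Num.max (stopped_time T n t w) 0 - Num.max (stopped_time T n s w) 0 <= e'.
  move: (stopped_time T n t w) (stopped_time T n s w) y1 y2 => y z y1 y2.
  by case: (leP y 0) => y3; case: (leP z 0) => z3; apply/andP; split; lra.
have A2 : 0 <= mu k 0 <= c.
  by rewrite mu0 /c (bigD1 k)//= addrCA lerDl addr_ge0// sumr_ge0.
have A3 : 0 <= \sum_(1 <= m < n.+1) (jump_compensator n k m t w - jump_compensator n k m s w) <= n%:R * e'.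
  have B m : (1 <= m < n.+1)%N -> 0 <= jump_compensator n k m t w - jump_compensator n k m s w <= e'.
    by move=> /andP[m1 mn]; exact: jump_compensator_incr hP.
  apply/andP; split.
    by rewrite big_nat_cond sumr_ge0// => m /andP[/B/andP[]].
  apply: (@le_trans _ _ (\sum_(1 <= m < n.+1) e')).
    by rewrite big_nat_cond [leRHS]big_nat_cond; apply: ler_sum => m /andP[/B/andP[]].
  by rewrite sumr_const_nat subn1 mulr_natl.
have -> : e = c * e' + n%:R * e' by rewrite /e'; field; lra.
case/andP: A1 => A1 A1'; case/andP: A2 => A2 A2'; case/andP: A3 => A3 A3'.
rewrite addr_ge0 ?mulr_ge0//= lerD//; exact: ler_pM.
Qed.

Lemma stopped_compensator_mono n k s t w : (1 <= n)%N -> s <= t ->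
  stopped_compensator T Z mu phi n k s w <= stopped_compensator T Z mu phi n k t w.
Proof.
move=> n1 st; have /andP[y1 _] := stopped_time_mono mpp w n1 st.
apply: lerD; first by rewrite ler_wpM2l// ge_max !le_max y1 lexx orbT.
apply: ler_sum_nat => m /andP[m1 mn].
have K0 i j : 0 <= branching_matrix phi i j.
  exact: le_trans (offspring_ge0 mphi phi0 phi_int i j 0) (offspring_leK mphi phi0 phi_int i j 0).
pose e := \sum_i \sum_j branching_matrix phi i j.
have He i j x y : x <= y -> y - x <= t - s -> offspring phi i j y - offspring phi i j x <= e.
  move=> _ _; apply: (@le_trans _ _ (branching_matrix phi i j)).
    have := offspring_leK mphi phi0 phi_int i j y.
    by have := offspring_ge0 mphi phi0 phi_int i j x; lra.
  rewrite /e (bigD1 i)//= (bigD1 j)//= -addrA lerDl addr_ge0// sumr_ge0// => i' _.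
  exact: sumr_ge0.
have /andP[+ _] := jump_compensator_incr k w n1 m1 mn st (lexx _) He.
by rewrite subr_ge0.
Qed.

Lemma stopped_compensator_ge0 n k t w : (1 <= n)%N -> 0 <= stopped_compensator T Z mu phi n k t w.
Proof.
move=> n1; rewrite /stopped_compensator addr_ge0 ?mulr_ge0 ?le_max ?lexx ?orbT//.
by apply: sumr_ge0 => m _; case: ifP => // _; exact: offspring_ge0.
Qed.

(* each jump of mark [j] contributes at most its total offspring mass *)
Lemma stopped_compensator_le n k t w : (1 <= n)%N ->
  stopped_compensator T Z mu phi n k t w <=
  mu k 0 * Num.max t 0 + \sum_j branching_matrix phi k j * stopped_count T Z n j t w.
Proof.
move=> n1; apply: lerD.
  by rewrite ler_wpM2l// ge_max !le_max (stopped_time_le mpp)//= lexx orbT.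
have -> : \sum_j branching_matrix phi k j * stopped_count T Z n j t w =
    \sum_j \sum_(1 <= m < n.+1)
       branching_matrix phi k j * ((T m w <= t%:E)%E && (Z m w == j))%:R.
  by apply: eq_bigr => j _; rewrite /stopped_count mulr_sumr.
rewrite exchange_big /=; apply: ler_sum => m _.
rewrite (bigD1 (Z m w))//= eqxx andbT [X in _ <= _ + X]big1 ?addr0; last first.
  by move=> j; rewrite eq_sym => /negbTE ->; rewrite andbF mulr0.
case: ifP => _; last by rewrite mulr0.
by rewrite mulr1; exact: offspring_leK.
Qed.

End stopped_compensator_theory.

Section stopped_martingale.
Context {disp : measure_display} {Omega : measurableType disp} {R : realType} {d : nat}.
Variables (T : nat -> Omega -> \bar R) (Z : nat -> Omega -> 'I_d).
Hypothesis mpp : marked_point_process T Z.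

Lemma natural_filtration_mono s t : s <= t ->
  natural_filtration T Z s `<=` natural_filtration T Z t.
Proof.
move=> st; apply: sub_sigma_algebra2; apply: subset_bigcup => k _.
apply: bigcup_subset => r /=; rewrite !in_itv /= => /andP[-> rs].
exact: le_trans st.
Qed.

Lemma natural_filtration_sub t : natural_filtration T Z t `<=` measurable.
Proof.
apply: smallest_sub; first exact: sigma_algebra_measurable.
move=> _ [k _] [r _] [B mB <-].
exact: (counting_process_measurable mpp k r).
Qed.

Lemma natural_filtrationK t : <<s natural_filtration T Z t >> = natural_filtration T Z t.
Proof. exact: sigma_algebra_id (smallest_sigma_algebra _ _). Qed.

(** Finitely many distinct finite times have a positive minimal gap. A window shorter than half of
    the last gap that contains the last jump begins after all the earlier ones. *)
Lemma separated_jumps n w : exists2 g : R, 0 < g & forall s t, s <= t -> t - s <= g ->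
  \sum_(1 <= m < n.+1) (T m w <= t%:E)%E%:R <=
  \sum_(1 <= m < n.+1) (T m w <= s%:E)%E%:R + 1 :> R.
Proof.
elim: n => [|n [g g0 gP]]; first by exists 1 => // s t _ _; rewrite !big_geq// add0r.
have mono m s t : s <= t -> (T m w <= s%:E)%E -> (T m w <= t%:E)%E.
  by move=> st Ts; apply: le_trans Ts _; rewrite lee_fin.
have [Tn1|Tn1] := ltP (T n.+1 w) +oo%E; last first.
  exists g => // s t st ts; rewrite !(big_nat_recr _ _ _ (ltn0Sn n))/=.
  by rewrite [in leLHS]leNgt [in leRHS]leNgt !(lt_le_trans (ltry _) Tn1) !addr0; exact: gP.
have [n0|n1] := posnP n.
  exists 1 => // s t st _; rewrite n0 !big_nat1 -lerBlDr.
  rewrite lerBlDr; apply: (@le_trans _ _ 1); last by rewrite lerDr.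
  by case: (_ <= t%:E)%E.
have Tn : (T n w < T n.+1 w)%E.
  apply: (T_lt mpp) => //; apply: le_lt_trans Tn1; exact: (T_mono mpp).
have := T_gt0 mpp w n1; have := T_gt0 mpp w (ltn0Sn n).
move: Tn Tn1; case E1 : (T n w) => [a| |]//; case E2 : (T n.+1 w) => [b| |]//.
rewrite !lte_fin => ab _ b0 a0.
exists (Num.min g ((b - a) / 2)); first by rewrite lt_min g0 divr_gt0// subr_gt0.
move=> s t st; rewrite le_min => /andP[tsg tsb].
rewrite !(big_nat_recr _ _ _ (ltn0Sn n))/= E2 !lee_fin.
have [bs|sb] := leP b s.
  by rewrite (le_trans bs st) addrAC lerD2r gP.
have [bt|tb] := leP b t; last by rewrite !addr0 gP.
rewrite addr0 lerD2r; apply: ler_sum_nat => m /andP[m1 mn].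
rewrite ler_nat (_ : (T m w <= s%:E)%E); first by case: (_ <= _)%E.
apply: (le_trans (T_mono mpp w m1 mn)); rewrite E1 lee_fin; lra.
Qed.

Variables (mu : 'cV[R]_d) (phi : R -> 'M[R]_d) (P : probability Omega R).
Hypothesis mu0 : forall i, 0 <= mu i 0.
Hypothesis mphi : forall i j, measurable_fun `[(0 : R), +oo[ (fun t : R => phi t i j).
Hypothesis phi0 : forall i j t, 0 <= t -> 0 <= phi t i j.
Hypothesis phi_int : forall i j,
  (\int[@lebesgue_measure R]_(t in `[0%R, +oo[) (phi t i j)%:E < +oo)%E.
Variable n : nat.
Hypothesis n1 : (1 <= n)%N.
Hypothesis mart : forall i, martingale P (natural_filtration T Z)
          (stopped_compensated T Z mu phi n i).

Local Notation N := (stopped_count T Z n).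
Local Notation L := (stopped_compensator T Z mu phi n).

Let stopped_countE k t w : exists a, N k t w = a%:R.
Proof.
by exists (\sum_(1 <= m < n.+1) ((T m w <= t%:E)%E && (Z m w == k)))%N; rewrite natr_sum.
Qed.

Let mart_shift k s t A : 0 <= s -> s <= t -> natural_filtration T Z s A ->
  \int[P]_(w in A) (N k t w - L k t w) = \int[P]_(w in A) (N k s w - L k s w).
Proof.
move=> s0 st FA; have [_ _ /(_ s t A s0 st FA) E] := mart k.
have FE u : 0 <= u ->
    (fun w => (N k u w - L k u w)%:E) = stopped_compensated T Z mu phi n k u.
  move=> u0; apply/funext => w.
  by rewrite (stopped_compensatedE mpp mu0 mphi phi0 phi_int).
have J u : 0 <= u -> \int[P]_(w in A) (N k u w - L k u w) =
    fine (\int[P]_(w in A) stopped_compensated T Z mu phi n k u w)%E.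
  by move=> u0; rewrite -FE.
by apply: (eq_trans (J t (le_trans s0 st))); rewrite E; apply: esym; exact: J.
Qed.

Let mart_le0 k t w : t <= 0 -> N k t w - L k t w = 0.
Proof.
by move=> t0; rewrite (stopped_count_le0 mpp)// (stopped_compensator_le0 _ _ mpp)// subrr.
Qed.

(** The martingale property is given on nonnegative times only. At negative times both processes
    vanish, and an event of a negative time belongs to the filtration at time 0, which extends the
    property to the whole line. *)
Lemma stopped_compensated_counting : compensated_counting P (natural_filtration T Z) N L.
Proof.
split.
- exact: natural_filtration_sub.
- by move=> s t st; rewrite !natural_filtrationK; exact: natural_filtration_mono.
- by move=> k t; exact: (stopped_count_measurable mpp).
- move=> k t; have [t0|t0] := leP 0 t; last first.
    rewrite (_ : (fun w => _) = cst 0); first exact: measurable_cst.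
    by apply/funext => w; rewrite mart_le0// ltW.
  move=> _ B mB; rewrite setTI; apply: sub_sigma_algebra.
  have [+ _ _] := mart k; apply => //; exists (EFin @` B).
    exact: measurable_image_EFin.
  rewrite setTI; apply/seteqP; split => w /=;
    rewrite (stopped_compensatedE mpp mu0 mphi phi0 phi_int)//.
    by move=> [x Bx [<-]].
  by move=> Bw; exists (N k t w - L k t w).
- by move=> k s t w; exact: stopped_count_mono.
- by move=> k s t w; exact: (stopped_compensator_mono mpp mu0 mphi phi0 phi_int).
- by exists n%:R => k t w; rewrite ger0_norm ?stopped_count_ge0 ?stopped_count_le.
- move=> t; exists (\sum_k (mu k 0 * Num.max t 0 + \sum_j branching_matrix phi k j * n%:R)).
  have K0 i j : 0 <= branching_matrix phi i j.
    exact: le_trans (offspring_ge0 mphi phi0 phi_int i j 0) (offspring_leK mphi phi0 phi_int i j 0).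
  have b0 k : 0 <= mu k 0 * Num.max t 0 + \sum_j branching_matrix phi k j * n%:R.
    by rewrite addr_ge0 ?mulr_ge0 ?le_max ?lexx ?orbT// sumr_ge0// => j _; rewrite mulr_ge0.
  move=> k w; rewrite ger0_norm ; last first.
    exact: (stopped_compensator_ge0 T Z mu0 mphi phi0 phi_int).
  apply: (le_trans (stopped_compensator_le mpp mu0 mphi phi0 phi_int k t w n1)).
  rewrite [leRHS](bigD1 k)//= -[leLHS]addr0 lerD ?sumr_ge0// lerD2l.
  by apply: ler_sum => j _; rewrite ler_wpM2l// stopped_count_le.
- move=> e e0; have [h h0 hP] := stopped_compensator_modulus mpp mu0 mphi phi0 phi_int n1 e0.
  by exists h => // k s t w st ts; have /andP[] := hP k s t w st ts.
- move=> w a b ab; have [g g0 gP] := separated_jumps n w.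
  have [m0 m0P] := subdivision_mesh ab g0; exists m0 => m m0m q qm k l D.
  have st : subdivision a b m q <= subdivision a b m q.+1 by exact: subdivision_mono.
  have := gP _ _ st; rewrite subdivisionS => /(_ (m0P _ m0m)).
  rewrite -!(stopped_count_sum T Z) -lerBlDl -sumrB => D1.
  (* Increments are natural numbers whose sum over all marks is at most 1: each is 0 or 1, and no
     two of them are 1. *)
  have Dn j : exists c : nat, D j = c%:R.
    have [x xE] := stopped_countE j (subdivision a b m q.+1) w.
    have [y yE] := stopped_countE j (subdivision a b m q) w.
    have := stopped_count_mono T Z n j w st.
    by rewrite /D xE yE ler_nat => yx; exists (x - y)%N; rewrite natrB.
  have D0 j : 0 <= D j by have [c ->] := Dn j.
  split.
    have : D k <= 1.
      by apply: le_trans D1; rewrite (bigD1 k)//= lerDl; apply: sumr_ge0 => j _; exact: D0.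
    by have [[|[|c]] ->] := Dn k; rewrite (ler_nat R _ 1)// => _; [left|right].
  move=> kl; have : D k + D l <= 1.
    apply: le_trans D1; rewrite (bigD1 k)//= lerD2l (bigD1 l) 1?eq_sym//= lerDl.
    by apply: sumr_ge0 => j _; exact: D0.
  have [[|x] ->] := Dn k; first by rewrite mul0r.
  have [[|y] ->] := Dn l; first by rewrite mulr0.
  by rewrite -natrD (ler_nat R _ 1) addSn addnS.
- move=> k s t A st; rewrite natural_filtrationK => FA.
  have [s0|s0] := leP 0 s; first exact: mart_shift.
  have Ls u : u <= 0 -> \int[P]_(w in A) (N k u w - L k u w) = 0.
    by move=> u0; rewrite /Rintegral integral0_eq// => w _; rewrite mart_le0.
  apply: eq_trans (esym (Ls s (ltW s0))).
  have [t0|/ltW t0] := leP 0 t; last exact: Ls.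
  apply: eq_trans (Ls 0 (lexx 0)); apply: mart_shift => //.
  exact: natural_filtration_mono (ltW s0) _ FA.
Qed.

End stopped_martingale.

(** * Bounds in L2 *)

(** Cauchy-Schwarz, from the nonnegative integral of [(c f - I)^2]. A positive bound [c] replaces
    the mass, so that the zero measure, possible for an entry of the kernel, is covered. *)
Lemma Rintegral_sqr_le d (T : measurableType d) (R : realType)
    (nu : {finite_measure set T -> \bar R}) (c : R) (f : T -> R) :
  0 < c -> (nu setT <= c%:E)%E -> measurable_fun setT f ->
  (((\int[nu]_x f x) ^+ 2)%:E <= c%:E * \int[nu]_x (f x ^+ 2)%:E)%E.
Proof.
move=> c0 nuc mf; set J : \bar R := (\int[nu]_x (f x ^+ 2)%:E)%E.
have J0 : (0 <= J)%E by apply: integral_ge0 => x _; rewrite lee_fin sqr_ge0.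
have [->|Joo] := eqVneq J +oo%E; first by rewrite gt0_muley ?lte_fin// leey.
have mf2 : measurable_fun setT (fun x => f x ^+ 2) by exact: measurable_funX.
have if2 : nu.-integrable setT (EFin \o (fun x => f x ^+ 2)).
  apply/integrableP; split; first exact/measurable_EFinP.
  under eq_integral do rewrite /= ger0_norm ?sqr_ge0//.
  by rewrite -/J ltey.
have i1 (a : R) : nu.-integrable setT (EFin \o cst a).
  by apply: bounded_measurable_integrable; exact: bounded_measurable_cst.
have if1 : nu.-integrable setT (EFin \o f).
  apply: (@le_integrable _ _ _ _ _ measurableT _ (EFin \o (fun x => 1 + f x ^+ 2))).
  - exact/measurable_EFinP.
  - move=> x _ /=; rewrite lee_fin (@ger0_norm _ (1 + _)) ?addr_ge0 ?sqr_ge0//.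
    rewrite -(@real_normK _ (f x)) ?num_real//; have := sqr_ge0 (`|f x| - 1); nra.
  - rewrite (_ : _ \o _ = ((EFin \o cst (1%R : R)) \+ (EFin \o (fun x => f x ^+ 2)%R))%E).
      by apply: integrableD => //; exact: i1.
    by apply/funext.
set I := \int[nu]_x f x.
have m0 : 0 <= fine (nu setT) by rewrite fine_ge0.
have mc : fine (nu setT) <= c.
  by rewrite -lee_fin fineK//; exact: fin_num_measure.
have JE : J = (\int[nu]_x (f x ^+ 2))%:E.
  by rewrite /Rintegral fineK// integrable_fin_num.
rewrite JE -EFinM lee_fin; set j := Rintegral _ _ _.
have : 0 <= \int[nu]_x (c ^+ 2 * f x ^+ 2 + (- (2 * c * I) * f x + cst (I ^+ 2) x)).
  apply: Rintegral_ge0 => x _ /=.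
  have -> : c ^+ 2 * f x ^+ 2 + (- (2 * c * I) * f x + I ^+ 2) = (c * f x - I) ^+ 2 by ring.
  exact: sqr_ge0.
have iZ (a : R) g : nu.-integrable setT (EFin \o g) -> nu.-integrable setT (EFin \o (fun x => a * g x)).
  move=> ig; rewrite (_ : _ \o _ = fun x => a%:E * (EFin \o g) x)%E; first exact: integrableZl.
  by apply/funext => x /=; rewrite EFinM.
have iDr : nu.-integrable setT (EFin \o (fun x => - (2 * c * I) * f x + cst (I ^+ 2) x)).
  rewrite (_ : _ \o _ = (EFin \o (fun x => (- (2 * c * I)) * f x)%R) \+ (EFin \o cst (I ^+ 2)%R))%E//.
  by apply: integrableD => //; exact: iZ.
rewrite RintegralD//; last exact: iZ.
rewrite RintegralD//; last exact: iZ.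
have -> : \int[nu]_x cst (I ^+ 2) x = I ^+ 2 * fine (nu setT) by exact: Rintegral_cst.
rewrite !RintegralZl// -/I -/j => H.
rewrite -(ler_pM2l c0); have := sqr_ge0 I => I0; nra.
Qed.

Section parametrized_integral.
Context d1 d2 (S : measurableType d1) (Y : measurableType d2) (R : realType).
Variables (nu : {finite_measure set S -> \bar R}) (f : S -> Y -> R).
Hypothesis mf : measurable_fun setT (fun z : S * Y => f z.1 z.2).

Lemma measurable_Rintegral_param : measurable_fun setT (fun y => \int[nu]_x f x y).
Proof.
rewrite /Rintegral; apply: (measurableT_comp (@fine_measurable _ setT measurableT)).
pose F (z : S * Y) : \bar R := (f z.1 z.2)%:E.
have mF : measurable_fun setT F by exact/measurable_EFinP.
rewrite (_ : (fun y => _) = (fun y => fubini_G nu F^\+ y - fubini_G nu F^\- y))%E.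
  apply: emeasurable_funB.
    by apply: measurable_fun_fubini_tonelli_G => //; exact: measurable_funepos.
  by apply: measurable_fun_fubini_tonelli_G => //; exact: measurable_funeneg.
apply/funext => y; rewrite integralE /fubini_G /=.
by congr (_ - _)%E; apply: eq_integral => x _; rewrite ?funeposE ?funenegE.
Qed.

End parametrized_integral.

Section L2_bounds.
Context d (Om : measurableType d) (R : realType) (P : probability Om R).
Implicit Types (f g : Om -> R) (a b c : R).

Definition L2_le f c := measurable_fun setT f /\ (\int[P]_w (f w ^+ 2)%:E <= c%:E)%E.

Lemma L2_le_weaken f a b : a <= b -> L2_le f a -> L2_le f b.
Proof. by move=> ab [mf fa]; split=> //; apply: le_trans fa _; rewrite lee_fin. Qed.

Lemma L2_le_sum (I : finType) (F : I -> Om -> R) (c : I -> R) :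
  (forall i, L2_le (F i) (c i)) ->
  L2_le (fun w => \sum_i F i w) (#|I|%:R * \sum_i c i).
Proof.
move=> FC; have mF i : measurable_fun setT (F i) by case: (FC i).
split; first exact: measurable_sum.
have mF2 i : measurable_fun setT (fun w => ((F i w) ^+ 2)%:E).
  by apply/measurable_EFinP; exact: measurable_funX.
apply: (@le_trans _ _ (\int[P]_w (#|I|%:R%:E * \sum_i ((F i w) ^+ 2)%:E))%E).
  apply: ge0_le_integral => //.
  - by move=> w _; rewrite lee_fin sqr_ge0.
  - by apply/measurable_EFinP; apply: measurable_funX; exact: measurable_sum.
  - by apply: measurable_funeM; exact: emeasurable_sum.
  - move=> w _; rewrite sumEFin -EFinM lee_fin.
    rewrite expr2 big_distrlr /=.
    apply: (@le_trans _ _ (\sum_i \sum_j (F i w ^+ 2 + F j w ^+ 2) / 2)).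
      apply: ler_sum => i _; apply: ler_sum => j _.
      have := sqr_ge0 (F i w - F j w); rewrite ler_pdivlMr//; nra.
    have E i : \sum_j (F i w ^+ 2 + F j w ^+ 2) / 2 =
        (#|I|%:R * F i w ^+ 2 + \sum_j F j w ^+ 2) / 2.
      by rewrite -mulr_suml big_split /= sumr_const mulr_natl.
    rewrite (eq_bigr _ (fun i _ => E i)).
    rewrite -mulr_suml big_split /= sumr_const -mulr_sumr mulr_natl.
    by rewrite ler_pdivrMr// mulr2n mulrDr mulr1.
rewrite ge0_integralZl//; last 2 first.
- exact: emeasurable_sum.
- by move=> w _; apply: sume_ge0 => i _; rewrite lee_fin sqr_ge0.
rewrite ge0_integral_sum//; last by move=> i w _; rewrite lee_fin sqr_ge0.
rewrite EFinM lee_wpmul2l// -sumEFin; apply: lee_sum => i _.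
by case: (FC i).
Qed.

Lemma L2_leD f g a b : L2_le f a -> L2_le g b -> L2_le (fun w => f w + g w) (2 * (a + b)).
Proof.
move=> fa gb; have := @L2_le_sum bool (fun i => if i then f else g) (fun i => if i then a else b).
rewrite card_bool big_bool /= => H.
rewrite (_ : (fun w => _) = (fun w => \sum_i (if i then f else g) w)); first by apply: H => -[].
by apply/funext => w; rewrite big_bool.
Qed.

Lemma L2_leZ k f c : L2_le f c -> L2_le (fun w => k * f w) (k ^+ 2 * c).
Proof.
move=> [mf fc]; split; first exact: measurable_funM.
under eq_integral do rewrite exprMn EFinM.
rewrite ge0_integralZl//; last 3 first.
- by apply/measurable_EFinP; exact: measurable_funX.
- by move=> w _; rewrite lee_fin sqr_ge0.
- by rewrite lee_fin sqr_ge0.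
by rewrite [X in (_ <= X)%E]EFinM lee_wpmul2l// lee_fin sqr_ge0.
Qed.

Lemma L2_leN f c : L2_le f c -> L2_le (fun w => - f w) c.
Proof.
move=> /(L2_leZ (-1)); rewrite sqrrN expr1n mul1r.
by under eq_fun do rewrite mulN1r.
Qed.

Lemma L2_leB f g a b : L2_le f a -> L2_le g b -> L2_le (fun w => f w - g w) (2 * (a + b)).
Proof. by move=> fa /L2_leN; exact: L2_leD. Qed.

Lemma L2_le_cst k : L2_le (cst k) (k ^+ 2).
Proof.
split; first exact: measurable_cst.
rewrite (_ : (fun w => _) = cst (k ^+ 2)%:E)// integral_cst//.
by rewrite (_ : _ setT = 1%E) ?mule1//; exact: probability_setT.
Qed.

Lemma L2_le_ae f g c : measurable_fun setT g -> {ae P, forall w, f w = g w} ->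
  L2_le f c -> L2_le g c.
Proof.
move=> mg fg [mf fc]; split=> //; apply: le_trans fc.
rewrite le_eqVlt; apply/orP; left; apply/eqP; apply: ge0_ae_eq_integral => //.
- by apply/measurable_EFinP; exact: measurable_funX.
- by apply/measurable_EFinP; exact: measurable_funX.
- by move=> w _; rewrite lee_fin sqr_ge0.
- by move=> w _; rewrite lee_fin sqr_ge0.
- by apply: filterS fg => w /= ->.
Qed.

(** Cauchy-Schwarz in the mixing variable, then Tonelli. It transfers a bound at each fixed shift to
    the integral over shifts. *)
Lemma L2_le_mixture d' (S : measurableType d') (nu : {finite_measure set S -> \bar R})
    (f : S -> Om -> R) (a : S -> R) (b c : R) :
  measurable_fun setT (fun z : S * Om => f z.1 z.2) -> measurable_fun setT a ->
  (forall s, L2_le (f s) (a s)) -> 0 < b -> (nu setT <= b%:E)%E ->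
  (\int[nu]_s (a s)%:E <= c%:E)%E ->
  L2_le (fun w => \int[nu]_s f s w) (b * c).
Proof.
move=> mf ma fa b0 nub ac; split; first exact: measurable_Rintegral_param.
pose F (z : S * Om) : \bar R := ((f z.1 z.2) ^+ 2)%:E.
have mF : measurable_fun setT F by apply/measurable_EFinP; exact: measurable_funX.
have F0 z : (0 <= F z)%E by rewrite lee_fin sqr_ge0.
have mfw w : measurable_fun setT (fun s => f s w).
  have := measurableT_comp mf (@pair2_measurable _ _ S Om w).
  by [].
apply: (@le_trans _ _ (\int[P]_w (b%:E * \int[nu]_s F (s, w)))%E).
  apply: ge0_le_integral => //.
  - by move=> w _; rewrite lee_fin sqr_ge0.
  - by apply/measurable_EFinP; apply: measurable_funX; exact: measurable_Rintegral_param.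
  - by apply: measurable_funeM; exact: (measurable_fun_fubini_tonelli_G (m1 := nu)).
  - by move=> w _; exact: Rintegral_sqr_le.
rewrite ge0_integralZl//; last 3 first.
- exact: (measurable_fun_fubini_tonelli_G (m1 := nu)).
- by move=> w _; apply: integral_ge0.
- by rewrite lee_fin ltW.
rewrite EFinM lee_pmul2l//.
rewrite -(@fubini_tonelli _ _ S Om R nu P F mF F0); apply: le_trans ac.
apply: ge0_le_integral => //.
- by move=> s _; exact: integral_ge0.
- exact: (measurable_fun_fubini_tonelli_F (m2 := P)).
- exact/measurable_EFinP.
- by move=> s _; case: (fa s).
Qed.

Lemma L2_le_fatou (f : nat -> Om -> R) g c : measurable_fun setT g ->
  (forall n, L2_le (f n) c) ->
  {ae P, forall w, exists n0, forall n, (n0 <= n)%N -> f n w = g w} ->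
  L2_le g c.
Proof.
move=> mg fc fg; split=> //.
have [N [mN N0 Ng]] := fg.
(* Replacing [f n] by [g] on the exceptional null set makes the convergence hold at every point. *)
pose f' n w := \1_N w * g w + (1 - \1_N w) * f n w.
have mf n : measurable_fun setT (f n) by case: (fc n).
have mf' n : measurable_fun setT (f' n).
  by apply: measurable_funD; apply: measurable_funM => //; apply: measurable_funB.
have f'c n : (\int[P]_w ((f' n w) ^+ 2)%:E <= c%:E)%E.
  have [] := @L2_le_ae (f n) (f' n) c (mf' n) _ (fc n); last by [].
  exists N; split=> // w /= H; apply: contrapT => Nw; apply: H.
  by rewrite /f' indicE memNset// subr0 mul1r mul0r add0r.
have f'g w : exists n0, forall n, (n0 <= n)%N -> f' n w = g w.
  have [Nw|Nw] := pselect (N w).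
    by exists 0%N => n _; rewrite /f' indicE mem_set// subrr mul1r mul0r addr0.
  have [n0 H] : exists n0, forall n, (n0 <= n)%N -> f n w = g w.
    by apply: contrapT => H; exact: Nw (Ng w H).
  by exists n0 => n /H fng; rewrite /f' indicE memNset// subr0 mul1r mul0r add0r.
have mf2 n : measurable_fun setT (fun w => ((f' n w) ^+ 2)%:E).
  by apply/measurable_EFinP; exact: measurable_funX.
rewrite (_ : (\int[P]_w _)%E = (\int[P]_w limn_einf (fun n => ((f' n w) ^+ 2)%:E))%E); last first.
  apply: eq_integral => w _; have [n0 H] := f'g w.
  have C : (fun n => ((f' n w) ^+ 2)%:E) @ \oo --> ((g w) ^+ 2)%:E.
    by apply: cvg_near_cst; exists n0 => // n /= n0n; rewrite H.
  by have [-> _] := cvg_limn_einf_sup C.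
apply: le_trans (fatou P measurableT mf2 _) _.
  by move=> n w _; rewrite lee_fin sqr_ge0.
rewrite limn_einf_lim; apply: lime_le; first exact: is_cvg_einfs.
apply: nearW => n; apply: le_trans (f'c n).
by apply: ereal_inf_lbound; exists n => /=.
Qed.

End L2_bounds.

(** * The unstopped process *)

Section unstopped_processes.
Context {disp : measure_display} {Omega : measurableType disp} {R : realType} {d : nat}.
Variables (T : nat -> Omega -> \bar R) (Z : nat -> Omega -> 'I_d).

Definition nonexplosive : set Omega :=
  [set w | forall m : nat, exists2 n, (1 <= n)%N & (m%:R%:E < T n w)%E].

(* The limit is eventually constant on [nonexplosive]. *)
Definition unstopped (u : nat -> 'I_d -> R -> Omega -> R) k t w : R :=
  \1_nonexplosive w * limn (fun n => u n.+1 k t w).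

End unstopped_processes.

Section unstopped_theory.
Context {disp : measure_display} {Omega : measurableType disp} {R : realType} {d : nat}.
Variables (T : nat -> Omega -> \bar R) (Z : nat -> Omega -> 'I_d).
Variables (mu : 'cV[R]_d) (phi : R -> 'M[R]_d).
Hypothesis mpp : marked_point_process T Z.
Hypothesis mu0 : forall i, 0 <= mu i 0.
Hypothesis mphi : forall i j, measurable_fun `[(0 : R), +oo[ (fun t : R => phi t i j).
Hypothesis phi0 : forall i j t, 0 <= t -> 0 <= phi t i j.
Hypothesis phi_int : forall i j,
  (\int[@lebesgue_measure R]_(t in `[0%R, +oo[) (phi t i j)%:E < +oo)%E.
Local Notation Ns := (stopped_count T Z).
Local Notation Ls := (stopped_compensator T Z mu phi).
Local Notation good := (nonexplosive T).
Local Notation N := (unstopped T Ns).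
Local Notation L := (unstopped T Ls).

Let late j n t w : (1 <= n)%N -> (n < j)%N -> (t%:E <= T n w)%E -> (T j w <= t%:E)%E = false.
Proof.
move=> n1 nj tT; apply/negP => Tt.
have Toy : (T n w < +oo)%E.
  apply: (@le_lt_trans _ _ t%:E); last exact: ltry.
  by apply: le_trans Tt; apply: (T_mono mpp) => //; exact: ltnW.
have := T_lt mpp n1 nj Toy.
by rewrite ltNge (le_trans Tt tT).
Qed.

Let stopped_time_past n t w : (1 <= n)%N -> (t%:E <= T n w)%E -> stopped_time T n t w = t.
Proof. by move=> n1 tT; apply: EFin_inj; rewrite (stopped_timeE mpp)// min_l. Qed.

Lemma stopped_count_past n m k t w : (1 <= n)%N -> (n <= m)%N -> (t%:E <= T n w)%E ->
  Ns m k t w = Ns n k t w.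
Proof.
move=> n1 nm tT; rewrite /stopped_count (@big_cat_nat _ _ _ n.+1)//=.
rewrite [X in _ + X]big_nat_cond [X in _ + X]big1 ?addr0// => j /andP[/andP[nj _] _].
by rewrite (late n1 nj tT).
Qed.

Lemma stopped_compensator_past n m k t w : (1 <= n)%N -> (n <= m)%N -> (t%:E <= T n w)%E ->
  Ls m k t w = Ls n k t w.
Proof.
move=> n1 nm tT; rewrite /stopped_compensator !stopped_time_past//; last 2 first.
- exact: leq_trans nm.
- by apply: le_trans tT _; exact: (T_mono mpp).
congr (_ + _); rewrite (@big_cat_nat _ _ _ n.+1)//=.
rewrite [X in _ + X]big_nat_cond [X in _ + X]big1 ?addr0// => j /andP[/andP[nj _] _].
by rewrite (late n1 nj tT).
Qed.

Let early j n s t w : (1 <= j)%N -> (j <= n)%N -> (T n w <= s%:E)%E -> s <= t -> (T j w <= t%:E)%E.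
Proof.
move=> j1 jn Ts st; apply: (le_trans (T_mono mpp w j1 jn)); apply: (le_trans Ts).
by rewrite lee_fin.
Qed.

Lemma stopped_count_late n k s t w : (T n w <= s%:E)%E -> s <= t -> Ns n k t w = Ns n k s w.
Proof.
move=> Ts st; rewrite /stopped_count; apply: eq_big_nat => j /andP[j1 jn].
by rewrite (early j1 jn Ts st) (early j1 jn Ts (lexx s)).
Qed.

Lemma stopped_compensator_late n k s t w : (1 <= n)%N -> (T n w <= s%:E)%E -> s <= t ->
  Ls n k t w = Ls n k s w.
Proof.
move=> n1 Ts st; have E : stopped_time T n t w = stopped_time T n s w.
  apply: EFin_inj; rewrite !(stopped_timeE mpp)// !min_r//.
  by apply: le_trans Ts _; rewrite lee_fin.
rewrite /stopped_compensator E; congr (_ + _); apply: eq_big_nat => j /andP[j1 jn].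
by rewrite (early j1 jn Ts st) (early j1 jn Ts (lexx s)).
Qed.

Lemma stopped_count_incr_index n m k t w : (n <= m)%N -> Ns n k t w <= Ns m k t w.
Proof.
move=> nm; rewrite /stopped_count [leRHS](@big_cat_nat _ _ _ n.+1)//= lerDl.
exact: sumr_ge0.
Qed.

Lemma stopped_compensator_incr_index n m k t w : (1 <= n)%N -> (n <= m)%N -> Ls n k t w <= Ls m k t w.
Proof.
move=> n1 nm; have y12 : stopped_time T n t w <= stopped_time T m t w.
  rewrite -lee_fin !(stopped_timeE mpp)//; last exact: leq_trans nm.
  by rewrite le_min !ge_min lexx /= (T_mono mpp)// orbT.
apply: lerD; first by rewrite ler_wpM2l// ge_max !le_max y12 lexx orbT.
rewrite [leRHS](@big_cat_nat _ _ _ n.+1)//= -[leLHS]addr0; apply: lerD.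
  apply: ler_sum_nat => j _; have [Tj|Tj] := boolP (T j w <= t%:E)%E; last exact: lexx.
  by apply: (offspring_mono mphi phi0 phi_int); rewrite lerD2r.
by apply: sumr_ge0 => j _; case: ifP => // _; exact: (offspring_ge0 mphi phi0 phi_int).
Qed.

(** If [s] precedes the [n]-th jump, both processes agree at [s] and later stopping only adds jumps.
    Otherwise the process stopped at [n] is already frozen. *)
Lemma stopped_count_incr_le n m k s t w : (1 <= n)%N -> (n <= m)%N -> s <= t ->
  Ns n k t w - Ns n k s w <= Ns m k t w - Ns m k s w.
Proof.
move=> n1 nm st; have [sT|/ltW Ts] := leP s%:E (T n w).
  by rewrite (stopped_count_past k n1 nm sT) lerD2r stopped_count_incr_index.
apply: (@le_trans _ _ 0); first by rewrite (stopped_count_late k Ts st) subrr.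
by rewrite subr_ge0 stopped_count_mono.
Qed.

Lemma stopped_compensator_incr_le n m k s t w : (1 <= n)%N -> (n <= m)%N -> s <= t ->
  Ls n k t w - Ls n k s w <= Ls m k t w - Ls m k s w.
Proof.
move=> n1 nm st; have [sT|/ltW Ts] := leP s%:E (T n w).
  by rewrite (stopped_compensator_past k n1 nm sT) lerD2r stopped_compensator_incr_index.
apply: (@le_trans _ _ 0); first by rewrite (stopped_compensator_late k n1 Ts st) subrr.
rewrite subr_ge0.
by apply: (stopped_compensator_mono mpp mu0 mphi phi0 phi_int) => //; exact: leq_trans nm.
Qed.

Lemma nonexplosiveP w t0 : good w ->
  exists n0, forall n, (n0 <= n)%N -> forall t, t <= t0 -> (t%:E <= T n.+1 w)%E.
Proof.
move=> /(_ (Num.truncn t0).+1)[n n1 nT]; exists n => m nm t tt0.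
apply: (le_trans _ (le_trans (ltW nT) (T_mono mpp w n1 (leqW nm)))).
by rewrite lee_fin (le_trans tt0)// ltW// truncnS_gt.
Qed.

Let unstoppedE (u : nat -> 'I_d -> R -> Omega -> R) w n k t : good w ->
  (forall m, (n.+1 <= m)%N -> u m k t w = u n.+1 k t w) ->
  unstopped T u k t w = u n.+1 k t w.
Proof.
move=> gw uE; rewrite /unstopped indicE mem_set// mul1r; apply/cvg_lim => //.
by apply: cvg_near_cst; exists n => // m /= nm; rewrite uE.
Qed.

Lemma unstopped_countE n k t w : good w -> (t%:E <= T n.+1 w)%E -> N k t w = Ns n.+1 k t w.
Proof. by move=> gw tT; apply: (@unstoppedE Ns) => [//|m nm]; exact: (stopped_count_past k (ltn0Sn n) nm tT). Qed.

Lemma unstopped_compensatorE n k t w : good w -> (t%:E <= T n.+1 w)%E -> L k t w = Ls n.+1 k t w.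
Proof. by move=> gw tT; apply: (@unstoppedE Ls) => [//|m nm]; exact: (stopped_compensator_past k (ltn0Sn n) nm tT). Qed.

Lemma unstopped_explosive (u : nat -> 'I_d -> R -> Omega -> R) k t w : ~ good w -> unstopped T u k t w = 0 :> R.
Proof. by move=> gw; rewrite /unstopped indicE memNset// mul0r. Qed.

Lemma unstopped_eventually w t0 : good w -> exists n0, forall n, (n0 <= n)%N ->
  forall k t, t <= t0 -> N k t w = Ns n.+1 k t w /\ L k t w = Ls n.+1 k t w.
Proof.
move=> gw; have [n0 H] := nonexplosiveP t0 gw.
exists n0 => n n0n k t tt0; have tT := H n n0n t tt0.
by split; [exact: unstopped_countE|exact: unstopped_compensatorE].
Qed.

Lemma unstopped_count_mono k s t w : s <= t -> N k s w <= N k t w.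
Proof.
move=> st; have [gw|gw] := pselect (good w); last by rewrite !unstopped_explosive.
have [n0 H] := unstopped_eventually t gw.
by have [-> _] := H n0 (leqnn _) k s st; have [-> _] := H n0 (leqnn _) k t (lexx t); exact: stopped_count_mono.
Qed.

Lemma unstopped_compensator_mono k s t w : s <= t -> L k s w <= L k t w.
Proof.
move=> st; have [gw|gw] := pselect (good w); last by rewrite !unstopped_explosive.
have [n0 H] := unstopped_eventually t gw.
have [_ ->] := H n0 (leqnn _) k s st; have [_ ->] := H n0 (leqnn _) k t (lexx t).
exact: (stopped_compensator_mono mpp mu0 mphi phi0 phi_int).
Qed.

Lemma unstopped_le0 k t w : t <= 0 -> N k t w = 0 /\ L k t w = 0.
Proof.
move=> t0; have [gw|gw] := pselect (good w); last by rewrite !unstopped_explosive.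
have [n0 H] := unstopped_eventually t gw.
have [-> ->] := H n0 (leqnn _) k t (lexx t).
by rewrite (stopped_count_le0 mpp)// (stopped_compensator_le0 _ _ mpp).
Qed.

Lemma stopped_incr_le_unstopped n k s t w : good w -> s <= t ->
  Ns n.+1 k t w - Ns n.+1 k s w <= N k t w - N k s w /\
  Ls n.+1 k t w - Ls n.+1 k s w <= L k t w - L k s w.
Proof.
move=> gw st; have [n0 H] := unstopped_eventually t gw.
pose m := maxn n n0.
have [-> ->] := H m (leq_maxr _ _) k s st; have [-> ->] := H m (leq_maxr _ _) k t (lexx t).
have nm : (n.+1 <= m.+1)%N by rewrite ltnS leq_maxl.
by split; [exact: stopped_count_incr_le|exact: stopped_compensator_incr_le].
Qed.

Lemma counting_process_unstopped k t w : good w -> counting_process T Z k t w = (N k t w)%:E.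
Proof.
move=> gw; have [n0 H] := nonexplosiveP t gw.
have tT := H n0 (leqnn _) t (lexx t).
rewrite (unstopped_countE k gw tT) -(counting_process_stopped mpp)//.
by rewrite stopped_time_past.
Qed.

Lemma nonexplosive_measurable : measurable good.
Proof.
rewrite (_ : good = \bigcap_m \bigcup_n [set w | (m%:R%:E < T n.+1 w)%E]).
  apply: bigcapT_measurable => m; apply: bigcupT_measurable => n.
  have := emeasurable_fun_o_infty measurableT (T_measurable mpp (ltn0Sn n)) (m%:R%:E).
  by rewrite setTI.
apply/seteqP; split => w /=.
  by move=> gw m _; have [[|n]// _ mT] := gw m; exists n.
by move=> H m; have [n _ mT] := H m I; exists n.+1.
Qed.

Let jump_joint m : (1 <= m)%N -> measurable [set z : R * Omega | (T m z.2 <= z.1%:E)%E].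
Proof.
move=> m1; pose f (z : R * Omega) : \bar R := (T m z.2 - z.1%:E)%E.
have mf : measurable_fun setT f.
  apply: emeasurable_funB.
    by apply: (measurableT_comp (T_measurable mpp m1)); exact: measurable_snd.
  by apply/measurable_EFinP; exact: measurable_fst.
have := emeasurable_fun_infty_c measurableT mf 0%E.
rewrite setTI (_ : [set z | _] = [set z : R * Omega | (T m z.2 <= z.1%:E)%E])//.
by apply/seteqP; split => z /=; rewrite /f leeBlDr// add0e.
Qed.

Let mark_joint m i : (1 <= m)%N -> measurable [set z : R * Omega | Z m z.2 = i].
Proof.
move=> m1; have := @measurable_snd _ _ R Omega measurableT _ (Z_measurable mpp i m1).
by rewrite setTI.
Qed.

Let jump_indic_joint m i : (1 <= m)%N ->
  measurable_fun setT (fun z : R * Omega => ((T m z.2 <= z.1%:E)%E && (Z m z.2 == i))%:R : R).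
Proof.
move=> m1; rewrite (_ : (fun z => _) =
    \1_([set z : R * Omega | (T m z.2 <= z.1%:E)%E] `&` [set z | Z m z.2 = i])).
  by apply: measurable_indic; apply: measurableI; [exact: jump_joint|exact: mark_joint].
apply/funext => z; rewrite indicE; congr (nat_of_bool _)%:R; apply/idP/idP.
  by move=> /andP[Tt /eqP Zi]; rewrite mem_set.
by rewrite inE => -[/= -> /= ->]; rewrite eqxx.
Qed.

Let sum_joint n (F : nat -> R * Omega -> R) :
  (forall m, (1 <= m)%N -> measurable_fun setT (F m)) ->
  measurable_fun setT (fun z => \sum_(1 <= m < n.+1) F m z).
Proof.
move=> mF; rewrite (_ : (fun z => _) = (fun z => \sum_(m <- index_iota 0 n) F m.+1 z)).
  by apply: measurable_sum => m; exact: mF.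
by apply/funext => z; rewrite big_add1.
Qed.

(** Joint measurability in time and path is what Tonelli needs when the kernel mixes shifted
    paths. *)
Lemma stopped_count_joint n k : measurable_fun setT (fun z : R * Omega => Ns n k z.1 z.2).
Proof. by apply: sum_joint => m m1; exact: jump_indic_joint. Qed.

Let stopped_time_joint n : (1 <= n)%N ->
  measurable_fun setT (fun z : R * Omega => stopped_time T n z.1 z.2).
Proof.
move=> n1; apply: (measurableT_comp (@fine_measurable _ setT measurableT)).
apply: measurable_mine; first by apply/measurable_EFinP; exact: measurable_fst.
by apply: (measurableT_comp (T_measurable mpp n1)); exact: measurable_snd.
Qed.

Lemma stopped_compensator_joint n k : (1 <= n)%N ->
  measurable_fun setT (fun z : R * Omega => Ls n k z.1 z.2).
Proof.
move=> n1; apply: measurable_funD.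
  apply: measurable_funM; first exact: measurable_cst.
  by apply: measurable_maxr; [exact: stopped_time_joint|exact: measurable_cst].
pose F m (z : R * Omega) : R := \sum_j (((T m z.2 <= z.1%:E)%E && (Z m z.2 == j))%:R *
  offspring phi k j (stopped_time T n z.1 z.2 - fine (T m z.2))).
rewrite (_ : (fun z => _) = (fun z => \sum_(1 <= m < n.+1) F m z)).
  apply: sum_joint => m m1; apply: measurable_sum => j.
  apply: measurable_funM; first exact: jump_indic_joint.
  apply: (measurableT_comp (offspring_measurable mphi phi0 phi_int k j)).
  apply: measurable_funB; first exact: stopped_time_joint.
  apply: (measurableT_comp (@fine_measurable _ setT measurableT)).
  by apply: (measurableT_comp (T_measurable mpp m1)); exact: measurable_snd.
apply/funext => z; apply: eq_bigr => m _; rewrite /F.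
rewrite (bigD1 (Z m z.2))//= eqxx andbT big1 ?addr0; last first.
  by move=> j; rewrite eq_sym => /negbTE ->; rewrite andbF mul0r.
by case: ifP => _; rewrite ?mul1r ?mul0r.
Qed.

Let unstopped_joint (u : nat -> 'I_d -> R -> Omega -> R) k : (forall n, measurable_fun setT (fun z : R * Omega => u n.+1 k z.1 z.2)) ->
  (forall t w, good w -> exists n0, forall n, (n0 <= n)%N -> u n.+1 k t w = unstopped T u k t w) ->
  measurable_fun setT (fun z : R * Omega => unstopped T u k z.1 z.2 : R).
Proof.
move=> mu' uE; apply: (@measurable_fun_cvg _ _ _ setT (fun n z => \1_good z.2 * u n.+1 k z.1 z.2)).
  move=> n; apply: measurable_funM => //.
  apply: (measurableT_comp (measurable_indic nonexplosive_measurable)); exact: measurable_snd.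
move=> [t w] _ /=; have [gw|gw] := pselect (good w).
  rewrite indicE mem_set//; have [n0 H] := uE t w gw.
  by apply: cvg_near_cst; exists n0 => // n /= n0n; rewrite mul1r H.
rewrite unstopped_explosive// indicE memNset//.
by apply: cvg_near_cst; exists 0%N => // n /= _; rewrite mul0r.
Qed.

Lemma unstopped_count_joint k : measurable_fun setT (fun z : R * Omega => N k z.1 z.2).
Proof.
apply: unstopped_joint => [n|t w gw]; first exact: stopped_count_joint.
have [n0 H] := unstopped_eventually t gw; exists n0 => n n0n.
by have [->] := H n n0n k t (lexx t).
Qed.

Lemma unstopped_compensator_joint k : measurable_fun setT (fun z : R * Omega => L k z.1 z.2).
Proof.
apply: unstopped_joint => [n|t w gw]; first exact: stopped_compensator_joint.
have [n0 H] := unstopped_eventually t gw; exists n0 => n n0n.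
by have [_ ->] := H n n0n k t (lexx t).
Qed.

End unstopped_theory.

(** * The representation of the centered process *)

(** A row vector annihilated by [1 - A] would be an eigenvector for the eigenvalue 1. *)
Lemma resolvent_unit (R : realType) n (A : 'M[R]_n) :
  spectral_radius A < 1 -> 1%:M - A \in unitmx.
Proof.
move=> rho; rewrite unitmxE unitfE; apply/negP => /det0P[v v0 vA].
have Av : v *m A = v by apply/esym/eqP; rewrite -subr_eq0 -{1}[v]mulmx1 -mulmxBr vA.
have /eigenvalue_norm_le : eigenvalue (map_mx (real_complex R) A) 1.
  apply/eigenvalueP; exists (map_mx (real_complex R) v); last by rewrite map_mx_eq0.
  by rewrite -map_mxM Av scale1r.
by rewrite Normc.normc1 leNgt rho.
Qed.

(** * Measures on the nonnegative half-line *)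

Section halfline_measure.
Context (R : realType) (nu : {finite_measure set R -> \bar R}).
Hypothesis nu_neg : nu `]-oo, (0 : R)[%classic = 0%E.

Let ae_onpos (f : R -> R) : ae_eq nu setT (EFin \o f) (EFin \o onpos f).
Proof.
exists `]-oo, (0 : R)[%classic; split=> //.
move=> s /= H; rewrite in_itv /= ltNge; apply/negP => s0; apply: H => _.
by rewrite /onpos s0.
Qed.

Let onpos_mT (f : R -> R) : measurable_fun setT f -> measurable_fun setT (onpos f).
Proof. by move=> mf; apply: onpos_measurable; exact: measurable_funTS. Qed.

(** Shifted paths and ramps, as functions of the shift [s], may be unbounded for negative [s]; they
    are bounded where the measure lives. *)
Lemma halfline_integrable (f : R -> R) c : measurable_fun setT f ->
  (forall s, 0 <= s -> `|f s| <= c) -> nu.-integrable setT (EFin \o f).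
Proof.
move=> mf fc; have c0 : 0 <= c by apply: le_trans (fc 0 (lexx 0)).
have : nu.-integrable setT (EFin \o onpos f).
  apply: bounded_measurable_integrable; split; first exact: onpos_mT.
  by exists c => s; rewrite /onpos; case: ifP => [/fc|]//; rewrite normr0.
move=> /integrableP[mo oo]; apply/integrableP; split; first exact/measurable_EFinP.
apply: le_lt_trans oo; rewrite le_eqVlt; apply/orP; left; apply/eqP.
apply: ge0_ae_eq_integral => //.
- by apply/measurable_EFinP; exact: measurableT_comp.
- exact: measurableT_comp.
- by apply: filterS (ae_onpos f) => s /= H _; have [->] := H I.
Qed.

Lemma halfline_congr (f g : R -> R) : measurable_fun setT f -> measurable_fun setT g ->
  (forall s, 0 <= s -> f s = g s) -> \int[nu]_s f s = \int[nu]_s g s.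
Proof.
move=> mf mg fg; rewrite /Rintegral; congr fine.
have E h : measurable_fun setT h -> (\int[nu]_s (h s)%:E = \int[nu]_s (onpos h s)%:E)%E.
  move=> mh; apply: ae_eq_integral => //; try exact/measurable_EFinP; last exact: ae_onpos.
  by apply/measurable_EFinP; exact: onpos_mT.
rewrite E// [RHS]E//; apply: eq_integral => s _.
by rewrite /onpos; case: ifP => // s0; rewrite fg.
Qed.

End halfline_measure.

Lemma ramp_measurable (R : realType) (t : R) : measurable_fun setT (fun s : R => Num.max (t - s) 0).
Proof.
apply: measurable_maxr; last exact: measurable_cst.
by apply: measurable_funB => //; exact: measurable_cst.
Qed.

Lemma ramp_le (R : realType) (t s : R) : 0 <= s -> 0 <= Num.max (t - s) 0 <= Num.max t 0.
Proof. by move=> s0; rewrite le_max lexx orbT /= ge_max !le_max lexx orbT andbT gerBl s0. Qed.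

Section cluster_representation.
Context {disp : measure_display} {Omega : measurableType disp} {R : realType} {d : nat}.
Local Notation leb := (@lebesgue_measure R).
Variables (T : nat -> Omega -> \bar R) (Z : nat -> Omega -> 'I_d).
Variables (mu : 'cV[R]_d) (phi : R -> 'M[R]_d).
Hypothesis mpp : marked_point_process T Z.
Hypothesis mu0 : forall i, 0 <= mu i 0.
Hypothesis mphi : forall i j, measurable_fun `[(0 : R), +oo[ (fun t : R => phi t i j).
Hypothesis phi0 : forall i j t, 0 <= t -> 0 <= phi t i j.
Hypothesis phi_int : forall i j,
  (\int[leb]_(t in `[0%R, +oo[) (phi t i j)%:E < +oo)%E.
Variable kap : 'I_d -> 'I_d -> {finite_measure set R -> \bar R}.
Hypothesis kap_neg : forall i j, kap i j `]-oo, (0 : R)[%classic = 0%E.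
Hypothesis kap_renewal : forall i j (x : R),
  kap i j `]-oo, x]%classic = (((i == j) && (0 <= x)%R)%:R%:E +
    \sum_(l < d) \int[kap i l]_s (\int[leb]_(t in `[0%R, (x - s)%R]) phi t l j)%:E)%E.
Local Notation good := (nonexplosive T).
Local Notation N := (unstopped T (stopped_count T Z)).
Local Notation L := (unstopped T (stopped_compensator T Z mu phi)).

(** Without explosion only finitely many jumps occur up to [t]. Listing them turns identities
    between paths into finite sums over jumps. *)
Lemma unstopped_jumps w t : good w -> exists (J : seq nat) (r : nat -> R),
  [/\ forall k, N k t w = \sum_(m <- J) (Z m w == k)%:R,
      forall m, m \in J -> r m <= t,
      forall l x, x <= t -> N l x w = \sum_(m <- J) ((Z m w == l) && (r m <= x))%:R &
      forall l x, x <= t -> L l x w = mu l 0 * Num.max x 0 +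
        \sum_(m <- J) offspring phi l (Z m w) (x - r m)].
Proof.
move=> gw; have [n0 H] := nonexplosiveP mpp t gw.
have HT x : x <= t -> (x%:E <= T n0.+1 w)%E by exact: H.
pose J := [seq m <- index_iota 1 n0.+2 | (T m w <= t%:E)%E].
have fin m : (1 <= m)%N -> (T m w <= t%:E)%E -> T m w = (fine (T m w))%:E.
  by move=> m1; have := T_gt0 mpp w m1; case: (T m w).
have bigJ (F : nat -> R) : \sum_(m <- J) F m =
    \sum_(1 <= m < n0.+2) (if (T m w <= t%:E)%E then F m else 0).
  by rewrite big_filter big_mkcond.
exists J, (fun m => fine (T m w)); split.
- move=> k; rewrite (unstopped_countE mpp _ gw (HT t (lexx t))) bigJ.
  by apply: eq_big_nat => m _; case: (_ <= _)%E.
- move=> m; rewrite mem_filter mem_index_iota => /andP[Tt /andP[m1 _]].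
  by rewrite -lee_fin -fin.
- move=> l x xt; rewrite (unstopped_countE mpp _ gw (HT x xt)) bigJ.
  apply: eq_big_nat => m /andP[m1 _]; have [Tt|Tt] := boolP (T m w <= t%:E)%E.
    by rewrite {1}(fin m)// lee_fin andbC.
  rewrite (_ : (T m w <= x%:E)%E = false)//; apply: contraNF Tt => Tx.
  by apply: le_trans Tx _; rewrite lee_fin.
- move=> l x xt; rewrite (unstopped_compensatorE mu phi mpp _ gw (HT x xt)) bigJ.
  rewrite /stopped_compensator (_ : stopped_time T n0.+1 x w = x); last first.
    by apply: EFin_inj; rewrite (stopped_timeE mpp)// min_l// HT.
  congr (_ + _); apply: eq_big_nat => m /andP[m1 _].
  have [Tt|Tt] := boolP (T m w <= t%:E)%E.
    have [//|Tx] := boolP (T m w <= x%:E)%E.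
    by rewrite offspring_le0// subr_le0 ltW// -lte_fin -fin// ltNge.
  rewrite (_ : (T m w <= x%:E)%E = false)//; apply: contraNF Tt => Tx.
  by apply: le_trans Tx _; rewrite lee_fin.
Qed.

Let renewal i j (x : R) : fine (kap i j `]-oo, x]%classic) =
  ((i == j) && (0 <= x))%:R + \sum_l \int[kap i l]_s offspring phi l j (x - s).
Proof.
have b l : bounded_measurable (fun s : R => offspring phi l j (x - s)).
  split.
    apply: (measurableT_comp (offspring_measurable mphi phi0 phi_int l j)).
    by apply: measurable_funB => //; exact: measurable_cst.
  exists (branching_matrix phi l j) => s.
  by rewrite ger0_norm ?(offspring_ge0 mphi phi0 phi_int)// (offspring_leK mphi phi0 phi_int).
apply: EFin_inj; rewrite fineK ?fin_num_measure// kap_renewal EFinD -sumEFin.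
by congr (_ + _)%E; apply: eq_bigr => l _; rewrite Rint_EFin.
Qed.

(* the expected number of points of mark [k] up to time [t] *)
Definition mean_count k t : R := \sum_l mu l 0 * \int[kap k l]_s Num.max (t - s) 0.

Let path_measurable (F : 'I_d -> R -> Omega -> R) l t w :
  measurable_fun setT (fun z : R * Omega => F l z.1 z.2) ->
  measurable_fun setT (fun s : R => F l (t - s) w).
Proof.
move=> mF; apply: (measurableT_comp (f := fun x : R => F l x w)).
  have := measurableT_comp mF (@pair2_measurable _ _ R Omega w).
  by [].
by apply: measurable_funB => //; exact: measurable_cst.
Qed.

Let mNp l t w : measurable_fun setT (fun s : R => N l (t - s) w).
Proof. by apply: path_measurable; exact: unstopped_count_joint. Qed.

Let mLp l t w : measurable_fun setT (fun s : R => L l (t - s) w).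
Proof. by apply: path_measurable; exact: unstopped_compensator_joint. Qed.

Let ramp_path_measurable t : measurable_fun setT (fun s : R => Num.max (t - s) 0).
Proof. exact: ramp_measurable. Qed.

Let ramp_integrable k l t : (kap k l).-integrable setT (EFin \o (fun s : R => Num.max (t - s) 0)).
Proof.
apply: (halfline_integrable (kap_neg k l) (c := Num.max t 0)) => // s s0.
rewrite ger0_norm ?le_max ?lexx ?orbT// -le_max ge_max !le_max lexx orbT andbT.
by rewrite gerBl s0.
Qed.

(** Both sides are sums over jumps plus the same deterministic term. For a jump at time [r] with
    mark [j], the contribution to the right is the kernel mass up to [t - r]; the contributions to
    the left are [1(k = j)] and the kernel integral of [offspring]. Equality is the renewal
    equation. Nothing is subtracted, so that expectations of both sides can be taken before
    finiteness is known. *)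
Lemma cluster_identity k t w : good w ->
  N k t w + \sum_l \int[kap k l]_s L l (t - s) w =
  mean_count k t + \sum_l \int[kap k l]_s N l (t - s) w.
Proof.
move=> gw; have [J [r [NtE rt NE LE]]] := unstopped_jumps t gw.
have bo l j x : bounded_measurable (fun s : R => offspring phi l j (x - s)).
  split.
    apply: (measurableT_comp (offspring_measurable mphi phi0 phi_int l j)).
    by apply: measurable_funB => //; exact: measurable_cst.
  exists (branching_matrix phi l j) => s.
  by rewrite ger0_norm ?(offspring_ge0 mphi phi0 phi_int)// (offspring_leK mphi phi0 phi_int).
have xt s : 0 <= s -> t - s <= t by rewrite gerBl.
have bi (x : R) : bounded_measurable (\1_(`]-oo, x]%classic) : R -> R).
  by split; [exact: measurable_indic|exists 1 => s; rewrite indicE ger0_norm// lern1 leq_b1].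
have LI l : \int[kap k l]_s L l (t - s) w = mu l 0 * \int[kap k l]_s Num.max (t - s) 0 +
    \sum_(m <- J) \int[kap k l]_s offspring phi l (Z m w) (t - r m - s).
  pose g (s : R) := \sum_(m <- J) offspring phi l (Z m w) (t - r m - s).
  have bg : bounded_measurable g by apply: bounded_measurable_sum => m _; exact: bo.
  rewrite (halfline_congr (kap_neg k l) (g := fun s => mu l 0 * Num.max (t - s) 0 + g s))//.
  - have iZ : (kap k l).-integrable setT (EFin \o (fun s : R => mu l 0 * Num.max (t - s) 0)).
      have := integrableZl measurableT (mu l 0) (ramp_integrable k l t).
      by congr (_.-integrable _ _); apply/funext => s /=; rewrite EFinM.
    rewrite RintegralD//; last exact: bounded_measurable_integrable.
    have -> : \int[kap k l]_s g s = \sum_(m <- J) \int[kap k l]_s offspring phi l (Z m w) (t - r m - s).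
      by apply: Rint_sum => m _; exact: bo.
    congr (_ + _); apply: RintegralZl => //; exact: ramp_integrable.
  - by apply: measurable_funD; [exact: measurable_funM|case: bg].
  - move=> s s0; rewrite LE ?xt//; congr (_ + _); apply: eq_bigr => m _.
    by congr (offspring _ _ _ _); ring.
have NI l : \int[kap k l]_s N l (t - s) w =
    \sum_(m <- J) (Z m w == l)%:R * fine (kap k l `]-oo, t - r m]%classic).
  pose g (s : R) : R := \sum_(m <- J) (Z m w == l)%:R * \1_(`]-oo, t - r m]%classic) s.
  have bg m : bounded_measurable (fun s : R => (Z m w == l)%:R * \1_(`]-oo, t - r m]%classic) s : R).
    exact: bounded_measurableZ.
  rewrite (halfline_congr (kap_neg k l) (g := g))//.
  - rewrite Rint_sum//; apply: eq_bigr => m _; rewrite Rint_scale//; congr (_ * _).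
    by rewrite /Rintegral integral_indic// setIT.
  - by have [] : bounded_measurable g by apply: bounded_measurable_sum => m _; exact: bg.
  - move=> s s0; rewrite NE ?xt//; apply: eq_bigr => m _.
    rewrite indicE mem_setE in_itv /= (_ : (r m <= t - s) = (s <= t - r m)); last by lra.
    by case: (Z m w == l); rewrite ?mul1r ?mul0r.
under eq_bigr do rewrite LI; under [in RHS]eq_bigr do rewrite NI.
rewrite big_split /= -/(mean_count k t) addrCA; congr (_ + _).
rewrite exchange_big [in RHS]exchange_big /= NtE -big_split /=.
rewrite big_seq [in RHS]big_seq; apply: eq_bigr => m mJ.
rewrite [RHS](bigD1 (Z m w))//= eqxx mul1r [X in _ = _ + X]big1 ?addr0; last first.
  by move=> l; rewrite eq_sym => /negbTE ->; rewrite mul0r.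
by rewrite renewal subr_ge0 rt// andbT eq_sym.
Qed.

End cluster_representation.

(** * First moments *)

Section first_moments.
Context {disp : measure_display} {Omega : measurableType disp} {R : realType} {d : nat}.
Local Notation leb := (@lebesgue_measure R).
Variables (P : probability Omega R) (T : nat -> Omega -> \bar R) (Z : nat -> Omega -> 'I_d).
Variables (mu : 'cV[R]_d) (phi : R -> 'M[R]_d).
Hypothesis mpp : marked_point_process T Z.
Hypothesis mu0 : forall i, 0 <= mu i 0.
Hypothesis mphi : forall i j, measurable_fun `[(0 : R), +oo[ (fun t : R => phi t i j).
Hypothesis phi0 : forall i j t, 0 <= t -> 0 <= phi t i j.
Hypothesis phi_int : forall i j,
  (\int[leb]_(t in `[0%R, +oo[) (phi t i j)%:E < +oo)%E.
Hypothesis mart : forall n i, (1 <= n)%N -> martingale P (natural_filtration T Z)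
          (stopped_compensated T Z mu phi n i).
Hypothesis rho_lt1 : spectral_radius (branching_matrix phi) < 1.
Local Notation K := (branching_matrix phi).
Local Notation S := (invmx (1%:M - branching_matrix phi)).
Local Notation Ns := (stopped_count T Z).
Local Notation Ls := (stopped_compensator T Z mu phi).
Local Notation good := (nonexplosive T).
Local Notation N := (unstopped T Ns).
Local Notation L := (unstopped T Ls).

Lemma stopped_counting n : (1 <= n)%N ->
  compensated_counting P (natural_filtration T Z) (Ns n) (Ls n).
Proof.
move=> n1.
exact: (stopped_compensated_counting mpp mu0 mphi phi0 phi_int n1 (fun i => mart i n1)).
Qed.

Lemma stopped_count_bounded n k t : bounded_measurable (Ns n k t).
Proof.
split; first exact: (stopped_count_measurable mpp).
by exists n%:R => w; rewrite (ger0_norm (stopped_count_ge0 T Z n k t w)) stopped_count_le.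
Qed.

Lemma stopped_compensator_measurable n k t : (1 <= n)%N -> measurable_fun setT (Ls n k t).
Proof.
move=> n1; have := measurableT_comp (stopped_compensator_joint mu mpp mphi phi0 phi_int k n1)
   (@pair1_measurable _ _ R Omega t).
by [].
Qed.

Lemma stopped_compensator_bounded n k t : (1 <= n)%N -> bounded_measurable (Ls n k t).
Proof.
move=> n1; split; first exact: stopped_compensator_measurable.
by have [c cP] := c_L_bnd (stopped_counting n1) t; exists c => w.
Qed.

Lemma stopped_mean n k t : (1 <= n)%N -> \int[P]_w Ns n k t w = \int[P]_w Ls n k t w.
Proof.
move=> n1; apply/eqP; rewrite -subr_eq0 -Rint_sub//; last 2 first.
- exact: stopped_count_bounded.
- exact: stopped_compensator_bounded.
have z u : u <= 0 -> \int[P]_w (Ns n k u w - Ls n k u w) = 0.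
  move=> u0; rewrite /Rintegral integral0_eq// => w _.
  by rewrite (stopped_count_le0 mpp)// (stopped_compensator_le0 _ _ mpp)// subrr.
have [t0|/ltW/z->//] := leP 0 t.
apply/eqP; apply: eq_trans (z 0 (lexx 0)).
by apply: (c_mart (stopped_counting n1) k t0); exact: (@measurableT _ (g_sigma_algebraType _)).
Qed.

(** The vector [u] of means satisfies [u - K u <= mu t], because each jump adds at most its total
    offspring mass to the compensator. Applying [S], whose entries are nonnegative, preserves the
    inequality and gives a bound independent of [n]. *)
Lemma stopped_mean_le n k t : (1 <= n)%N -> 0 <= t ->
  \int[P]_w Ns n k t w <= (\sum_i S k i * mu i 0) * t.
Proof.
move=> n1 t0; pose u : 'cV[R]_d := \col_i \int[P]_w Ns n i t w.
have uP i : u i 0 = \int[P]_w Ns n i t w by rewrite mxE.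
have Hu i : u i 0 - \sum_j K i j * u j 0 <= mu i 0 * t.
  rewrite lerBlDr uP (stopped_mean i t n1).
  have -> : mu i 0 * t + \sum_j K i j * u j 0 =
      \int[P]_w (mu i 0 * t + \sum_j K i j * Ns n j t w).
    rewrite Rint_add; last 2 first.
    - exact: bounded_measurable_cst.
    - by apply: bounded_measurable_sum => j _; apply: bounded_measurableZ; exact: stopped_count_bounded.
    rewrite Rint_cst Rint_sum; last first.
      by move=> j _; apply: bounded_measurableZ; exact: stopped_count_bounded.
    congr (_ + _); apply: eq_bigr => j _; rewrite uP Rint_scale//.
    exact: stopped_count_bounded.
  apply: Rint_le => [||w].
  - exact: stopped_compensator_bounded.
  - apply: bounded_measurableD; first exact: bounded_measurable_cst.
    by apply: bounded_measurable_sum => j _; apply: bounded_measurableZ; exact: stopped_count_bounded.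
  - have := stopped_compensator_le mpp mu0 mphi phi0 phi_int i t w n1.
    by rewrite max_l.
have uE : u = S *m (u - K *m u).
  by rewrite -{2}[u]mul1mx -mulmxBl mulKmx// resolvent_unit.
rewrite -uP.
rewrite uE mxE mulr_suml; apply: ler_sum => i _; rewrite -mulrA ler_wpM2l//.
  exact: (resolvent_ge0 mphi phi0 phi_int rho_lt1).
by rewrite mxE [in X in _ + X]mxE [in X in _ + X]mxE; exact: Hu.
Qed.

(** Markov's inequality: if all jump times are at most [m], the process stopped at jump [n.+1] has
    counted [n.+1] jumps by time [m], while its mean stays below [C * m] for every [n]. *)
Lemma nonexplosive_ae : {ae P, forall w, good w}.
Proof.
pose B (m : nat) : set Omega := \bigcap_n [set w | (T n.+1 w <= m%:R%:E)%E].
have mTn n (m : nat) : measurable [set w | (T n.+1 w <= m%:R%:E)%E].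
  have := emeasurable_fun_infty_c measurableT (T_measurable mpp (ltn0Sn n)) (m%:R%:E).
  by rewrite setTI.
have mB m : measurable (B m) by apply: bigcapT_measurable.
pose C := \sum_k \sum_i S k i * mu i 0.
have BC m n : (n.+1%:R%:E * P (B m) <= (C * m%:R)%:E)%E.
  pose A := [set w | (T n.+1 w <= m%:R%:E)%E].
  apply: (@le_trans _ _ (n.+1%:R%:E * P A)%E).
    rewrite lee_wpmul2l// le_measure ?inE//; first exact: mTn.
    by move=> w /(_ n I).
  have bA : bounded_measurable (\1_A : Omega -> R).
    split; first by apply: measurable_indic; exact: mTn.
    by exists 1 => w; rewrite indicE ger0_norm// lern1 leq_b1.
  have -> : (n.+1%:R%:E * P A = (\int[P]_w (n.+1%:R * \1_A w))%:E)%E.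
    rewrite Rint_scale// EFinM; congr (_ * _)%E; rewrite Rint_EFin//.
    by rewrite integral_indic ?setIT//; exact: mTn.
  rewrite lee_fin; apply: (@le_trans _ _ (\int[P]_w (\sum_k Ns n.+1 k m%:R w))).
    apply: Rint_le => [||w].
    - exact: bounded_measurableZ.
    - by apply: bounded_measurable_sum => k _; exact: stopped_count_bounded.
    rewrite indicE; have [/set_mem wA|_] := boolP (w \in A); last first.
      by rewrite mulr0 sumr_ge0// => k _; exact: stopped_count_ge0.
    rewrite mulr1 stopped_count_sum.
    rewrite (eq_big_nat _ _ (F2 := fun => 1)); last first.
      by move=> j /andP[j1 jn]; rewrite (le_trans (T_mono mpp w j1 _) wA).
    by rewrite sumr_const_nat subn1.
  rewrite Rint_sum; last by move=> k _; exact: stopped_count_bounded.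
  by rewrite /C mulr_suml; apply: ler_sum => k _; exact: stopped_mean_le.
have PB m : P (B m) = 0%E.
  apply/eqP; rewrite -measure_le0; apply/lee_addgt0Pr => e e0; rewrite add0e.
  have [n nP] : exists n : nat, C * m%:R / e < n.+1%:R.
    by exists (Num.truncn (C * m%:R / e)); exact: truncnS_gt.
  have fB : P (B m) \is a fin_num by exact: fin_num_measure.
  have := BC m n; rewrite -(fineK fB) -EFinM !lee_fin => H.
  move: nP; rewrite ltr_pdivrMr// => nP.
  suff : (P (B m) <= e%:E)%E by [].
  by rewrite -(fineK fB) lee_fin -(ler_pM2l (ltr0Sn R n)) (le_trans H)// ltW.
exists (\bigcup_m B m); split.
- exact: bigcupT_measurable.
- apply: measure_negligible; first exact: bigcupT_measurable.
  apply: negligible_bigcup => m; exists (B m); split; [exact: mB|exact: PB|by []].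
- move=> w /= ngw; apply: contrapT => H; apply: ngw => m.
  apply: contrapT => Hm; apply: H; exists m => // n _ /=.
  by rewrite leNgt; apply/negP => mT; apply: Hm; exists n.+1.
Qed.

(** Monotone convergence in the stopping index for both processes, starting from the equality of
    means of the stopped ones. *)
Lemma unstopped_mean k t :
  (\int[P]_w (N k t w)%:E = \int[P]_w (L k t w)%:E)%E /\
  (\int[P]_w (N k t w)%:E <= ((\sum_i S k i * mu i 0) * Num.max t 0)%:E)%E.
Proof.
have S0 : 0 <= \sum_i S k i * mu i 0.
  by apply: sumr_ge0 => i _; rewrite mulr_ge0//; exact: (resolvent_ge0 mphi phi0 phi_int rho_lt1).
have [t0|/ltW t0] := leP 0 t; last first.
  have z (u : R -> Omega -> R) : (forall w, u t w = 0) -> (\int[P]_w (u t w)%:E = 0)%E.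
    by move=> uz; rewrite integral0_eq// => w _; rewrite uz.
  rewrite !z; first by split; rewrite ?lee_fin ?mulr0.
  - by move=> w; have [_ ->] := unstopped_le0 mu phi mpp k w t0.
  - by move=> w; have [-> _] := unstopped_le0 mu phi mpp k w t0.
have mct (u : nat -> Omega -> R) (v : Omega -> R) : (forall n, measurable_fun setT (u n)) ->
    measurable_fun setT v -> (forall n w, 0 <= u n w) ->
    (forall w m n, (m <= n)%N -> u m w <= u n w) ->
    (forall w, good w -> exists n0, forall n, (n0 <= n)%N -> v w = u n w) ->
    (\int[P]_w (v w)%:E = limn (fun n => \int[P]_w (u n w)%:E))%E.
  move=> mu' mv u0 uh uv; rewrite -(monotone_convergence P measurableT)//; last 3 first.
  - by move=> n; apply/measurable_EFinP.
  - by move=> n w _; rewrite lee_fin.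
  - by move=> w _ m n mn; rewrite lee_fin; exact: uh.
  apply: ae_eq_integral => //.
  - exact/measurable_EFinP.
  - apply: (emeasurable_fun_cvg (fun n w => (u n w)%:E)) => [n|w _].
      exact/measurable_EFinP.
    by apply: ereal_nondecreasing_is_cvgn => m n mn; rewrite lee_fin; exact: uh.
  apply: filterS nonexplosive_ae => w gw _ /=; have [n0 H] := uv w gw.
  apply/esym/cvg_lim => //; apply: cvg_near_cst; exists n0 => // n /= n0n.
  by rewrite (H n n0n).
have joint1 (f : R * Omega -> R) : measurable_fun setT f -> measurable_fun setT (fun w => f (t, w)).
  move=> mf; have := measurableT_comp mf (@pair1_measurable _ _ R Omega t).
  by [].
have NE : (\int[P]_w (N k t w)%:E = limn (fun n => \int[P]_w (Ns n.+1 k t w)%:E))%E.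
  apply: mct.
  - by move=> n; case: (stopped_count_bounded n.+1 k t).
  - exact: (joint1 (fun z => N k z.1 z.2) (unstopped_count_joint mu phi mpp k)).
  - by move=> n w; exact: stopped_count_ge0.
  - by move=> w m n mn; exact: stopped_count_incr_index.
  - move=> w gw; have [n0 H] := unstopped_eventually mu phi mpp t gw.
    by exists n0 => n n0n; have [->] := H n n0n k t (lexx t).
have LE : (\int[P]_w (L k t w)%:E = limn (fun n => \int[P]_w (Ls n.+1 k t w)%:E))%E.
  apply: mct.
  - by move=> n; exact: stopped_compensator_measurable.
  - exact: (joint1 (fun z => L k z.1 z.2) (unstopped_compensator_joint mu mpp mphi phi0 phi_int k)).
  - by move=> n w; exact: (stopped_compensator_ge0 T Z mu0 mphi phi0 phi_int).
  - by move=> w m n mn; exact: (stopped_compensator_incr_index mpp mu0 mphi phi0 phi_int).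
  - move=> w gw; have [n0 H] := unstopped_eventually mu phi mpp t gw.
    by exists n0 => n n0n; have [_ ->] := H n n0n k t (lexx t).
split.
  rewrite NE LE; congr (limn _); apply/funext => n.
  rewrite -!Rint_EFin; last 2 first.
  - exact: stopped_compensator_bounded.
  - exact: stopped_count_bounded.
  by rewrite stopped_mean.
rewrite NE; apply: lime_le.
  apply: ereal_nondecreasing_is_cvgn => m n mn; apply: ge0_le_integral => //.
  - by move=> w _; rewrite lee_fin stopped_count_ge0.
  - by apply/measurable_EFinP; case: (stopped_count_bounded m.+1 k t).
  - by apply/measurable_EFinP; case: (stopped_count_bounded n.+1 k t).
  - by move=> w _; rewrite lee_fin stopped_count_incr_index.
apply: nearW => n; rewrite -Rint_EFin; last exact: stopped_count_bounded.
by rewrite lee_fin stopped_mean_le.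
Qed.

End first_moments.

(** * Second moments *)

(* [Ns n] and [Ls n] are the processes stopped at the [n]-th jump, [N] and [L]
   their limits. *)
Record cluster_system disp (Omega : measurableType disp) (R : realType) (d : nat)
    (P : probability Omega R) (mu : 'cV[R]_d)
    (kap : 'I_d -> 'I_d -> {finite_measure set R -> \bar R})
    (F : R -> set (set Omega)) (Ns Ls : nat -> 'I_d -> R -> Omega -> R)
    (N L : 'I_d -> R -> Omega -> R) : Prop := ClusterSystem {
  s_mu : forall i, 0 <= mu i 0 ;
  s_neg : forall i j, kap i j `]-oo, (0 : R)[%classic = 0%E ;
  s_stopped : forall n, compensated_counting P F (Ns n) (Ls n) ;
  s_N_meas : forall k, measurable_fun setT (fun z : R * Omega => N k z.1 z.2) ;
  s_L_meas : forall k, measurable_fun setT (fun z : R * Omega => L k z.1 z.2) ;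
  s_N_mono : forall k s t w, s <= t -> N k s w <= N k t w ;
  s_L_mono : forall k s t w, s <= t -> L k s w <= L k t w ;
  s_N_le0 : forall k t w, t <= 0 -> N k t w = 0 ;
  s_L_le0 : forall k t w, t <= 0 -> L k t w = 0 ;
  s_limit : {ae P, forall w, forall t0, exists n0, forall n, (n0 <= n)%N -> forall k t, t <= t0 ->
    Ns n k t w = N k t w /\ Ls n k t w = L k t w} ;
  s_incr : {ae P, forall w, forall n k s t, s <= t ->
    Ns n k t w - Ns n k s w <= N k t w - N k s w /\
    Ls n k t w - Ls n k s w <= L k t w - L k s w} ;
  s_identity : {ae P, forall w, forall k t,
    N k t w + \sum_l \int[kap k l]_s L l (t - s) w =
    mean_count mu kap k t + \sum_l \int[kap k l]_s N l (t - s) w} ;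
  s_mean : forall k t, (\int[P]_w (N k t w)%:E = \int[P]_w (L k t w)%:E)%E ;
  s_mean_le : exists c, forall k t, (\int[P]_w (N k t w)%:E <= (c * Num.max t 0)%:E)%E
}.

Section cluster_system_theory.
Context {disp : measure_display} {Omega : measurableType disp} {R : realType} {d : nat}.
Variables (P : probability Omega R) (mu : 'cV[R]_d).
Variable kap : 'I_d -> 'I_d -> {finite_measure set R -> \bar R}.
Variables (F : R -> set (set Omega)) (Ns Ls : nat -> 'I_d -> R -> Omega -> R).
Variables (N L : 'I_d -> R -> Omega -> R).
Hypothesis H : cluster_system P mu kap F Ns Ls N L.
Local Notation m := (mean_count mu kap).

Lemma N_ge0 k t w : 0 <= N k t w.
Proof.
have [t0|/ltW t0] := leP 0 t; last by rewrite (s_N_le0 H).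
by rewrite -(s_N_le0 H k w (lexx 0)); exact: (s_N_mono H).
Qed.

Lemma L_ge0 k t w : 0 <= L k t w.
Proof.
have [t0|/ltW t0] := leP 0 t; last by rewrite (s_L_le0 H).
by rewrite -(s_L_le0 H k w (lexx 0)); exact: (s_L_mono H).
Qed.

Section one_process.
Variable G : 'I_d -> R -> Omega -> R.
Hypothesis G_meas : forall k, measurable_fun setT (fun z : R * Omega => G k z.1 z.2).
Hypothesis G_mono : forall k s t w, s <= t -> G k s w <= G k t w.
Hypothesis G_ge0 : forall k t w, 0 <= G k t w.

Lemma lagged_joint l t : measurable_fun setT (fun z : R * Omega => G l (t - z.1) z.2).
Proof.
apply: (measurableT_comp (f := fun z : R * Omega => G l z.1 z.2) (G_meas l)
  (g := fun z : R * Omega => (t - z.1, z.2))).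
apply: measurable_fun_pair; last exact: measurable_snd.
by apply: measurable_funB; [exact: measurable_cst|exact: measurable_fst].
Qed.

Lemma lagged_path_measurable l t w : measurable_fun setT (fun s : R => G l (t - s) w).
Proof. by have := measurable_fun_pair1 w (lagged_joint l t). Qed.

Lemma lagged_path_integrable k l t w :
  (kap k l).-integrable setT (EFin \o (fun s : R => G l (t - s) w)).
Proof.
apply: (halfline_integrable (s_neg H k l) (c := G l t w)) => [|s s0].
  exact: lagged_path_measurable.
by rewrite ger0_norm// G_mono// gerBl.
Qed.

Lemma state_measurable l t : measurable_fun setT (G l t).
Proof. by have := measurable_fun_pair2 t (G_meas l). Qed.

Let g l t (z : R * Omega) : \bar R := (G l (t - z.1) z.2)%:E.
Let mg l t : measurable_fun setT (g l t).
Proof. by apply/measurable_EFinP; exact: lagged_joint. Qed.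
Let g0 l t z : (0 <= g l t z)%E.
Proof. by rewrite lee_fin. Qed.

Lemma cluster_sum_measurable k t :
  measurable_fun setT (fun w => (\sum_l \int[kap k l]_s (G l (t - s) w)%:E)%E).
Proof.
apply: emeasurable_sum => l.
exact: (@measurable_fun_fubini_tonelli_G _ _ _ _ R (kap k l) (g l t) (mg l t) (g0 l t)).
Qed.

Lemma cluster_sum_integral k t :
  (\int[P]_w (\sum_l \int[kap k l]_s (G l (t - s) w)%:E) =
   \sum_l \int[kap k l]_s \int[P]_w (G l (t - s) w)%:E)%E.
Proof.
rewrite ge0_integral_sum//; last 2 first.
- by move=> l; exact: (@measurable_fun_fubini_tonelli_G _ _ _ _ R (kap k l) (g l t) (mg l t) (g0 l t)).
- by move=> l w _; apply: integral_ge0 => s _; rewrite lee_fin.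
apply: eq_bigr => l _.
by rewrite -(@fubini_tonelli _ _ R Omega R (kap k l) P (g l t) (mg l t) (g0 l t)).
Qed.

Lemma expectation_lagged_measurable l t :
  measurable_fun setT (fun s : R => (\int[P]_w (G l (t - s) w)%:E)%E).
Proof.
exact: (@measurable_fun_fubini_tonelli_F _ _ _ _ R P (g l t) (mg l t) (g0 l t)).
Qed.

Lemma cluster_sum_EFin k t w :
  (\sum_l \int[kap k l]_s (G l (t - s) w)%:E =
   (\sum_l \int[kap k l]_s G l (t - s) w)%:E)%E.
Proof.
rewrite -sumEFin; apply: eq_bigr => l _; rewrite /Rintegral fineK//.
by apply: integrable_fin_num => //; exact: lagged_path_integrable.
Qed.

End one_process.

Let ramp_integrable k l t : (kap k l).-integrable setT (EFin \o (fun s : R => Num.max (t - s) 0)).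
Proof.
apply: (halfline_integrable (s_neg H k l) (c := Num.max t 0)) => [|s s0].
  exact: ramp_measurable.
by have /andP[r0 r1] := ramp_le t s0; rewrite ger0_norm.
Qed.

Lemma mean_count_ge0 k t : 0 <= m k t.
Proof.
apply: sumr_ge0 => l _; apply: mulr_ge0; first exact: (s_mu H).
by apply: Rintegral_ge0 => s _; rewrite le_max lexx orbT.
Qed.

(** Expectations are taken in [s_identity]. The kernel terms have the same expectation because N and
    L have equal means, and the linear growth [s_mean_le] makes it finite, hence cancellable. *)
Lemma expected_count k t : (\int[P]_w (N k t w)%:E = (m k t)%:E)%E.
Proof.
pose B (G : 'I_d -> R -> Omega -> R) := (\sum_l \int[kap k l]_s \int[P]_w (G l (t - s) w)%:E)%E.
have BNL : B L = B N.
  by apply: eq_bigr => l _; apply: eq_integral => s _; exact/esym/(s_mean H).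
have Bfin : B N \is a fin_num.
  rewrite ge0_fin_numE; last first.
    apply: sume_ge0 => l _; apply: integral_ge0 => s _; apply: integral_ge0 => w _.
    by rewrite lee_fin N_ge0.
  have [c cP] := s_mean_le H.
  apply: lte_sum_pinfty => l _.
  have ir : (kap k l).-integrable setT (EFin \o (fun s : R => `|c| * Num.max (t - s) 0)).
    have := integrableZl measurableT `|c| (ramp_integrable k l t).
    by congr (_.-integrable _ _); apply/funext => s /=; rewrite EFinM.
  have := integrable_lty measurableT ir; apply: le_lt_trans.
  apply: ge0_le_integral => //.
  - by move=> s _; apply: integral_ge0 => w _; rewrite lee_fin N_ge0.
  - exact: (expectation_lagged_measurable (s_N_meas H) N_ge0).
  - apply/measurable_EFinP; apply: measurable_funM; first exact: measurable_cst.
    exact: ramp_measurable.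
  - move=> s _; apply: le_trans (cP l (t - s)) _; rewrite lee_fin ler_wpM2r//.
      by rewrite le_max lexx orbT.
    exact: ler_norm.
have mNt : measurable_fun setT (fun w => (N k t w)%:E).
  by apply/measurable_EFinP; exact: (state_measurable (s_N_meas H)).
have cE : (m k t)%:E = (\int[P]_w (m k t)%:E)%E.
  rewrite -Rint_EFin ?Rint_cst//; exact: bounded_measurable_cst.
have mN := cluster_sum_measurable (s_N_meas H) N_ge0 k t.
have mL := cluster_sum_measurable (s_L_meas H) L_ge0 k t.
have G0 (G : 'I_d -> R -> Omega -> R) : (forall l x w, 0 <= G l x w) ->
    forall w, (0 <= \sum_l \int[kap k l]_s (G l (t - s) w)%:E)%E.
  by move=> Gp w; apply: sume_ge0 => l _; apply: integral_ge0 => s _; rewrite lee_fin.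
have : (\int[P]_w (N k t w)%:E + B L = (m k t)%:E + B N)%E.
  rewrite /B -(cluster_sum_integral (s_L_meas H) L_ge0) -(cluster_sum_integral (s_N_meas H) N_ge0) cE.
  rewrite -ge0_integralD//; last 2 first.
  - by move=> w _; rewrite lee_fin N_ge0.
  - by move=> w _; apply: G0; exact: L_ge0.
  rewrite -ge0_integralD//; last 2 first.
  - by move=> w _; rewrite lee_fin mean_count_ge0.
  - by move=> w _; apply: G0; exact: N_ge0.
  apply: ae_eq_integral => //.
  - exact: emeasurable_funD.
  - by apply: emeasurable_funD => //; exact: measurable_cst.
  apply: filterS (s_identity H) => w Hw _ /=.
  rewrite (cluster_sum_EFin (s_L_meas H) (s_L_mono H) L_ge0).
  by rewrite (cluster_sum_EFin (s_N_meas H) (s_N_mono H) N_ge0) -!EFinD Hw.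
rewrite BNL => /(congr1 (fun x => x - B N)%E).
by rewrite !addeK.
Qed.

Lemma centered_count : {ae P, forall w, forall k t,
  N k t w - m k t = \sum_l \int[kap k l]_s (N l (t - s) w - L l (t - s) w)}.
Proof.
apply: filterS (s_identity H) => w Hw k t; have := Hw k t.
have E l : \int[kap k l]_s (N l (t - s) w - L l (t - s) w) =
    \int[kap k l]_s N l (t - s) w - \int[kap k l]_s L l (t - s) w.
  rewrite RintegralB//.
    exact: (lagged_path_integrable (s_N_meas H) (s_N_mono H) N_ge0).
  exact: (lagged_path_integrable (s_L_meas H) (s_L_mono H) L_ge0).
rewrite (eq_bigr _ (fun l _ => E l)) sumrB.
set a := \sum_l _; set b := \sum_l _; lra.
Qed.

Lemma mean_count_incr k a b : a <= b ->
  0 <= m k b - m k a <= (\sum_l mu l 0 * fine (kap k l setT)) * (b - a).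
Proof.
move=> ab; rewrite -sumrB mulr_suml.
have Hl l : 0 <= \int[kap k l]_s Num.max (b - s) 0 - \int[kap k l]_s Num.max (a - s) 0 <=
    fine (kap k l setT) * (b - a).
  rewrite -RintegralB; try exact: ramp_integrable; last exact: measurableT.
  have ri : forall s : R, 0 <= Num.max (b - s) 0 - Num.max (a - s) 0 <= b - a.
    by move=> s; case: (leP (b - s) 0) => ?; case: (leP (a - s) 0) => ?; lra.
  have br : bounded_measurable (fun s : R => Num.max (b - s) 0 - Num.max (a - s) 0).
    split; first by apply: measurable_funB; exact: ramp_measurable.
    by exists (b - a) => s; have /andP[r0 r1] := ri s; rewrite ger0_norm.
  apply/andP; split; first by apply: Rintegral_ge0 => s _; have /andP[] := ri s.
  have -> : fine (kap k l setT) * (b - a) = \int[kap k l]_s (b - a).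
    by rewrite mulrC; apply/esym; exact: Rintegral_cst.
  apply: Rint_le => // [|s]; first exact: bounded_measurable_cst.
  by have /andP[] := ri s.
apply/andP; split.
  apply: sumr_ge0 => l _; rewrite -mulrBr mulr_ge0 ?(s_mu H)//.
  by have /andP[] := Hl l.
apply: ler_sum => l _; rewrite -mulrBr -mulrA ler_wpM2l ?(s_mu H)//.
by have /andP[] := Hl l.
Qed.

End cluster_system_theory.

Lemma L2_le_bounded d (Om : measurableType d) (R : realType) (P : probability Om R) (f : Om -> R) c :
  bounded_measurable f -> \int[P]_w (f w ^+ 2) <= c -> L2_le P f c.
Proof.
move=> bf fc; split; first by case: bf.
by rewrite -Rint_EFin ?lee_fin//; exact: bounded_measurableX.
Qed.

Lemma Rint_sqr_le_L2 d (Om : measurableType d) (R : realType) (P : probability Om R)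
    (f g : Om -> R) c : bounded_measurable f -> {ae P, forall w, `|f w| <= `|g w|} ->
  L2_le P g c -> \int[P]_w (f w ^+ 2) <= c.
Proof.
move=> bf fg [mg gc]; rewrite -lee_fin Rint_EFin; last exact: bounded_measurableX.
apply: le_trans gc; apply: ae_ge0_le_integral => //.
- by move=> w _; rewrite lee_fin sqr_ge0.
- by apply/measurable_EFinP; apply: measurable_funX; case: bf.
- by move=> w _; rewrite lee_fin sqr_ge0.
- by apply/measurable_EFinP; apply: measurable_funX.
- apply: filterS fg => w Hw _; rewrite lee_fin.
  by rewrite -(@real_normK _ (f w)) ?num_real// -(@real_normK _ (g w)) ?num_real// lerXn2r ?nnegrE.
Qed.

Section integrable_EFin.
Context d (S : measurableType d) (R : realType) (nu : {measure set S -> \bar R}).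
Implicit Types f g : S -> R.

Lemma integrable_EFinD f g : nu.-integrable setT (EFin \o f) -> nu.-integrable setT (EFin \o g) ->
  nu.-integrable setT (EFin \o (fun x => f x + g x)).
Proof. by move=> fi gi; have := integrableD measurableT fi gi. Qed.

Lemma integrable_EFinZ c f : nu.-integrable setT (EFin \o f) ->
  nu.-integrable setT (EFin \o (fun x => c * f x)).
Proof.
move=> fi; have := integrableZl measurableT c fi.
by congr (_.-integrable _ _); apply/funext => s /=; rewrite EFinM.
Qed.

Lemma integrable_EFinB f g : nu.-integrable setT (EFin \o f) -> nu.-integrable setT (EFin \o g) ->
  nu.-integrable setT (EFin \o (fun x => f x - g x)).
Proof.
move=> fi /(integrable_EFinZ (-1)) /(integrable_EFinD fi).
by under eq_fun do rewrite mulN1r.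
Qed.

Lemma integrable_EFin_sum (I : Type) (r : seq I) (p : pred I) (f : I -> S -> R) :
  (forall i, nu.-integrable setT (EFin \o f i)) ->
  nu.-integrable setT (EFin \o (fun x => \sum_(i <- r | p i) f i x)).
Proof.
move=> fi; elim: r => [|i r IH].
  by under eq_fun do rewrite big_nil; exact: integrable0.
rewrite (_ : (fun x => _) = (fun x => if p i then f i x + \sum_(j <- r | p j) f j x
    else \sum_(j <- r | p j) f j x)); last by apply/funext => x; rewrite big_cons.
by case: (p i) => //; exact: integrable_EFinD.
Qed.

Lemma Rintegral_sum (I : Type) (r : seq I) (p : pred I) (f : I -> S -> R) :
  (forall i, nu.-integrable setT (EFin \o f i)) ->
  \int[nu]_x (\sum_(i <- r | p i) f i x) = \sum_(i <- r | p i) \int[nu]_x f i x.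
Proof.
move=> fi; elim: r => [|i r IH].
  rewrite big_nil; under eq_Rintegral do rewrite big_nil.
  by rewrite /Rintegral integral0.
rewrite big_cons; under eq_Rintegral do rewrite big_cons.
case: (p i) => //; rewrite -IH RintegralD//; exact: integrable_EFin_sum.
Qed.

End integrable_EFin.

(** * Moment bounds uniform in the stopping index *)

Section moments.
Context {disp : measure_display} {Omega : measurableType disp} {R : realType} {d : nat}.
Variables (P : probability Omega R) (mu : 'cV[R]_d).
Variable kap : 'I_d -> 'I_d -> {finite_measure set R -> \bar R}.
Variables (F : R -> set (set Omega)) (Ns Ls : nat -> 'I_d -> R -> Omega -> R).
Variables (N L : 'I_d -> R -> Omega -> R).
Hypothesis H : cluster_system P mu kap F Ns Ls N L.
Local Notation m := (mean_count mu kap).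
Local Notation mass k l := (fine (kap k l setT)).

Definition rate_bound : R := \sum_k \sum_l mu l 0 * mass k l.

Let mass0 k l : 0 <= mass k l. Proof. by rewrite fine_ge0. Qed.

Lemma rate_bound_ge0 : 0 <= rate_bound.
Proof. by apply: sumr_ge0 => k _; apply: sumr_ge0 => l _; rewrite mulr_ge0 ?(s_mu H). Qed.

Lemma mean_count_le k a b : a <= b -> 0 <= m k b - m k a <= rate_bound * (b - a).
Proof.
move=> ab; have /andP[-> Hm] /= := mean_count_incr H k ab.
apply: le_trans Hm _; rewrite ler_wpM2r ?subr_ge0//.
rewrite /rate_bound [leRHS](bigD1 k)//= lerDl; apply: sumr_ge0 => j _.
by apply: sumr_ge0 => l _; rewrite mulr_ge0 ?(s_mu H).
Qed.

Let mN k t : measurable_fun setT (N k t).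
Proof. exact: (state_measurable (s_N_meas H)). Qed.
Let mL k t : measurable_fun setT (L k t).
Proof. exact: (state_measurable (s_L_meas H)). Qed.
Let mM k t : measurable_fun setT (fun w => N k t w - L k t w).
Proof. exact: measurable_funB. Qed.

Lemma stopped_expected_incr n k a b : a <= b ->
  \int[P]_w (Ns n k b w - Ns n k a w) <= rate_bound * (b - a).
Proof.
move=> ab; have /andP[_ Hm] := mean_count_le k ab; apply: le_trans Hm.
have bD := dN_bounded (s_stopped H n) k a b.
rewrite -lee_fin Rint_EFin//.
have iN t : P.-integrable setT (EFin \o N k t).
  apply/integrableP; split; first exact/measurable_EFinP.
  under eq_integral do rewrite /= ger0_norm ?(N_ge0 H)//.
  by rewrite (expected_count H) ltry.
have -> : ((m k b - m k a)%:E = \int[P]_w (N k b w - N k a w)%:E)%E.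
  rewrite EFinB -!(expected_count H) -integralB//; exact: iN.
apply: ae_ge0_le_integral => //.
- by move=> w _; rewrite lee_fin subr_ge0 (c_N_mono (s_stopped H n)).
- by apply/measurable_EFinP; case: bD.
- by move=> w _; rewrite lee_fin subr_ge0 (s_N_mono H).
- by apply/measurable_EFinP; apply: measurable_funB.
- by apply: filterS (s_incr H) => w Hw _; rewrite lee_fin; have [] := Hw n k a b ab.
Qed.

Let eventually_sum (x y : nat -> R) q : exists t0, forall p : 'I_q, x p <= t0 /\ y p <= t0.
Proof.
exists (\sum_(p < q) (`|x p| + `|y p|)) => p; rewrite (bigD1 p)//=.
have r0 : 0 <= \sum_(i < q | i != p) (`|x i| + `|y i|) by apply: sumr_ge0 => i _; rewrite addr_ge0.
have := ler_norm (x p); have := ler_norm (y p).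
by have := normr_ge0 (x p); have := normr_ge0 (y p); split; lra.
Qed.

(** For the stopped processes the second moment is the expected number of jumps in the intervals,
    which is at most that of the unstopped process. The bound does not involve [n], so Fatou
    applies. *)
Lemma L2_M_sum k (x y : nat -> R) q : (forall p, x p <= y p) -> (forall p, y p <= x p.+1) ->
  L2_le P (fun w => \sum_(p < q) ((N k (y p) w - L k (y p) w) - (N k (x p) w - L k (x p) w)))
    (rate_bound * \sum_(p < q) (y p - x p)).
Proof.
move=> xy yx.
apply: (@L2_le_fatou _ _ _ _ (fun n w => \sum_(p < q)
  ((Ns n k (y p) w - Ls n k (y p) w) - (Ns n k (x p) w - Ls n k (x p) w)))).
- by apply: measurable_sum => p; apply: measurable_funB.
- move=> n; apply: L2_le_bounded.
    by apply: bounded_measurable_sum => p _; exact: (dM_bounded (s_stopped H n)).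
  rewrite (M_sum_sqr (s_stopped H n) k q xy yx) mulr_sumr; apply: ler_sum => p _.
  exact: stopped_expected_incr.
- apply: filterS (s_limit H) => w Hw.
  have [t0 t0P] := eventually_sum x y q; have [n0 n0P] := Hw t0.
  exists n0 => n n0n; apply: eq_bigr => p _; have [xt yt] := t0P p.
  by have [-> ->] := n0P n n0n k _ xt; have [-> ->] := n0P n n0n k _ yt.
Qed.

Lemma L2_M k a b : a <= b ->
  L2_le P (fun w => (N k b w - L k b w) - (N k a w - L k a w)) (rate_bound * (b - a)).
Proof.
move=> ab; have := @L2_M_sum k (fun p => if p is 0%N then a else b) (fun=> b) 1.
rewrite big_ord1 /=; under eq_fun do rewrite big_ord1.
by apply; case.
Qed.

(** The factor [d] comes from the sum over marks, [mass + 1] from Cauchy-Schwarz in the shift, the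
    rest from integrating the bound of [L2_M_sum]. Summing over [k] makes it the same for all
    marks. *)
Definition centered_bound : R :=
  d%:R * \sum_k \sum_l (mass k l + 1) * (rate_bound * mass k l).

(** The centered process is a mixture of shifts of M. A shift keeps the intervals ordered and their
    total length unchanged, so the bound for M is uniform in the shift. *)
Lemma L2_centered_sum k (x y : nat -> R) q : (forall p, x p <= y p) -> (forall p, y p <= x p.+1) ->
  L2_le P (fun w => \sum_(p < q) ((N k (y p) w - m k (y p)) - (N k (x p) w - m k (x p))))
    (centered_bound * \sum_(p < q) (y p - x p)).
Proof.
move=> xy yx; set W := \sum_(p < q) (y p - x p).
have W0 : 0 <= W by apply: sumr_ge0 => p _; rewrite subr_ge0.
pose D l (s : R) w := \sum_(p < q) ((N l (y p - s) w - L l (y p - s) w) - (N l (x p - s) w - L l (x p - s) w)).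
have jM l t : measurable_fun setT (fun z : R * Omega => N l (t - z.1) z.2 - L l (t - z.1) z.2).
  apply: measurable_funB; first exact: (lagged_joint (s_N_meas H)).
  exact: (lagged_joint (s_L_meas H)).
have mD l : measurable_fun setT (fun z : R * Omega => D l z.1 z.2).
  by apply: measurable_sum => p; apply: measurable_funB; exact: jM.
have LD l : L2_le P (fun w => \int[kap k l]_s D l s w) ((mass k l + 1) * (rate_bound * W * mass k l)).
  apply: (@L2_le_mixture _ _ _ _ _ _ (kap k l) (D l) (cst (rate_bound * W))) => //.
  - move=> s; have := @L2_M_sum l (fun p => x p - s) (fun p => y p - s) q.
    have -> : \sum_(p < q) (y p - s - (x p - s)) = W by apply: eq_bigr => p _; ring.
    by apply=> p; rewrite lerD2r.
  - by rewrite ltr_wpDl.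
  - by rewrite -[leLHS]fineK ?fin_num_measure// lee_fin lerDl.
  - rewrite (_ : (fun s => _) = cst (rate_bound * W)%:E)// integral_cst//.
    by rewrite -[X in (_ * X)%E]fineK ?fin_num_measure// -EFinM lee_fin.
have := L2_le_sum LD; rewrite card_ord => LS.
apply: (@L2_le_ae _ _ _ _ (fun w => \sum_l \int[kap k l]_s D l s w)); last first.
- apply: L2_le_weaken LS; rewrite /centered_bound -mulrA ler_wpM2l// [leRHS]mulr_suml.
  rewrite [X in _ <= X](bigD1 k)//= -[X in X <= _]addr0; apply: lerD.
    by rewrite [X in _ <= X]mulr_suml; apply: ler_sum => l _; rewrite le_eqVlt; apply/orP; left; apply/eqP; ring.
  apply: sumr_ge0 => j _; rewrite mulr_ge0//; apply: sumr_ge0 => l _.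
  by rewrite mulr_ge0 ?addr_ge0// mulr_ge0// rate_bound_ge0.
- apply: filterS (centered_count H) => w Hw.
  have iM l t : (kap k l).-integrable setT (EFin \o (fun s : R => N l (t - s) w - L l (t - s) w)).
    apply: integrable_EFinB.
      exact: (lagged_path_integrable H (s_N_meas H) (s_N_mono H) (N_ge0 H)).
    exact: (lagged_path_integrable H (s_L_meas H) (s_L_mono H) (L_ge0 H)).
  under [RHS]eq_bigr do rewrite !Hw -sumrB.
  rewrite exchange_big; apply: eq_bigr => l _.
  rewrite /D Rintegral_sum => [|p]; last by apply: integrable_EFinB; exact: iM.
  by apply: eq_bigr => p _; rewrite RintegralB//; exact: iM.
- by apply: measurable_sum => p; apply: measurable_funB; apply: measurable_funB => //; exact: measurable_cst.
Qed.


Definition count_bound : R := 2 * (centered_bound + rate_bound ^+ 2).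

Lemma centered_bound_ge0 : 0 <= centered_bound.
Proof.
rewrite /centered_bound mulr_ge0// sumr_ge0// => k _; rewrite sumr_ge0// => l _.
by rewrite mulr_ge0 ?addr_ge0// mulr_ge0// rate_bound_ge0.
Qed.

(** The centered part contributes linearly in the length, the increment of the mean
    quadratically. *)
Lemma L2_N k a b : a <= b ->
  L2_le P (fun w => N k b w - N k a w) (count_bound * ((b - a) + (b - a) ^+ 2)).
Proof.
move=> ab.
have := @L2_centered_sum k (fun p => if p is 0%N then a else b) (fun=> b) 1.
rewrite big_ord1 /=; under eq_fun do rewrite big_ord1.
move=> /(_ _ _)/wrap[]; [by case|by []|move=> LX].
have /andP[m0 m1] := mean_count_le k ab.
have := L2_leD LX (L2_le_cst P (m k b - m k a)).
have -> : (fun w => N k b w - m k b - (N k a w - m k a) + cst (m k b - m k a) w) =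
  (fun w => N k b w - N k a w) by apply/funext => w /=; ring.
apply: L2_le_weaken.
have : (m k b - m k a) ^+ 2 <= rate_bound ^+ 2 * (b - a) ^+ 2.
  by rewrite -exprMn lerXn2r// nnegrE mulr_ge0 ?rate_bound_ge0 ?subr_ge0.
have := centered_bound_ge0; have := sqr_ge0 rate_bound; have := sqr_ge0 (b - a).
have : 0 <= b - a by rewrite subr_ge0.
rewrite /count_bound; nra.
Qed.

Definition compensator_bound : R := 2 * (count_bound + rate_bound).

Lemma count_bound_ge0 : 0 <= count_bound.
Proof. by rewrite mulr_ge0// addr_ge0 ?centered_bound_ge0 ?sqr_ge0. Qed.

Lemma L2_L k a b : a <= b ->
  L2_le P (fun w => L k b w - L k a w) (compensator_bound * ((b - a) + (b - a) ^+ 2)).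
Proof.
move=> ab; have := L2_leB (L2_N k ab) (L2_M k ab).
have -> : (fun w => N k b w - N k a w - (N k b w - L k b w - (N k a w - L k a w))) =
  (fun w => L k b w - L k a w) by apply/funext => w /=; ring.
apply: L2_le_weaken; rewrite /compensator_bound.
have := rate_bound_ge0; have := sqr_ge0 (b - a); nra.
Qed.

(** The value [2 * c + 2 * c'] of [lagged_sum_sqr], with the constants 64 and 6 of [fourth_moment]
    in [c] and the second moment of the counts as [c']. *)
Definition lagged_bound : R := 128 * compensator_bound + 12 * rate_bound + 2 * count_bound.

Lemma compensator_bound_ge0 : 0 <= compensator_bound.
Proof. exact: mulr_ge0 (ler0n _ 2) (addr_ge0 count_bound_ge0 rate_bound_ge0). Qed.

Lemma lagged_bound_ge0 : 0 <= lagged_bound.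
Proof.
have := compensator_bound_ge0; have := count_bound_ge0; have := rate_bound_ge0.
by rewrite /lagged_bound; move: compensator_bound count_bound rate_bound => x y z *; lra.
Qed.

Lemma lagged_product_measurable k l h a b : measurable_fun setT (lagged_product N L k l h a b).
Proof.
apply: measurable_funB; first by apply: measurable_funM; exact: measurable_funB.
by apply: measurable_funM; [exact: measurable_cst|exact: measurable_funB].
Qed.

Lemma L2_lagged_sum k l h a D q : 0 <= h -> 0 <= D ->
  L2_le P (fun w => \sum_(p < q) lagged_product N L k l h (a + p%:R * D) (a + p%:R * D + D) w)
    (q%:R * (lagged_bound * (D + D ^+ 2))).
Proof.
move=> h0 D0.
apply: (@L2_le_fatou _ _ _ _ (fun n w => \sum_(p < q)
  lagged_product (Ns n) (Ls n) k l h (a + p%:R * D) (a + p%:R * D + D) w)).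
- by apply: measurable_sum => p; exact: lagged_product_measurable.
- move=> n; apply: L2_le_bounded.
    apply: bounded_measurable_sum => p _.
    apply: (ad_bounded_measurable (s_stopped H n) (t := a + p%:R * D + D + h)).
    by apply: (lagged_product_ad (s_stopped H n)) => //; rewrite lerDl.
  have bnd (x : R) : 0 <= x -> x <= D -> x + x ^+ 2 <= D + D ^+ 2 by move=> ? ?; nra.
  have DD : 0 <= D + D ^+ 2 by rewrite addr_ge0 ?sqr_ge0.
  (* The compensator of the stopped process is dominated by that of the unstopped one, whose second
     moment is [L2_L]; this is where uniformity in [n] is obtained. *)
  have M4 k' s : \int[P]_w (Ns n k' (s + D) w - Ls n k' (s + D) w - (Ns n k' s w - Ls n k' s w)) ^+ 4 <=
      (64 * compensator_bound + 6 * rate_bound) * (D + D ^+ 2).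
    have sD : s <= s + D by rewrite lerDl.
    have sDs : s + D - s = D by ring.
    apply: le_trans (fourth_moment (s_stopped H n) k' sD) _.
    have E : \int[P]_w (Ns n k' (s + D) w - Ns n k' s w) <= rate_bound * D.
      by have := stopped_expected_incr n k' sD; rewrite sDs.
    have E2 : \int[P]_w (Ls n k' (s + D) w - Ls n k' s w) ^+ 2 <= compensator_bound * (D + D ^+ 2).
      have := L2_L k' sD; rewrite sDs => LL.
      apply: Rint_sqr_le_L2 LL; first exact: (dL_bounded (s_stopped H n)).
      apply: filterS (s_incr H) => w Hw; have [_ L1] := Hw n k' s _ sD.
      have D1 : 0 <= Ls n k' (s + D) w - Ls n k' s w by rewrite subr_ge0 (c_L_mono (s_stopped H n)).
      by rewrite (ger0_norm D1) (ger0_norm (le_trans D1 L1)).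
    have := rate_bound_ge0; have := sqr_ge0 D; nra.
  have N2 k' s t : s <= t -> t <= s + D ->
      \int[P]_w (Ns n k' t w - Ns n k' s w) ^+ 2 <= count_bound * (D + D ^+ 2).
    move=> st tD; apply: le_trans (_ : count_bound * ((t - s) + (t - s) ^+ 2) <= _).
      apply: Rint_sqr_le_L2 (L2_N k' st); first exact: (dN_bounded (s_stopped H n)).
      apply: filterS (s_incr H) => w Hw; have [L1 _] := Hw n k' s t st.
      have D1 : 0 <= Ns n k' t w - Ns n k' s w by rewrite subr_ge0 (c_N_mono (s_stopped H n)).
      by rewrite (ger0_norm D1) (ger0_norm (le_trans D1 L1)).
    by rewrite ler_wpM2l ?count_bound_ge0// bnd; lra.
  apply: le_trans (lagged_sum_sqr (s_stopped H n) k l a q h0 D0 M4 N2) _.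
  by rewrite ler_wpM2l// /lagged_bound le_eqVlt; apply/orP; left; apply/eqP; ring.
- apply: filterS (s_limit H) => w Hw.
  have [t0 t0P] := eventually_sum (fun p => a + p%:R * D + D) (fun p => a + p%:R * D + D + h) q.
  have [n0 n0P] := Hw t0.
  exists n0 => n n0n; apply: eq_bigr => p _; have [xt yt] := t0P p.
  have E j t : t <= t0 -> Ns n j t w = N j t w by move=> tt; have [] := n0P n n0n j t tt.
  have E' j t : t <= t0 -> Ls n j t w = L j t w by move=> tt; have [] := n0P n n0n j t tt.
  have ht : a + p%:R * D + h <= t0 by lra.
  have at0 : a + p%:R * D <= t0 by lra.
  by rewrite /lagged_product !E ?E'//; try lra; rewrite ge_min ht.
Qed.

End moments.

(** * The error of one pair of shifts *)

Section pointwise_bracket.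
Context (R : realType).
Variables (D T h a : R) (n : nat).
Hypotheses (D0 : 0 < D) (T0 : 0 < T) (h0 : 0 <= h) (nT : n%:R * D <= T) (Tn : T <= n%:R * D + D).

(** The interval from [x p] to [y p] is the overlap of cell [p] with its translate by [h]; it is
    empty when [h] exceeds the cell. *)
Let x p := Num.min (a + p%:R * D + h) (a + p%:R * D + D).
Let y p := a + p%:R * D + D.

Lemma tent_width p : y p - x p = D * tent D h.
Proof.
rewrite /x /y /tent ger0_norm// maxr_pMr ?ltW// mulr0 mulrBr mulr1 mulrCA divff ?gt_eqF// mulr1.
by case: (leP (a + p%:R * D + h)) => ?; case: (leP (D - h) 0) => ?; lra.
Qed.

(** The length of the overlap lying before [r], a time before which points with delay [r] are still
    missing. *)
Let b r p := Num.min (y p) r - Num.min (x p) r.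

Let b_le r p : 0 <= b r p <= Num.min (a + p.+1%:R * D) r - Num.min (a + p%:R * D) r.
Proof.
have E : a + p.+1%:R * D = y p by rewrite /y -natr1; ring.
rewrite E /b.
have xy : x p <= y p by rewrite ge_min lexx orbT.
have ax : a + p%:R * D <= x p by rewrite le_min lerDl h0 lerDl ltW.
by move: (x p) (y p) xy ax => u v xy ax; case: (leP v r) => ?; case: (leP u r) => ?; case: (leP (a + _) r) => ?; lra.
Qed.

Let sum_b r : 0 <= \sum_(p < n) b r p <= Num.min T (`|r| + `|a|).
Proof.
apply/andP; split; first by apply: sumr_ge0 => p _; have /andP[] := b_le r p.
apply: (@le_trans _ _ (Num.min (a + n%:R * D) r - Num.min (a + 0%:R * D) r)).
  apply: (@le_trans _ _ (\sum_(p < n) (Num.min (a + p.+1%:R * D) r - Num.min (a + p%:R * D) r))).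
    by apply: ler_sum => p _; have /andP[] := b_le r p.
  by rewrite -(big_mkord xpredT (fun p => Num.min (a + p.+1%:R * D) r - Num.min (a + p%:R * D) r)) telescope_sumr.
rewrite mul0r addr0 le_min.
have n0 : 0 <= n%:R * D by rewrite mulr_ge0 ?ler0n ?ltW.
have := ler_norm r; have := ler_norm a; have := ler_norm (- r); have := ler_norm (- a); rewrite !normrN => ? ? ? ?.
have := nT; move: (n%:R * D) n0 => A A0 AT.
by apply/andP; split; case: (leP (a + A) r) => ?; case: (leP a r) => ?; lra.
Qed.

(** The full overlaps add up to [n * D * tent D h]. Replacing [n * D] by [T] costs [D / T], for the
    incomplete last cell. The part before [r] lies in disjoint cells starting at [a], hence is at
    most both [T] and [|r| + |a|]. *)
Lemma bracket_le r :
  `|T^-1 * (\sum_(p < n) (Num.max (y p - r) 0 - Num.max (x p - r) 0)) - tent D h| <=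
  D / T + Num.min 1 ((`|r| + `|a|) / T).
Proof.
have E p : Num.max (y p - r) 0 - Num.max (x p - r) 0 = D * tent D h - b r p.
  rewrite -(tent_width p) /b.
  by case: (leP (y p - r) 0) => ?; case: (leP (x p - r) 0) => ?;
     case: (leP (y p) r) => ?; case: (leP (x p) r) => ?; lra.
under eq_bigr do rewrite E.
rewrite sumrB sumr_const card_ord -mulr_natl.
have /andP[s0 s1] := sum_b r; set s := \sum_(p < n) b r p in s0 s1 *.
have t0 := tent_ge0 D h; have t1 := tent_le1 h D0.
have Ti : 0 < T^-1 by rewrite invr_gt0.
have TT : T^-1 * T = 1 by rewrite mulVf ?gt_eqF.
have A : 0 <= T^-1 * s <= Num.min 1 ((`|r| + `|a|) / T).
  apply/andP; split; first by rewrite mulr_ge0// ltW.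
  rewrite le_min; move: s1; rewrite le_min => /andP[s1 s2]; apply/andP; split.
    by rewrite -TT ler_wpM2l// ltW.
  by rewrite [leRHS]mulrC ler_wpM2l// ltW.
have B : `|T^-1 * (n%:R * (D * tent D h)) - tent D h| <= D / T.
  have -> : T^-1 * (n%:R * (D * tent D h)) - tent D h = - (T^-1 * (T - n%:R * D) * tent D h).
    by rewrite mulrBr TT; ring.
  rewrite normrN ger0_norm ?mulr_ge0 ?subr_ge0 ?(ltW Ti)//.
  apply: (@le_trans _ _ (T^-1 * (T - n%:R * D) * 1)).
    by rewrite ler_wpM2l// mulr_ge0 ?subr_ge0 ?(ltW Ti).
  by rewrite mulr1 [leRHS]mulrC ler_wpM2l ?(ltW Ti)// lerBlDl.
have -> : T^-1 * (n%:R * (D * tent D h) - s) - tent D h =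
  (T^-1 * (n%:R * (D * tent D h)) - tent D h) - T^-1 * s by ring.
apply: le_trans (ler_normB _ _) _; apply: lerD B _.
by case/andP: A => A1 A2; rewrite ger0_norm.
Qed.

End pointwise_bracket.

(** The relative effect of a delay [r] on a window of length [T]. Being at most 1 and tending to 0
    for fixed [r], it has a vanishing integral against any finite measure, even one without a first
    moment. *)
Definition truncated (R : realType) (T r : R) : R := Num.min 1 (`|r| / T).

Section truncated_theory.
Context (R : realType) (T : R).
Hypothesis T0 : 0 < T.

Lemma truncated_ge0 r : 0 <= truncated T r.
Proof. by rewrite /truncated le_min ler01/= divr_ge0// ltW. Qed.

Lemma truncated_le1 r : truncated T r <= 1.
Proof. by rewrite /truncated ge_min lexx. Qed.

Lemma truncated_add r a : Num.min 1 ((`|r| + `|a|) / T) <= truncated T r + truncated T a.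
Proof.
rewrite /truncated mulrDl; have : 0 <= `|r| / T by rewrite divr_ge0// ltW.
have : 0 <= `|a| / T by rewrite divr_ge0// ltW.
move: (_ / T) (_ / T) => u v u0 v0.
by case: (leP 1 (u + v)) => ?; case: (leP 1 v) => ?; case: (leP 1 u) => ?; lra.
Qed.

Lemma truncated_sub r a : truncated T (r - a) <= `|r| / T + truncated T a.
Proof.
apply: (@le_trans _ _ (Num.min 1 ((`|r| + `|a|) / T))).
  rewrite /truncated le_min ge_min lexx /= ge_min; apply/orP; right.
  by rewrite ler_wpM2r ?invr_ge0 ?(ltW T0)// ler_normB.
apply: le_trans (truncated_add _ _) _; rewrite lerD2r.
by rewrite /truncated ge_min lexx orbT.
Qed.

Lemma truncated_bounded : bounded_measurable (truncated T).
Proof.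
split.
  apply: measurable_minr; first exact: measurable_cst.
  by apply: measurable_funM; [exact: normr_measurable|exact: measurable_cst].
by exists 1 => r; rewrite ger0_norm ?truncated_ge0// truncated_le1.
Qed.

End truncated_theory.

Section shifted_covariation.
Context {disp : measure_display} {Omega : measurableType disp} {R : realType} {d : nat}.
Variables (P : probability Omega R) (mu : 'cV[R]_d).
Variable kap : 'I_d -> 'I_d -> {finite_measure set R -> \bar R}.
Variables (F : R -> set (set Omega)) (Ns Ls : nat -> 'I_d -> R -> Omega -> R).
Variables (N L : 'I_d -> R -> Omega -> R).
Hypothesis CS : cluster_system P mu kap F Ns Ls N L.
Local Notation m := (mean_count mu kap).
Local Notation mass k l := (fine (kap k l setT)).
Local Notation dM k a b w := ((N k b w - L k b w) - (N k a w - L k a w)).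
Local Notation rate_bound := (rate_bound mu kap).
Local Notation centered_bound := (centered_bound mu kap).
Local Notation lagged_bound := (lagged_bound mu kap).

Definition stationary_rate k : R := \sum_q mu q 0 * mass k q.
Definition tail (T : R) : R := \sum_k \sum_q \int[kap k q]_r truncated T r.
Definition immigration : R := \sum_q mu q 0.

Let mass0 k l : 0 <= mass k l. Proof. by rewrite fine_ge0. Qed.
Let mu0 q : 0 <= mu q 0. Proof. exact: (s_mu CS). Qed.
Let imm0 : 0 <= immigration. Proof. exact: sumr_ge0. Qed.

Variables (D T : R) (n : nat).
Hypotheses (D0 : 0 < D) (T0 : 0 < T) (nT : n%:R * D <= T) (Tn : T <= n%:R * D + D).

Let trunc_int k q : 0 <= \int[kap k q]_r truncated T r.
Proof. by apply: Rintegral_ge0 => r _; exact: truncated_ge0. Qed.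

Lemma tail_ge0 : 0 <= tail T.
Proof. by apply: sumr_ge0 => k _; apply: sumr_ge0. Qed.

Lemma truncated_le_tail k q : \int[kap k q]_r truncated T r <= tail T.
Proof.
rewrite /tail (bigD1 k)//= (bigD1 q)//= -addrA lerDl addr_ge0// sumr_ge0// => j _.
exact: sumr_ge0.
Qed.

Section lag.
Variables (h a : R).
Hypothesis h0 : 0 <= h.

Let x (p : nat) := Num.min (a + p%:R * D + h) (a + p%:R * D + D).
Let y (p : nat) := a + p%:R * D + D.

Definition deviation : R := rate_bound * (D / T + truncated T a) + immigration * tail T.

Let bracket r := T^-1 * (\sum_(p < n) (Num.max (y p - r) 0 - Num.max (x p - r) 0)) - tent D h.

Let ramp_int k l t : (kap k l).-integrable setT (EFin \o (fun s : R => Num.max (t - s) 0)).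
Proof.
apply: (halfline_integrable (s_neg CS k l) (c := Num.max t 0)) => [|s s0].
  exact: ramp_measurable.
by have /andP[r0 r1] := ramp_le t s0; rewrite ger0_norm.
Qed.

Let cst_int k l (c : R) : (kap k l).-integrable setT (EFin \o cst c).
Proof. by apply: bounded_measurable_integrable; exact: bounded_measurable_cst. Qed.

Let inc_int k q : (kap k q).-integrable setT
  (EFin \o (fun r : R => \sum_(p < n) (Num.max (y p - r) 0 - Num.max (x p - r) 0))).
Proof. by apply: integrable_EFin_sum => p; apply: integrable_EFinB; exact: ramp_int. Qed.

Let bracket_int k q : (kap k q).-integrable setT (EFin \o bracket).
Proof. by apply: integrable_EFinB; [apply: integrable_EFinZ; exact: inc_int|exact: cst_int]. Qed.

Let bracket_Rint k q : \int[kap k q]_r bracket r =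
  T^-1 * (\sum_(p < n) (\int[kap k q]_r Num.max (y p - r) 0 - \int[kap k q]_r Num.max (x p - r) 0))
  - tent D h * mass k q.
Proof.
rewrite RintegralB//; last 2 first.
- by apply: integrable_EFinZ; exact: inc_int.
- exact: (cst_int k q (tent D h)).
rewrite RintegralZl//; last exact: inc_int.
rewrite Rintegral_sum; last by move=> p; apply: integrable_EFinB; exact: ramp_int.
congr (_ * _ - _); last exact: Rintegral_cst.
by apply: eq_bigr => p _; rewrite RintegralB//; exact: ramp_int.
Qed.

(** The mean count is a mixture of ramps starting at the delays [r], so [bracket_le] is integrated
    against the kernel. The kernel part of the error is bounded by [tail T]. *)
Lemma mean_bracket k :
  `|T^-1 * (\sum_(p < n) (m k (y p) - m k (x p))) - tent D h * stationary_rate k| <= deviation.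
Proof.
have -> : T^-1 * (\sum_(p < n) (m k (y p) - m k (x p))) - tent D h * stationary_rate k =
    \sum_q mu q 0 * \int[kap k q]_r bracket r.
  transitivity (\sum_q (T^-1 * (\sum_(p < n) (mu q 0 * \int[kap k q]_r Num.max (y p - r) 0 -
     mu q 0 * \int[kap k q]_r Num.max (x p - r) 0)) - tent D h * (mu q 0 * mass k q))).
    rewrite [RHS]sumrB -[X in _ = X - _]mulr_sumr -[X in _ = _ - X]mulr_sumr [in RHS]exchange_big /=.
    congr (_ * _ - _).
    by apply: eq_bigr => p _; rewrite sumrB.
  apply: eq_bigr => q _; rewrite bracket_Rint mulrBr; congr (_ - _); last by ring.
  by rewrite [RHS]mulrCA; congr (_ * _); rewrite mulr_sumr; apply: eq_bigr => p _; ring.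
apply: le_trans (ler_norm_sum _ _ _) _.
have bq q : `|\int[kap k q]_r bracket r| <= (D / T + truncated T a) * mass k q + tail T.
  apply: le_trans (le_normr_Rintegral measurableT (bracket_int k q)) _.
  have bT := truncated_bounded T0.
  apply: (@le_trans _ _ (\int[kap k q]_r ((D / T + truncated T a) + truncated T r))).
    apply: le_Rintegral => //.
    - by have := integrable_norm (bracket_int k q).
    - by apply: bounded_measurable_integrable; apply: bounded_measurableD => //; exact: bounded_measurable_cst.
    - move=> r _; apply: le_trans (bracket_le a D0 T0 h0 nT Tn r) _.
      by rewrite -addrA lerD2l addrC truncated_add.
  rewrite Rint_add//; last exact: bounded_measurable_cst.
  by rewrite lerD ?truncated_le_tail// (_ : Rintegral _ _ _ = (D / T + truncated T a) * mass k q)//; exact: Rintegral_cst.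
apply: (@le_trans _ _ (\sum_q mu q 0 * ((D / T + truncated T a) * mass k q + tail T))).
  by apply: ler_sum => q _; rewrite normrM (ger0_norm (mu0 q)) ler_wpM2l.
have -> : \sum_q mu q 0 * ((D / T + truncated T a) * mass k q + tail T) =
   stationary_rate k * (D / T + truncated T a) + immigration * tail T.
  by rewrite !mulr_suml -big_split /=; apply: eq_bigr => q _; ring.
rewrite lerD2r ler_wpM2r//; first by rewrite addr_ge0 ?truncated_ge0// divr_ge0 ?ltW.
rewrite /rate_bound [leRHS](bigD1 k)//= lerDl sumr_ge0// => j _.
by apply: sumr_ge0 => l _; rewrite mulr_ge0.
Qed.

Let xy p : x p <= y p. Proof. by rewrite ge_min lexx orbT. Qed.
Let yx p : y p <= x p.+1.
Proof.
have -> : y p = a + p.+1%:R * D by rewrite /y -natr1; ring.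
by rewrite le_min lerDl h0 lerDl ltW.
Qed.

Let width_sum : \sum_(p < n) (y p - x p) <= T.
Proof.
apply: le_trans nT; rewrite mulr_natl -[n in _ *+ n]card_ord -sumr_const; apply: ler_sum => p _.
rewrite (tent_width a D0 h0) ler_piMr ?(ltW D0)//; exact: tent_le1.
Qed.

(** The number of common jumps splits into its fluctuation, controlled by the total overlap length,
    at most [T], and its deterministic bias. *)
Lemma L2_diagonal k :
  L2_le P (fun w => T^-1 * (\sum_(p < n) (N k (y p) w - N k (x p) w)) - tent D h * stationary_rate k)
    (2 * (centered_bound / T + deviation ^+ 2)).
Proof.
have := L2_leD (L2_leZ T^-1 (L2_centered_sum CS k n xy yx))
  (L2_le_cst P (T^-1 * (\sum_(p < n) (m k (y p) - m k (x p))) - tent D h * stationary_rate k)).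
set f := (fun w => _ + _); set g := (fun w => _ - _).
have -> : f = g.
  apply/funext => w; rewrite /f /g /cst addrA -mulrDr -big_split /=; congr (_ * _ - _).
  by apply: eq_bigr => p _; ring.
apply: L2_le_weaken; rewrite ler_pM2l//; apply: lerD.
  have -> : centered_bound / T = T^-1 ^+ 2 * (centered_bound * T).
    by rewrite expr2; field; rewrite gt_eqF.
  apply: ler_wpM2l; first exact: sqr_ge0.
  by apply: ler_wpM2l; [exact: (centered_bound_ge0 CS)|exact: width_sum].
rewrite -(@real_normK _ (_ - _)) ?num_real// lerXn2r ?nnegrE ?mean_bracket//.
exact: le_trans (mean_bracket k).
Qed.

(** Adding two variables costs a factor 2, applied to the lagged products and again inside
    [L2_diagonal]; hence 2 and 4. The factor 12 is 4 times the 3 from squaring the three terms of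
    [deviation]. *)
Definition pair_bound : R :=
  2 * lagged_bound + 4 * centered_bound + 12 * rate_bound ^+ 2 + 12 * immigration ^+ 2.

Definition base_rate : R := T^-1 + D / T + (D / T) ^+ 2 + tail T ^+ 2.

Lemma L2_pair k l :
  L2_le P (fun w => T^-1 * (\sum_(p < n) dM k (a + p%:R * D) (a + p%:R * D + D) w *
       dM l (a + p%:R * D + h) (a + p%:R * D + D + h) w) - (k == l)%:R * (tent D h * stationary_rate k))
    (pair_bound * (base_rate + truncated T a)).
Proof.
have L1 := L2_leZ T^-1 (L2_lagged_sum CS k l a n h0 (ltW D0)).
have L2 := L2_leZ ((k == l)%:R) (L2_diagonal k).
have := L2_leD L1 L2.
set f := (fun w => _ + _); set g := (fun w => _ - _).
have -> : f = g.
  apply/funext => w; rewrite /f /g /lagged_product sumrB -mulr_sumr; ring.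
apply: L2_le_weaken.
have dT0 : 0 <= D / T by rewrite divr_ge0 ?ltW.
have Ti : 0 < T^-1 by rewrite invr_gt0.
have cb := centered_bound_ge0 CS.
have lb := lagged_bound_ge0 CS.
have Ti0 := ltW Ti.
have A1 : T^-1 ^+ 2 * (n%:R * (lagged_bound * (D + D ^+ 2))) <= lagged_bound * (T^-1 + D / T).
  have -> : T^-1 ^+ 2 * (n%:R * (lagged_bound * (D + D ^+ 2))) =
     lagged_bound * (T^-1 + D / T) * (T^-1 * (n%:R * D)) by ring.
  rewrite -[leRHS]mulr1 ler_wpM2l//.
    exact: mulr_ge0 lb (addr_ge0 Ti0 dT0).
  by rewrite mulrC ler_pdivrMr// mul1r.
have A2 : ((k == l)%:R : R) ^+ 2 * (2 * (centered_bound / T + deviation ^+ 2)) <=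
    2 * (centered_bound / T + deviation ^+ 2).
  have : 0 <= 2 * (centered_bound / T + deviation ^+ 2).
    apply: mulr_ge0 (ler0n _ 2) (addr_ge0 _ (sqr_ge0 _)); exact: divr_ge0 cb (ltW T0).
  by case: (k == l); rewrite ?expr1n ?mul1r ?expr0n ?mul0r.
(* Since [truncated] is at most 1, its square is replaced by itself; the bound stays linear and can
   be integrated against the kernel. *)
have A3 : deviation ^+ 2 <= 3 * (rate_bound ^+ 2 * (D / T) ^+ 2 + rate_bound ^+ 2 * truncated T a
    + immigration ^+ 2 * tail T ^+ 2).
  have t0 := truncated_ge0 T0 a; have t1 := truncated_le1 T a.
  have tt : truncated T a ^+ 2 <= truncated T a by rewrite expr2 ler_piMr.
  have rr : rate_bound ^+ 2 * truncated T a ^+ 2 <= rate_bound ^+ 2 * truncated T a.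
    by rewrite ler_wpM2l ?sqr_ge0.
  have sq3 (u v z : R) : (u + v + z) ^+ 2 <= 3 * (u ^+ 2 + v ^+ 2 + z ^+ 2).
    by have := sqr_ge0 (u - v); have := sqr_ge0 (v - z); have := sqr_ge0 (u - z); nra.
  have := sq3 (rate_bound * (D / T)) (rate_bound * truncated T a) (immigration * tail T).
  have -> : rate_bound * (D / T) + rate_bound * truncated T a + immigration * tail T = deviation.
    by rewrite /deviation mulrDr.
  rewrite !exprMn => S3; apply: le_trans S3 _; rewrite ler_pM2l//.
  by rewrite lerD2r lerD2l.
have t0 := truncated_ge0 T0 a.
have r2 := sqr_ge0 rate_bound; have i2 := sqr_ge0 immigration.
have d2 := sqr_ge0 (D / T); have l2 := sqr_ge0 (tail T).
rewrite /pair_bound /base_rate.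
move: A1 A2 A3; set A := T^-1 ^+ 2 * _; set B := _ ^+ 2 * (2 * _).
move: A B (deviation ^+ 2) (rate_bound ^+ 2) (immigration ^+ 2) ((D / T) ^+ 2) r2 i2 d2.
move: (tail T ^+ 2) (truncated T a) T^-1 (D / T) lagged_bound centered_bound l2 t0 dT0 Ti0 lb cb.
move=> ll tr ti dt lb cb l0 tr0 dt0 ti0 lb0 cb0 A B dv rr ii dd r0 i0 d0 A1 A2 A3.
(* [P1] to [P4] are the nonnegative surplus products in the expansion of
   [pair_bound * (base_rate + truncated T a)]. *)
have P1 : 0 <= lb * (dd + ll + tr) by rewrite mulr_ge0// !addr_ge0.
have P2 : 0 <= cb * (dt + dd + ll + tr) by rewrite mulr_ge0// !addr_ge0.
have P3 : 0 <= rr * (ti + dt + ll) by rewrite mulr_ge0// !addr_ge0.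
have P4 : 0 <= ii * (ti + dt + dd + tr) by rewrite mulr_ge0// !addr_ge0.
nra.
Qed.

End lag.

Lemma pair_bound_ge0 : 0 <= pair_bound.
Proof.
have := lagged_bound_ge0 CS; have := centered_bound_ge0 CS.
have := sqr_ge0 rate_bound; have := sqr_ge0 immigration; rewrite /pair_bound.
by move: lagged_bound centered_bound (rate_bound ^+ 2) (immigration ^+ 2) => x y z u *; lra.
Qed.

Lemma base_rate_ge0 : 0 <= base_rate.
Proof. by rewrite /base_rate !addr_ge0 ?sqr_ge0 ?invr_ge0 ?divr_ge0 ?(ltW T0) ?(ltW D0). Qed.

Variable tau : R.

Definition shifted_term k l (s t : R) w : R :=
  T^-1 * (\sum_(p < n) dM k (p%:R * D - s) (p%:R * D + D - s) w *
     dM l (p%:R * D + tau - t) (p%:R * D + D + tau - t) w)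
  - (k == l)%:R * (tent D (t - s - tau) * stationary_rate k).

(** [L2_pair] wants a nonnegative lag. According to the sign of [tau - t + s], the window of [k] or
    that of [l] comes first, and in the second case the roles are exchanged. The starting point is
    then [- s] or [tau - t], which accounts for the terms in [s], [t] and [tau]. *)
Lemma L2_shifted_term k l s t :
  L2_le P (shifted_term k l s t)
    (pair_bound * (base_rate + `|tau| / T + truncated T t + truncated T s)).
Proof.
have tT : 0 <= `|tau| / T by rewrite divr_ge0 ?(ltW T0).
have ts := truncated_ge0 T0 s; have tt := truncated_ge0 T0 t.
have [u0|/ltW u0] := leP 0 (tau - t + s).
  have := L2_pair (- s) u0 k l.
  set f := (fun w => _ - _); have -> : f = shifted_term k l s t.
    apply/funext => w; rewrite /f /shifted_term; congr (_ * _ - _ * (_ * _)).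
      apply: eq_bigr => p _.
      have -> : - s + p%:R * D = p%:R * D - s by ring.
      have -> : p%:R * D - s + D = p%:R * D + D - s by ring.
      have -> : p%:R * D - s + (tau - t + s) = p%:R * D + tau - t by ring.
      by have -> : p%:R * D + D - s + (tau - t + s) = p%:R * D + D + tau - t by ring.
    by rewrite -tentN; congr tent; ring.
  apply: L2_le_weaken; rewrite ler_wpM2l ?pair_bound_ge0//.
  have -> : truncated T (- s) = truncated T s by rewrite /truncated normrN.
  lra.
have h0 : 0 <= t - s - tau by lra.
have := L2_pair (tau - t) h0 l k.
set f := (fun w => _ - _); have -> : f = shifted_term k l s t.
  apply/funext => w; rewrite /f /shifted_term; congr (_ * _ - _).
    apply: eq_bigr => p _; rewrite mulrC.
    have -> : tau - t + p%:R * D = p%:R * D + tau - t by ring.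
    have -> : p%:R * D + tau - t + D = p%:R * D + D + tau - t by ring.
    have -> : p%:R * D + tau - t + (t - s - tau) = p%:R * D - s by ring.
    by have -> : p%:R * D + D + tau - t + (t - s - tau) = p%:R * D + D - s by ring.
  by rewrite eq_sym; case: eqVneq => [->|]//; rewrite !mul0r.
apply: L2_le_weaken; rewrite ler_wpM2l ?pair_bound_ge0//.
have := truncated_sub T0 tau t; lra.
Qed.

Let joint (G : 'I_d -> R -> Omega -> R) k c :
  measurable_fun setT (fun z : R * Omega => G k z.1 z.2) ->
  measurable_fun setT (fun z : R * (R * Omega) => G k (c - z.2.1) z.2.2) /\
  measurable_fun setT (fun z : R * (R * Omega) => G k (c - z.1) z.2.2).
Proof.
move=> mG.
have m2 : measurable_fun setT (fun z : R * (R * Omega) => z.2) by exact: measurable_snd.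
have m21 : measurable_fun setT (fun z : R * (R * Omega) => z.2.1).
  exact: (measurableT_comp (f := fst) measurable_fst m2).
have m22 : measurable_fun setT (fun z : R * (R * Omega) => z.2.2).
  exact: (measurableT_comp (f := snd) measurable_snd m2).
split.
- apply: (measurableT_comp (f := fun z : R * Omega => G k z.1 z.2) mG
    (g := fun z : R * (R * Omega) => (c - z.2.1, z.2.2))).
  by apply: measurable_fun_pair => //; apply: measurable_funB => //; exact: measurable_cst.
- apply: (measurableT_comp (f := fun z : R * Omega => G k z.1 z.2) mG
    (g := fun z : R * (R * Omega) => (c - z.1, z.2.2))).
  apply: measurable_fun_pair => //; apply: measurable_funB; first exact: measurable_cst.
  exact: measurable_fst.
Qed.

Lemma shifted_term_measurable k l :
  measurable_fun setT (fun z : R * (R * Omega) => shifted_term k l z.2.1 z.1 z.2.2).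
Proof.
have jN q c := joint c (s_N_meas CS q); have jL q c := joint c (s_L_meas CS q).
apply: measurable_funB.
  apply: measurable_funM; first exact: measurable_cst.
  apply: measurable_sum => p; apply: measurable_funM.
    by apply: measurable_funB; apply: measurable_funB;
      [case: (jN k (p%:R * D + D))|case: (jL k (p%:R * D + D))|case: (jN k (p%:R * D))|case: (jL k (p%:R * D))].
  by apply: measurable_funB; apply: measurable_funB;
    [case: (jN l (p%:R * D + D + tau))|case: (jL l (p%:R * D + D + tau))
    |case: (jN l (p%:R * D + tau))|case: (jL l (p%:R * D + tau))].
apply: measurable_funM; first exact: measurable_cst.
apply: measurable_funM; last exact: measurable_cst.
apply: (measurableT_comp (@tent_measurable R D)).
apply: measurable_funB; last exact: measurable_cst.
apply: measurable_funB; first exact: measurable_fst.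
exact: (measurableT_comp (f := fst) measurable_fst measurable_snd).
Qed.

Let inner_bound j l s := pair_bound *
  ((base_rate + `|tau| / T + truncated T s) * mass j l + tail T).

Let affine_integral k q (c x : R) : 0 <= c ->
  (\int[kap k q]_s (c * (x + truncated T s))%:E <= (c * (x * mass k q + tail T))%:E)%E.
Proof.
move=> c0; have bT := truncated_bounded T0.
have bx : bounded_measurable (fun s : R => x + truncated T s).
  by apply: bounded_measurableD => //; exact: bounded_measurable_cst.
rewrite -Rint_EFin; last exact: bounded_measurableZ.
rewrite lee_fin Rint_scale// ler_wpM2l// Rint_add//; last exact: bounded_measurable_cst.
by rewrite lerD ?truncated_le_tail// (_ : Rintegral _ _ _ = x * mass k q)//; exact: Rintegral_cst.
Qed.

Let mass_gt0 k l : 0 < mass k l + 1. Proof. by rewrite ltr_wpDl. Qed.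
Let mass_le k l : (kap k l setT <= (mass k l + 1)%:E)%E.
Proof. by rewrite -[leLHS]fineK ?fin_num_measure// lee_fin lerDl. Qed.

Lemma L2_inner j k l s : L2_le P (fun w => \int[kap j l]_t shifted_term k l s t w)
  ((mass j l + 1) * inner_bound j l s).
Proof.
apply: (@L2_le_mixture _ _ _ _ _ _ (kap j l) (fun t w => shifted_term k l s t w)
  (fun t => pair_bound * (base_rate + `|tau| / T + truncated T s + truncated T t))) => //.
- have mz : measurable_fun setT (fun z : R * Omega => (z.1, (s, z.2))).
    apply: measurable_fun_pair; first exact: measurable_fst.
    by apply: measurable_fun_pair; [exact: measurable_cst|exact: measurable_snd].
  exact: (measurableT_comp (shifted_term_measurable k l) mz).
- apply: measurable_funM; first exact: measurable_cst.
  apply: measurable_funD; first exact: measurable_cst.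
  by case: (truncated_bounded T0).
- move=> t; have := L2_shifted_term k l s t.
  by rewrite -!addrA [truncated T t + _]addrC.
- exact: affine_integral pair_bound_ge0.
Qed.

Lemma L2_outer i j k l : L2_le P (fun w => \int[kap i k]_s \int[kap j l]_t shifted_term k l s t w)
  ((mass i k + 1) * ((mass j l + 1) * (pair_bound *
     (((base_rate + `|tau| / T) * mass j l + tail T) * mass i k + mass j l * tail T)))).
Proof.
apply: (@L2_le_mixture _ _ _ _ _ _ (kap i k) (fun s w => \int[kap j l]_t shifted_term k l s t w)
  (fun s => (mass j l + 1) * inner_bound j l s)) => //.
- exact: (@measurable_Rintegral_param _ _ R (R * Omega)%type R (kap j l)
    (fun t y => shifted_term k l y.1 t y.2) (shifted_term_measurable k l)).
- apply: measurable_funM; first exact: measurable_cst.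
  apply: measurable_funM; first exact: measurable_cst.
  apply: measurable_funD; last exact: measurable_cst.
  apply: measurable_funM; last exact: measurable_cst.
  apply: measurable_funD; first exact: measurable_cst.
  by case: (truncated_bounded T0).
- by move=> s; exact: L2_inner.
pose c := (mass j l + 1) * pair_bound.
have c0 : 0 <= c by rewrite mulr_ge0 ?pair_bound_ge0// ltW.
have bT := truncated_bounded T0.
have bx x y : bounded_measurable (fun s : R => x + y * truncated T s).
  by apply: bounded_measurableD; [exact: bounded_measurable_cst|exact: bounded_measurableZ].
have E s : (mass j l + 1) * inner_bound j l s =
    c * (((base_rate + `|tau| / T) * mass j l + tail T) + mass j l * truncated T s).
  by rewrite /c /inner_bound; ring.
under eq_integral do rewrite E.
rewrite -Rint_EFin; last exact: bounded_measurableZ.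
rewrite lee_fin mulrA -/c Rint_scale// ler_wpM2l// Rint_add//; last 2 first.
- exact: bounded_measurable_cst.
- exact: bounded_measurableZ.
rewrite lerD//.
  by rewrite le_eqVlt; apply/orP; left; apply/eqP; exact: Rintegral_cst.
by rewrite Rint_scale// ler_wpM2l// truncated_le_tail.
Qed.

Definition total_mass : R := \sum_k \sum_l mass k l + 1.

Let mass_total k l : mass k l + 1 <= total_mass.
Proof.
rewrite /total_mass lerD2r (bigD1 k)//= (bigD1 l)//= -addrA lerDl addr_ge0//.
  exact: sumr_ge0.
by apply: sumr_ge0 => q _; exact: sumr_ge0.
Qed.

(** Each of the two sums over marks costs [d^2]. Two powers of [total_mass] come from Cauchy-Schwarz
    in the two shifts, two from integrating the bound against the two kernels. *)
Definition covariation_bound : R := d%:R ^+ 4 * (total_mass ^+ 4 * pair_bound).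

Lemma L2_total i j :
  L2_le P (fun w => \sum_k \sum_l \int[kap i k]_s \int[kap j l]_t shifted_term k l s t w)
    (covariation_bound * (base_rate + `|tau| / T + 2 * tail T)).
Proof.
set B := base_rate + `|tau| / T.
have B0 : 0 <= B by rewrite addr_ge0 ?base_rate_ge0// divr_ge0 ?(ltW T0).
have t0 := tail_ge0; have p0 := pair_bound_ge0.
pose c := total_mass ^+ 4 * pair_bound * (B + 2 * tail T).
have L1 k l : L2_le P (fun w => \int[kap i k]_s \int[kap j l]_t shifted_term k l s t w) c.
  apply: L2_le_weaken (L2_outer i j k l); rewrite /c -/B.
  have := mass_total i k; have := mass_total j l; have := mass0 i k; have := mass0 j l.
  move: (mass i k) (mass j l) total_mass => x y z y0 x0 yz xz.
  have z1 : 1 <= z by lra.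
  have -> : (x + 1) * ((y + 1) * (pair_bound * ((B * y + tail T) * x + y * tail T))) =
     pair_bound * ((x + 1) * (y + 1) * (B * (x * y) + tail T * (x + y))) by ring.
  have -> : z ^+ 4 * pair_bound * (B + 2 * tail T) = pair_bound * (z ^+ 2 * (z ^+ 2 * (B + 2 * tail T))) by ring.
  have z2 : (x + 1) * (y + 1) <= z ^+ 2 by rewrite expr2 ler_pM// addr_ge0.
  have xy : x * y <= z ^+ 2 by rewrite expr2 ler_pM//; lra.
  have zz : z <= z ^+ 2 by rewrite expr2 ler_peMl//; lra.
  have xpy : x + y <= 2 * z ^+ 2 by lra.
  have B0' : 0 <= B * (x * y) + tail T * (x + y).
    by rewrite addr_ge0// mulr_ge0// ?mulr_ge0// addr_ge0.
  have BB : B * (x * y) + tail T * (x + y) <= z ^+ 2 * (B + 2 * tail T).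
    by have := ler_wpM2l B0 xy; have := ler_wpM2l t0 xpy; lra.
  rewrite (ler_wpM2l p0)// ler_pM//.
  by rewrite mulr_ge0// addr_ge0.
have := L2_le_sum (fun k => L2_le_sum (fun l => L1 k l)).
apply: L2_le_weaken; rewrite !sumr_const !card_ord le_eqVlt; apply/orP; left; apply/eqP.
rewrite /covariation_bound /c -/B; move: total_mass pair_bound (B + 2 * tail T) => x y z.
by rewrite -(mulr_natl (x ^+ 4 * y * z)) -(mulr_natl (d%:R * _)); ring.
Qed.

End shifted_covariation.

(** * Convergence *)

Section covariation_error.
Context {disp : measure_display} {Omega : measurableType disp} {R : realType} {d : nat}.
Variables (P : probability Omega R) (mu : 'cV[R]_d).
Variable kap : 'I_d -> 'I_d -> {finite_measure set R -> \bar R}.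
Variables (F : R -> set (set Omega)) (Ns Ls : nat -> 'I_d -> R -> Omega -> R).
Variables (N L : 'I_d -> R -> Omega -> R).
Hypothesis CS : cluster_system P mu kap F Ns Ls N L.
Local Notation m := (mean_count mu kap).
Local Notation mass k l := (fine (kap k l setT)).
Local Notation dM k a b w := ((N k b w - L k b w) - (N k a w - L k a w)).
Local Notation X k t w := (N k t w - m k t).
Local Notation stationary_rate := (stationary_rate mu kap).

Variables (D T tau : R) (n : nat).
Hypotheses (D0 : 0 < D) (T0 : 0 < T) (nT : n%:R * D <= T) (Tn : T <= n%:R * D + D).

Let dM_integrable i k a b w :
  (kap i k).-integrable setT (EFin \o (fun s : R => dM k (a - s) (b - s) w)).
Proof.
have iN c := lagged_path_integrable CS (s_N_meas CS) (s_N_mono CS) (N_ge0 CS) i k c w.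
have iL c := lagged_path_integrable CS (s_L_meas CS) (s_L_mono CS) (L_ge0 CS) i k c w.
by apply: integrable_EFinB; apply: integrable_EFinB.
Qed.

Let tent_bounded s : bounded_measurable (fun t : R => tent D (t - s - tau)).
Proof.
split; last by exists 1 => t; rewrite ger0_norm ?tent_ge0// tent_le1.
apply: (measurableT_comp (@tent_measurable R D)).
apply: measurable_funB; last exact: measurable_cst.
by apply: measurable_funB => //; exact: measurable_cst.
Qed.

Let tent_inner_bounded j k :
  bounded_measurable (fun s : R => \int[kap j k]_t tent D (t - s - tau)).
Proof.
split.
  apply: (@measurable_Rintegral_param _ _ R R R (kap j k) (fun t s => tent D (t - s - tau))).
  apply: (measurableT_comp (@tent_measurable R D)).
  apply: measurable_funB; last exact: measurable_cst.
  by apply: measurable_funB; [exact: measurable_fst|exact: measurable_snd].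
exists (mass j k) => s; rewrite ger0_norm; last by apply: Rintegral_ge0 => t _; exact: tent_ge0.
have -> : mass j k = \int[kap j k]_t cst 1 t.
  by rewrite -[LHS]mul1r; apply/esym; exact: Rintegral_cst.
apply: Rint_le => // [|t]; first exact: bounded_measurable_cst.
exact: tent_le1.
Qed.

Let shifted_term_integral i j k l w :
  \int[kap i k]_s \int[kap j l]_t shifted_term mu kap N L D T n tau k l s t w =
  T^-1 * (\sum_(p < n) (\int[kap i k]_s dM k (p%:R * D - s) (p%:R * D + D - s) w) *
      (\int[kap j l]_t dM l (p%:R * D + tau - t) (p%:R * D + D + tau - t) w))
  - (k == l)%:R * (stationary_rate k * \int[kap i k]_s \int[kap j l]_t tent D (t - s - tau)).
Proof.
have inner s : \int[kap j l]_t shifted_term mu kap N L D T n tau k l s t w =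
    T^-1 * (\sum_(p < n) (\int[kap j l]_t dM l (p%:R * D + tau - t) (p%:R * D + D + tau - t) w) *
        dM k (p%:R * D - s) (p%:R * D + D - s) w)
    - (k == l)%:R * stationary_rate k * \int[kap j l]_t tent D (t - s - tau).
  have E t : shifted_term mu kap N L D T n tau k l s t w =
     T^-1 * (\sum_(p < n) dM k (p%:R * D - s) (p%:R * D + D - s) w *
       dM l (p%:R * D + tau - t) (p%:R * D + D + tau - t) w) -
     (k == l)%:R * stationary_rate k * tent D (t - s - tau).
    by rewrite /shifted_term -mulrA [stationary_rate k * _]mulrC.
  under eq_Rintegral do rewrite E.
  have i1 p : (kap j l).-integrable setT (EFin \o (fun t : R =>
      dM k (p%:R * D - s) (p%:R * D + D - s) w * dM l (p%:R * D + tau - t) (p%:R * D + D + tau - t) w)).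
    by apply: integrable_EFinZ; exact: dM_integrable.
  have i2 := integrable_EFin_sum (index_enum 'I_n) xpredT (fun p : 'I_n => i1 p).
  rewrite RintegralB//; last 2 first.
  - exact: integrable_EFinZ.
  - by apply: integrable_EFinZ; exact: bounded_measurable_integrable.
  congr (_ - _); last by rewrite RintegralZl//; exact: bounded_measurable_integrable.
  rewrite RintegralZl//; congr (_ * _).
  apply: etrans (Rintegral_sum _ _ (fun p : 'I_n => i1 p)) _.
  by apply: eq_bigr => p _; rewrite [RHS]mulrC RintegralZl//; exact: dM_integrable.
under eq_Rintegral do rewrite inner.
have i1 p : (kap i k).-integrable setT (EFin \o (fun s : R =>
   (\int[kap j l]_t dM l (p%:R * D + tau - t) (p%:R * D + D + tau - t) w) *
        dM k (p%:R * D - s) (p%:R * D + D - s) w)).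
  by apply: integrable_EFinZ; exact: dM_integrable.
have i2 := integrable_EFin_sum (index_enum 'I_n) xpredT (fun p : 'I_n => i1 p).
rewrite RintegralB//; last 2 first.
- exact: integrable_EFinZ.
- by apply: integrable_EFinZ; exact: bounded_measurable_integrable.
congr (_ - _); last by rewrite RintegralZl ?mulrA//; exact: bounded_measurable_integrable.
rewrite RintegralZl//; congr (_ * _).
apply: etrans (Rintegral_sum _ _ (fun p : 'I_n => i1 p)) _.
by apply: eq_bigr => p _; rewrite [RHS]mulrC RintegralZl//; exact: dM_integrable.
Qed.

(** The double integral of a product of increments factorizes, and summation over marks rebuilds the
    increments of the centered process. The subtracted terms survive only for [k = l]. *)
Lemma covariation_error_expansion i j : {ae P, forall w,
  \sum_k \sum_l \int[kap i k]_s \int[kap j l]_t shifted_term mu kap N L D T n tau k l s t w =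
  T^-1 * (\sum_(p < n) (X i (p%:R * D + D) w - X i (p%:R * D) w) *
      (X j (p%:R * D + D + tau) w - X j (p%:R * D + tau) w))
  - \sum_k stationary_rate k * \int[kap i k]_s \int[kap j k]_t tent D (t - s - tau)}.
Proof.
apply: filterS (centered_count CS) => w Hw.
have Xincr k a b : X k b w - X k a w = \sum_l \int[kap k l]_s dM l (a - s) (b - s) w.
  rewrite (Hw k b) (Hw k a) -sumrB; apply: eq_bigr => l _.
  have iN c := lagged_path_integrable CS (s_N_meas CS) (s_N_mono CS) (N_ge0 CS) k l c w.
  have iL c := lagged_path_integrable CS (s_L_meas CS) (s_L_mono CS) (L_ge0 CS) k l c w.
  by apply/esym; apply: RintegralB => //; exact: integrable_EFinB.
under eq_bigr do under eq_bigr do rewrite shifted_term_integral.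
under eq_bigr do rewrite sumrB.
rewrite sumrB; congr (_ - _).
  under eq_bigr do rewrite -mulr_sumr.
  rewrite -mulr_sumr; congr (_ * _).
  under eq_bigr do rewrite exchange_big /=.
  rewrite exchange_big /=; apply: eq_bigr => p _.
  rewrite Xincr (Xincr j) mulr_suml; apply: eq_bigr => k _.
  by rewrite mulr_sumr.
apply: eq_bigr => k _; rewrite (bigD1 k)//= eqxx mul1r big1 ?addr0// => l /negbTE lk.
by rewrite eq_sym lk mul0r.
Qed.

Lemma L2_covariation_error i j :
  L2_le P (fun w => T^-1 * (\sum_(p < n) (X i (p%:R * D + D) w - X i (p%:R * D) w) *
      (X j (p%:R * D + D + tau) w - X j (p%:R * D + tau) w))
    - \sum_k stationary_rate k * \int[kap i k]_s \int[kap j k]_t tent D (t - s - tau))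
  (covariation_bound mu kap * (base_rate kap D T + `|tau| / T + 2 * tail kap T)).
Proof.
have mX k t : measurable_fun setT (fun w => X k t w).
  by apply: measurable_funB; [exact: (state_measurable (s_N_meas CS))|exact: measurable_cst].
apply: L2_le_ae (covariation_error_expansion i j) (L2_total CS D0 T0 nT Tn tau i j).
apply: measurable_funB; last exact: measurable_cst.
apply: measurable_funM; first exact: measurable_cst.
by apply: measurable_sum => p; apply: measurable_funM; apply: measurable_funB.
Qed.

End covariation_error.

Section tail_limit.
Context {R : realType} {d : nat}.
Variable kap : 'I_d -> 'I_d -> {finite_measure set R -> \bar R}.

(** The integral is split at a radius [n0] beyond which the mass of [nu] is at most [e / 2]. Inside
    it, [truncated H] is at most [n0 / H]. *)
Lemma truncated_integral_cvg0 (nu : {finite_measure set R -> \bar R}) :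
  \int[nu]_r truncated H r @[H --> +oo] --> (0 : R).
Proof.
apply/cvgrPdist_le => e e0.
pose c := fine (nu setT) + 1.
have c0 : 0 < c by rewrite ltr_wpDl// fine_ge0.
pose f (n : nat) (r : R) : R := if n%:R < `|r| then 1 else 0.
have mf n : measurable_fun setT (f n).
  apply: measurable_fun_ifT; [|exact: measurable_cst|exact: measurable_cst].
  by apply: measurable_fun_ltr; [exact: measurable_cst|exact: normr_measurable].
have f01 n r : 0 <= f n r <= 1 by rewrite /f; case: ifP => _; rewrite ?ler01 ?lexx.
have f_le n r : `|f n r| <= 1 by have /andP[? ?] := f01 n r; rewrite ger0_norm.
have f_ev r : exists n1, forall n, (n1 <= n)%N -> f n r = 0.
  exists (Num.truncn `|r|).+1 => n rn; rewrite /f ifF//; apply/negbTE; rewrite -leNgt.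
  by apply: le_trans (ltW (truncnS_gt _)) _; rewrite ler_nat.
have [n0 Hn0] := Rint_eventually0 nu mf f_le f_ev (divr_gt0 e0 (ltr0Sn R 1)).
near=> H.
have H0 : 0 < H by near: H; exact: nbhs_pinfty_gt.
have HA : 2 * (n0%:R * c) / e <= H by near: H; apply: nbhs_pinfty_ge; rewrite num_real.
rewrite sub0r normrN ger0_norm; last by apply: Rintegral_ge0 => r _; exact: truncated_ge0.
have b1 : bounded_measurable (f n0).
  by split => //; exists 1 => r; have /andP[? ?] := f01 n0 r; rewrite ger0_norm.
apply: (@le_trans _ _ (\int[nu]_r (n0%:R / H + f n0 r))).
  apply: Rint_le => [||r].
  - exact: truncated_bounded.
  - by apply: bounded_measurableD => //; exact: bounded_measurable_cst.
  - rewrite /f /truncated; case: ltP => rn.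
      by rewrite ge_min lerDr divr_ge0 ?ler0n ?(ltW H0).
    by rewrite addr0 ge_min; apply/orP; right; rewrite ler_wpM2r// invr_ge0 ltW.
rewrite Rint_add//; last exact: bounded_measurable_cst.
have -> : \int[nu]_x (n0%:R / H) = n0%:R / H * fine (nu setT) by exact: Rintegral_cst.
have I2 : \int[nu]_x f n0 x <= e / 2.
  apply: le_trans (Hn0 n0 (leqnn _)); rewrite le_eqVlt; apply/orP; left; apply/eqP.
  by apply: eq_Rintegral => r _; have /andP[? ?] := f01 n0 r; rewrite ger0_norm.
have I1 : n0%:R / H * fine (nu setT) <= e / 2.
  apply: (@le_trans _ _ (n0%:R / H * c)).
    by rewrite ler_wpM2l ?divr_ge0 ?ler0n ?(ltW H0)// lerDl.
  rewrite mulrAC ler_pdivrMr//.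
  by move: HA; rewrite ler_pdivrMr// => HA; rewrite mulrAC ler_pdivlMr// mulrC [leRHS]mulrC.
by rewrite (splitr e) lerD.
Unshelve. all: by end_near. Qed.

Let sum_cvg0 (I : finType) (f : I -> R -> R) :
  (forall i, f i H @[H --> +oo] --> (0 : R)) -> \sum_i f i H @[H --> +oo] --> (0 : R).
Proof.
move=> f0; elim: (index_enum I) => [|i r IH].
  by under eq_fun do rewrite big_nil; exact: cvg_cst.
under eq_fun do rewrite big_cons.
suff : f i H + \sum_(j <- r) f j H @[H --> +oo] --> (0 + 0 : R) by rewrite addr0.
exact: cvgD.
Qed.

Lemma tail_cvg0 : tail kap H @[H --> +oo] --> (0 : R).
Proof.
by apply: sum_cvg0 => k; apply: sum_cvg0 => q; exact: truncated_integral_cvg0.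
Qed.

Lemma base_rate_cvg0 (D : R -> R) : D H / H @[H --> +oo] --> (0 : R) ->
  base_rate kap (D H) H @[H --> +oo] --> (0 : R).
Proof.
move=> D0.
have inv0 : H^-1 @[H --> +oo] --> (0 : R).
  by apply/gtr0_cvgV0; [exact: nbhs_pinfty_gt|exact: cvg_id].
suff : base_rate kap (D H) H @[H --> +oo] --> (0 + 0 + 0 * 0 + 0 * 0 : R).
  by rewrite !mul0r !addr0.
apply: cvgD; last by apply: cvgM; exact: tail_cvg0.
apply: cvgD; last exact: cvgM.
exact: cvgD.
Qed.

End tail_limit.

Lemma L2_le_Lnorm d (Om : measurableType d) (R : realType) (P : probability Om R) (f : Om -> R) e :
  0 <= e -> L2_le P f (e ^+ 2) -> ('N[P]_2%:E [ (fun w => (f w)%:E) ] <= e%:E)%E.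
Proof.
move=> e0 [mf fe]; rewrite unlock.
have -> : (\int[P]_x `|(f x)%:E| `^ 2 = \int[P]_x (f x ^+ 2)%:E)%E.
  by apply: eq_integral => w _; rewrite /= powR_mulrn// real_normK// num_real.
have -> : (e%:E = (e ^+ 2)%:E `^ 2^-1)%E.
  by rewrite /= -powR_mulrn// -powRrM mulfV ?powRr1// pnatr_eq0.
apply: gt0_ler_poweR => //.
- by rewrite in_itv/= leey andbT; apply: integral_ge0 => w _; rewrite lee_fin sqr_ge0.
- by rewrite in_itv/= leey andbT lee_fin sqr_ge0.
Qed.

(** * The Hawkes process as a cluster system *)

Section hawkes_covariation.
Context {disp : measure_display} {Omega : measurableType disp} {R : realType} {d : nat}.
Variables (P : probability Omega R) (T : nat -> Omega -> \bar R) (Z : nat -> Omega -> 'I_d).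
Variables (mu : 'cV[R]_d) (phi : R -> 'M[R]_d).
Hypothesis mpp : marked_point_process T Z.
Hypothesis mu0 : forall i, 0 <= mu i 0.
Hypothesis mphi : forall i j, measurable_fun `[(0 : R), +oo[ (fun t : R => phi t i j).
Hypothesis phi0 : forall i j t, 0 <= t -> 0 <= phi t i j.
Hypothesis phi_int : forall i j,
  (\int[lebesgue_measure]_(t in `[0%R, +oo[) (phi t i j)%:E < +oo)%E.
Hypothesis mart : forall n i, (1 <= n)%N -> martingale P (natural_filtration T Z)
          (stopped_compensated T Z mu phi n i).
Hypothesis rho_lt1 : spectral_radius (branching_matrix phi) < 1.
Variable kap : 'I_d -> 'I_d -> {finite_measure set R -> \bar R}.
Hypothesis kap_mass : forall i j, kap i j setT = (invmx (1%:M - branching_matrix phi) i j)%:E.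
Hypothesis kap_neg : forall i j, kap i j `]-oo, (0 : R)[%classic = 0%E.
Hypothesis kap_renewal : forall i j (x : R), kap i j `]-oo, x]%classic = (((i == j) && (0 <= x)%R)%:R%:E +
        \sum_(l < d) \int[kap i l]_s (\int[lebesgue_measure]_(t in `[0%R, (x - s)%R]) phi t l j)%:E)%E.
Local Notation N := (unstopped T (stopped_count T Z)).
Local Notation L := (unstopped T (stopped_compensator T Z mu phi)).
Local Notation m := (mean_count mu kap).
Local Notation X := (centered_process P T Z).

(** Jump indices start at 1, hence the stopping index [n.+1]. The almost sure clauses all hold on
    the nonexplosive event. *)
Lemma hawkes_cluster_system : cluster_system P mu kap (natural_filtration T Z)
  (fun n => stopped_count T Z n.+1) (fun n => stopped_compensator T Z mu phi n.+1) N L.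
Proof.
have ng := nonexplosive_ae mpp mu0 mphi phi0 phi_int mart rho_lt1.
have um := unstopped_mean mpp mu0 mphi phi0 phi_int mart rho_lt1.
split.
- exact: mu0.
- exact: kap_neg.
- move=> n; exact: (stopped_compensated_counting mpp mu0 mphi phi0 phi_int (ltn0Sn n)
    (fun i => mart i (ltn0Sn n))).
- exact: unstopped_count_joint mu phi mpp.
- exact: unstopped_compensator_joint.
- by move=> k s t w; exact: (unstopped_count_mono mu phi mpp k w).
- by move=> k s t w; exact: (unstopped_compensator_mono mpp mu0 mphi phi0 phi_int k w).
- by move=> k t w t0; have [] := unstopped_le0 mu phi mpp k w t0.
- by move=> k t w t0; have [] := unstopped_le0 mu phi mpp k w t0.
- apply: filterS ng => w gw t0; have [n0 H] := unstopped_eventually mu phi mpp t0 gw.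
  by exists n0 => n nn k t tt; have [-> ->] := H n nn k t tt.
- apply: filterS ng => w gw n k s t st.
  exact: (stopped_incr_le_unstopped mpp mu0 mphi phi0 phi_int n k gw st).
- by apply: filterS ng => w gw k t; exact: (cluster_identity mu mpp mphi phi0 phi_int kap_neg kap_renewal k t gw).
- by move=> k t; have [] := um k t.
- exists (\sum_k \sum_i invmx (1%:M - branching_matrix phi) k i * mu i 0) => k t.
  have [_ H] := um k t; apply: le_trans H _; rewrite lee_fin ler_wpM2r ?le_max ?lexx ?orbT//.
  rewrite [leRHS](bigD1 k)//= lerDl sumr_ge0// => j _; apply: sumr_ge0 => q _.
  by apply: mulr_ge0 => //; exact: (resolvent_ge0 mphi phi0 phi_int rho_lt1).
Qed.

Let CS := hawkes_cluster_system.

(** Outside the null set of explosions the count is finite, so [fine] is harmless. For [t <= 0] both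
    terms on the right vanish. *)
Lemma centered_processE : {ae P, forall w, forall t i, X t w i 0 = N i t w - m i t}.
Proof.
have ng := nonexplosive_ae mpp mu0 mphi phi0 phi_int mart rho_lt1.
have ng' := ng; apply: filterS ng => w gw t i; rewrite /centered_process.
have EN : (\int[P]_w (N i t w)%:E = (m i t)%:E)%E := expected_count CS i t.
case: ifPn => t0.
  have z w' : N i t w' = 0 by have [] := unstopped_le0 mu phi mpp i w' t0.
  have -> : m i t = 0.
    by apply: EFin_inj; rewrite -EN integral0_eq// => w' _; rewrite z.
  by rewrite z subrr mxE.
rewrite mxE (counting_process_unstopped mpp i t gw); congr (_ - _).
have -> : (\int[P]_w' counting_process T Z i t w' = \int[P]_w (N i t w)%:E)%E.
  apply: ae_eq_integral => //.
  - exact: counting_process_measurable.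
  - by apply/measurable_EFinP; exact: (state_measurable (s_N_meas CS)).
  - by apply: filterS ng' => w' gw' _; exact: counting_process_unstopped.
by rewrite EN.
Qed.

Lemma centered_process_measurable t i : measurable_fun setT (fun w => X t w i 0).
Proof.
have [t0|t0] := boolP (t <= 0).
  rewrite (_ : (fun w => _) = cst 0); first exact: measurable_cst.
  by apply/funext => w; rewrite /centered_process t0 mxE.
rewrite (_ : (fun w => _) = (fun w => fine (counting_process T Z i t w) -
    fine (\int[P]_w' counting_process T Z i t w')%E)); last first.
  by apply/funext => w; rewrite /centered_process (negbTE t0) mxE.
apply: measurable_funB; last exact: measurable_cst.
apply: (measurableT_comp (@fine_measurable _ setT measurableT)).
exact: counting_process_measurable.
Qed.

Lemma covariationE D H u i j w :
  covariation D H (fun t => X t w) (fun t => X (u + t) w) i j =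
  H^-1 * \sum_(p < Num.truncn (H / D)) (X (p%:R * D + D) w i 0 - X (p%:R * D) w i 0) *
     (X (p%:R * D + D + u) w j 0 - X (p%:R * D + u) w j 0).
Proof.
rewrite /covariation mxE summxE big_add1 /= big_mkord; congr (_ * _).
apply: eq_bigr => p _; rewrite mxE big_ord1 !mxE.
have -> : p.+1%:R * D = p%:R * D + D by rewrite -natr1; ring.
have -> : (p.+1%:R - 1) * D = p%:R * D by rewrite -natr1; ring.
by rewrite ![u + _]addrC.
Qed.

Lemma stationary_rateE k : stationary_rate mu kap k = Sigma mu phi k k.
Proof.
rewrite SigmaE eqxx mulr1n; apply: eq_bigr => q _.
by rewrite kap_mass /= mulrC.
Qed.

Hypothesis kap_int : forall i j (f : R -> \bar R), measurable_fun setT f -> (forall x, 0 <= f x)%E ->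
        (\int[kap i j]_x f x = (i == j)%:R%:E * f 0%R +
           \int[lebesgue_measure]_(s in `[0%R, +oo[) ((psi phi s i j)%:E * f s))%E.

Lemma L2_covariation D H u i j : 0 < D -> 0 < H ->
  L2_le P (fun w => (covariation D H (fun t => X t w) (fun t => X (u + t) w) - limit_cov mu phi D u) i j)
    (covariation_bound mu kap * (base_rate kap D H + `|u| / H + 2 * tail kap H)).
Proof.
move=> D0 H0; pose n := Num.truncn (H / D).
have HD : 0 <= H / D by rewrite divr_ge0 ?(ltW H0) ?(ltW D0).
(* The number of cells is the integer part of [H / D], so the cells cover [0, H] up to a remainder
   shorter than [D]. *)
have /andP[n1 n2] := truncn_itv HD.
have nH : n%:R * D <= H by rewrite -ler_pdivlMr.
have Hn : H <= n%:R * D + D.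
  by have := ltW n2; rewrite ler_pdivrMr// -natr1 mulrDl mul1r.
have E w : (covariation D H (fun t => X t w) (fun t => X (u + t) w) - limit_cov mu phi D u) i j =
  H^-1 * (\sum_(p < n) (X (p%:R * D + D) w i 0 - X (p%:R * D) w i 0) *
     (X (p%:R * D + D + u) w j 0 - X (p%:R * D + u) w j 0))
  - \sum_k stationary_rate mu kap k * \int[kap i k]_s \int[kap j k]_t tent D (t - s - u).
  rewrite mxE covariationE mxE (limit_cov_kernelE mu0 mphi phi0 phi_int rho_lt1 u D0 kap_int).
  by congr (_ - _); apply: eq_bigr => k _; rewrite stationary_rateE.
rewrite (funext E).
apply: L2_le_ae (L2_covariation_error CS u D0 H0 nH Hn i j).
- apply: measurable_funB; last exact: measurable_cst.
  apply: measurable_funM; first exact: measurable_cst.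
  by apply: measurable_sum => p; apply: measurable_funM; apply: measurable_funB;
    exact: centered_process_measurable.
- apply: filterS centered_processE => w Xw; congr (_ * _ - _); apply: eq_bigr => p _.
  have XD k a b : N k b w - m k b - (N k a w - m k a) = X b w k 0 - X a w k 0.
    exact: (congr2 (fun x y => x - y) (esym (Xw b k)) (esym (Xw a k))).
  exact: (congr2 *%R (XD i _ _) (XD j _ _)).
Qed.

Lemma covariation_cvg (Delta tau : R -> R) :
  (forall H, 0 < H -> 0 < Delta H) -> Delta H / H @[H --> +oo] --> (0 : R) ->
  tau H / H @[H --> +oo] --> (0 : R) ->
  cvg0_L2 P (fun H w =>
    covariation (Delta H) H (fun t => X t w) (fun t => X (tau H + t) w)
    - limit_cov mu phi (Delta H) (tau H)).
Proof.
move=> D0 Dcvg taucvg i j.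
pose c H := covariation_bound mu kap * (base_rate kap (Delta H) H + `|tau H| / H + 2 * tail kap H).
have c0 : c H @[H --> +oo] --> (0 : R).
  have ntau : `|tau H / H| @[H --> +oo] --> (0 : R) by rewrite -(normr0 R); exact: cvg_norm.
  have ntau' : `|tau H| / H @[H --> +oo] --> (0 : R).
    apply: cvg_trans ntau; apply: near_eq_cvg; near=> H.
    have H0 : 0 < H by near: H; exact: nbhs_pinfty_gt.
    by rewrite normrM normfV (gtr0_norm H0).
  suff : c H @[H --> +oo] --> (covariation_bound mu kap * (0 + 0 + 2 * 0) : R).
    by rewrite mulr0 !addr0 mulr0.
  apply: cvgM; first exact: cvg_cst.
  apply: cvgD; last by apply: cvgM; [exact: cvg_cst|exact: tail_cvg0].
  by apply: cvgD => //; exact: base_rate_cvg0.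
have L2 e : 0 < e -> \forall H \near +oo,
    ('N[P]_2%:E [ (fun w => ((covariation (Delta H) H (fun t => X t w) (fun t => X (tau H + t) w)
    - limit_cov mu phi (Delta H) (tau H)) i j)%:E) ] <= e%:E)%E.
  move=> e0; have e20 : 0 < e ^+ 2 by rewrite exprn_gt0.
  near=> H; apply: L2_le_Lnorm; first exact: ltW.
  have H0 : 0 < H by near: H; exact: nbhs_pinfty_gt.
  apply: L2_le_weaken (L2_covariation (tau H) i j (D0 H H0) H0).
  rewrite -/(c H); apply: le_trans (ler_norm _) _; near: H.
  by move/cvgr0Pnorm_le : c0; apply.
(* The norm is an extended real: it is eventually finite by the bound with [e = 1], after which
   convergence is a statement about reals. *)
apply/fine_cvgP; split.
  have := L2 1 ltr01; apply: filterS => H HL; rewrite ge0_fin_numE ?Lnorm_ge0//.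
  exact: le_lt_trans HL (ltry _).
apply/cvgr0Pnorm_le => e e0; have := L2 e e0; apply: filterS => H HL /=.
rewrite ger0_norm ?fine_ge0 ?Lnorm_ge0// -lee_fin fineK// ge0_fin_numE ?Lnorm_ge0//.
exact: le_lt_trans HL (ltry _).
Unshelve. all: by end_near. Qed.

End hawkes_covariation.

Theorem theorem3 (R : realType) (d : nat)
    (disp : measure_display) (Omega : measurableType disp)
    (P : probability Omega R)
    (mu : 'cV[R]_d) (phi : R -> 'M[R]_d)
    (T : nat -> Omega -> \bar R) (Z : nat -> Omega -> 'I_d)
    (hawkes_N : hawkes_process P mu phi T Z)
    (phi_int : forall i j,
      (\int[lebesgue_measure]_(t in `[0%R, +oo[) (phi t i j)%:E < +oo)%E)
    (rho_lt1 : spectral_radius (branching_matrix phi) < 1)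
    (Delta tau : R -> R)
    (Delta_gt0 : forall H, 0 < H -> 0 < Delta H)
    (Delta_cvg : Delta H / H @[H --> +oo] --> 0)
    (tau_cvg : tau H / H @[H --> +oo] --> 0) :
  let X := centered_process P T Z in
  cvg0_L2 P (fun H w =>
    covariation (Delta H) H (fun t => X t w) (fun t => X (tau H + t) w)
    - limit_cov mu phi (Delta H) (tau H))
  /\
  (forall D u : R, 0 < D -> limit_cov mu phi D u = limit_cov_measure mu phi D u).
Proof.
move=> X; have [mu0 mphi phi0 mpp mart] := hawkes_N.
have [kap [kapE kap_mass kap_neg kap_int kap_renewal]] := cluster_kernel mphi phi0 phi_int rho_lt1.
split; first exact: (covariation_cvg mpp mu0 mphi phi0 phi_int mart rho_lt1 kap_mass).
move=> D u D0; apply/matrixP => i j.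
exact: (limit_cov_equiv mu0 mphi phi0 phi_int rho_lt1 u D0 kapE kap_int).
Qed.
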